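(* Let $p\in(\max\{m(n-h),1\},+\infty)$, $s\in\left(0,1-\frac{m(n-h)}{p}\right)$, let $\Omega\subset\mathbb{G}^n$ be open and bounded, let $g\in W^{s,p}(\mathbb{G}^n)$, and let $u\in W^{s,p}(\mathbb{G}^n)$ be a weak supersolution to the problem $\mathcal{L}u=0$ in $\Omega$, $u=g$ in $\mathbb{G}^n\setminus\Omega$, such that $u\ge0$ in $B_R\equiv B(x_0,R)\subset\Omega$. Then for any $B_r\equiv B(x_0,r)\subset B(x_0,R/2)$ and any $d>0$, $$\begin{aligned} &\int_{B_r}\int_{B_r}d_C(x,y)^{-Q-sp}\left|\log\left(\frac{u(x)+d}{u(y)+d}\right)\right|^p\,\mathrm{d}x\,\mathrm{d}y\\ \le{}& c\,r^{2n-Q-sp}\left(|x_0|_h+2r\right)^{m(n-h)}\\ &\times\left\{d^{1-p}\left(\frac rR\right)^{sp}r^{Q-n}\left[\mathrm{Tail}(u_-;x_0,R)\right]^{p-1}+\left(|x_0|_h+2r\right)^{m(n-h)}\right\}, \end{aligned}$$ where $u_-:=\max\{-u,0\}$ and $c$ depends only on $n,h,p,s$ and $m$.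
   Context: Grushin-type space. Let $n\ge h\ge 1$ be integers and $m\ge 0$ an integer, and write $\mathbb{R}^n=\mathbb{R}^h\times\mathbb{R}^{n-h}$. For $x=(x_1,\dots,x_n)$ put $|x|_h=\left(\sum_{i=1}^h x_i^2\right)^{1/2}$ and consider the vector fields $X_i=\partial/\partial x_i$ for $i=1,\dots,h$ and $X_{h+j}=|x|_h^m\,\partial/\partial x_{h+j}$ for $j=1,\dots,n-h$. Set $Q=n+m(n-h)$ and assume throughout $2n>Q$. The Carnot-Carathéodory distance is $d_C(p,q)=\inf_\gamma\int_0^1\|\gamma'(t)\|\,dt$, the infimum over (absolutely continuous) curves $\gamma:[0,1]\to\mathbb{R}^n$ with $\gamma(0)=p$, $\gamma(1)=q$ and $\gamma'(t)\in\mathrm{span}\{X_i(\gamma(t))\}_{i=1}^n$, where $\|\cdot\|$ is the horizontal norm $\|w\|=\min\{(\sum a_i^2)^{1/2}: w=\sum a_iX_i(\gamma(t))\}$. $\mathbb{G}^n$ is $\mathbb{R}^n$ with the metric $d_C$ and Lebesgue measure $\mathrm{d}x$; $B(x_0,r)=\{x\in\mathbb{G}^n: d_C(x,x_0)<r\}$. Function spaces ($p\ge1$, $s\in(0,1)$). $W^{s,p}(\mathbb{G}^n)$ is the set of $u\in L^p(\mathbb{G}^n)$ with $\int_{\mathbb{G}^n}\int_{\mathbb{G}^n}\frac{|u(x)-u(y)|^p}{d_C(x,y)^{Q+sp}}\,\mathrm{d}x\,\mathrm{d}y<\infty$. $W^{s,p}_0(\Omega)$ is the set of $v\in W^{s,p}(\mathbb{G}^n)$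 with $v=0$ a.e. in $\mathbb{G}^n\setminus\Omega$. Weak supersolutions. Formally $\mathcal{L}u(x)=\mathrm{P.V.}\int_{\mathbb{G}^n}\frac{|u(x)-u(y)|^{p-2}(u(x)-u(y))}{d_C(x,y)^{Q+sp}}\,\mathrm{d}y$. Given $g\in W^{s,p}(\mathbb{G}^n)$, a function $u\in W^{s,p}(\mathbb{G}^n)$ with $(g-u)_+\in W^{s,p}_0(\Omega)$ (where $a_+=\max\{a,0\}$) is a weak supersolution to $\mathcal{L}u=0$ in $\Omega$, $u=g$ in $\mathbb{G}^n\setminus\Omega$, if $$\int_{\mathbb{G}^n}\int_{\mathbb{G}^n}d_C(x,y)^{-Q-sp}|u(x)-u(y)|^{p-2}(u(x)-u(y))(\eta(x)-\eta(y))\,\mathrm{d}x\,\mathrm{d}y\ge 0$$ for every nonnegative $\eta\in W^{s,p}_0(\Omega)$ (with $|a|^{p-2}a$ read as $0$ at $a=0$). Nonlocal tail: $\mathrm{Tail}(v;x_0,R)=\left[R^{sp}\int_{\mathbb{G}^n\setminus B(x_0,R)}|v(x)|^{p-1}d_C(x,x_0)^{-Q-sp}\,\mathrm{d}x\right]^{\frac1{p-1}}$. *)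

(* Defs.v *)
From HB Require Import structures.
From mathcomp Require Import all_boot all_order all_algebra.
From mathcomp Require Import all_classical all_reals all_analysis.
Import Order.TTheory GRing.Theory Num.Theory.
Import numFieldNormedType.Exports.

Set Implicit Arguments.
Unset Strict Implicit.
Unset Printing Implicit Defensive.

Local Open Scope classical_set_scope.
Local Open Scope ring_scope.

(* Points of R^n. [measurableTypeR R] is [R] with its Borel sigma-algebra, so
   that n-tuples carry the library's product sigma-algebra, i.e. the Borel sets
   of R^n. *)
Notation eucl R n := (n.-tuple (measurableTypeR R)).

Section lebesgue_tuple.
Context {R : realType}.

Definition tuple_cons n (z : measurableTypeR R * eucl R n) : eucl R n.+1 :=
  [tuple of z.1 :: z.2].

Lemma measurable_tuple_cons n : measurable_fun [set: _] (@tuple_cons n).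
Proof. exact: measurable_cons. Qed.

Section step.
Variables (n : nat) (nu : {sigma_finite_measure set (eucl R n) -> \bar R}).

Definition lebesgue_step : set (eucl R n.+1) -> \bar R :=
  pushforward (lebesgue_measure \x nu)%E (@tuple_cons n).

Let step0 : lebesgue_step set0 = 0%E.
Proof. by rewrite /lebesgue_step /pushforward preimage_set0 measure0. Qed.

Let step_ge0 A : (0 <= lebesgue_step A)%E.
Proof. by rewrite /lebesgue_step /pushforward; exact: measure_ge0. Qed.

Let step_sigma_additive : semi_sigma_additive lebesgue_step.
Proof.
move=> F mF tF mUF; rewrite /lebesgue_step /pushforward preimage_bigcup.
have mpre A : measurable A -> measurable (@tuple_cons n @^-1` A).
  by move=> mA; rewrite -[X in measurable X]setTI; exact: measurable_tuple_cons.
apply: measure_semi_sigma_additive.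
- by move=> k; exact: mpre.
- apply/trivIsetP => /= i j _ _ ij; rewrite -preimage_setI.
  by move/trivIsetP : tF => /(_ _ _ _ _ ij) ->//; rewrite preimage_set0.
- by rewrite -preimage_bigcup; exact: mpre.
Qed.

HB.instance Definition _ := isMeasure.Build _ _ _ lebesgue_step
  step0 step_ge0 step_sigma_additive.

Let step_sigma_finite : sigma_finite setT lebesgue_step.
Proof.
have /sigma_finiteP[F [TF ndF Foo]] := sigma_finiteT (@lebesgue_measure R).
have /sigma_finiteP[G [TG ndG Goo]] := sigma_finiteT nu.
pose uncons (x : eucl R n.+1) : measurableTypeR R * eucl R n :=
  (thead x, [tuple of behead x]).
have muncons : measurable_fun setT uncons.
  apply/measurable_fun_pair; first exact: measurable_tnth.
  exact: measurable_behead.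
have consK z : uncons (tuple_cons z) = z.
  by case: z => a t; congr pair; apply/val_inj.
exists (fun k => uncons @^-1` (F k `*` G k)).
  apply/esym; rewrite -subTset => x _.
  have [k _ Fk] : (\bigcup_k F k) (uncons x).1 by rewrite -TF.
  have [l _ Gl] : (\bigcup_k G k) (uncons x).2 by rewrite -TG.
  exists (maxn k l) => //; split.
    by move: Fk; exact/subsetPset/ndF/leq_maxl.
  by move: Gl; exact/subsetPset/ndG/leq_maxr.
move=> k; have [mF Fk] := Foo k; have [mG Gk] := Goo k; split.
  by rewrite -[X in measurable X]setTI; apply: muncons => //;
    exact: measurableX.
rewrite /lebesgue_step /pushforward.
rewrite (_ : @tuple_cons n @^-1` _ = F k `*` G k).
  by rewrite product_measure1E// lte_mul_pinfty// ge0_fin_numE.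
by apply/seteqP; split => z; rewrite /preimage /mkset consK.
Qed.

HB.instance Definition _ := Measure_isSigmaFinite.Build _ _ _ lebesgue_step
  step_sigma_finite.

End step.

(* Lebesgue measure on R^n as the n-fold product of the measure on R. *)
Fixpoint lebesgue_tuple n : {sigma_finite_measure set (eucl R n) -> \bar R} :=
  match n with
  | 0 => \d_([tuple] : eucl R 0)
  | n'.+1 => lebesgue_step (lebesgue_tuple n')
  end.

End lebesgue_tuple.

Definition absolutely_continuous {R : realType} (a b : R) (f : R -> R) :=
  forall e : R, 0 < e -> exists2 delta : R, 0 < delta &
    forall (k : nat) (I : 'I_k -> R * R),
      (forall i, [&& a <= (I i).1, (I i).1 <= (I i).2 & (I i).2 <= b]) ->
      (forall i j, i != j -> ((I i).2 <= (I j).1) || ((I j).2 <= (I i).1)) ->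
      \sum_i ((I i).2 - (I i).1) < delta ->
      \sum_i `|f (I i).2 - f (I i).1| < e.

Section grushin_space.
Context {R : realType} {n : nat}.
Variables (h m : nat).
Implicit Types (x y : eucl R n) (w : 'rV[R]_n) (gamma : R -> eucl R n).

Definition hom_dim : nat := n + m * (n - h).

Definition normh x : R := Num.sqrt (\sum_(i < n | (i < h)%N) tnth x i ^+ 2).

Definition grushin_field (i : 'I_n) x : 'rV[R]_n :=
  (if (i < h)%N then 1 else normh x ^+ m) *: delta_mx 0 i.

Definition horizontal_coeffs x w : set ('I_n -> R) :=
  [set a | w = \sum_i a i *: grushin_field i x].

(* The minimum is attained when [w] is horizontal; +oo otherwise. *)
Definition hnorm x w : \bar R :=
  ereal_inf [set (Num.sqrt (\sum_i a i ^+ 2))%:E | a in horizontal_coeffs x w].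

Definition curve_coord gamma (i : 'I_n) (t : R) : R := tnth (gamma t) i.

Definition velocity gamma (t : R) : 'rV[R]_n :=
  \row_i derive1 (curve_coord gamma i) t.

Definition horizontal_curve x y gamma :=
  [/\ gamma 0 = x, gamma 1 = y,
      forall i, absolutely_continuous 0 1 (curve_coord gamma i) &
      {ae @lebesgue_measure R, forall t, t \in `]0, 1[ ->
         (forall i, derivable (curve_coord gamma i) t 1) /\
         horizontal_coeffs (gamma t) (velocity gamma t) !=set0}].

Definition curve_length gamma : \bar R :=
  (\int[lebesgue_measure]_(t in `[0%R, 1%R])
     hnorm (gamma t) (velocity gamma t))%E.

(* When [0 < h <= n] any two points are joined by a horizontal curve of finite
   length, so that [fine] does not alter the infimum. *)
Definition cc_dist x y : R :=
  fine (ereal_inf [set curve_length gamma | gamma in horizontal_curve x y]).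

Definition cc_ball x (r : R) : set (eucl R n) := [set y | cc_dist y x < r].

Definition cc_open (A : set (eucl R n)) :=
  forall x, A x -> exists2 e : R, 0 < e & cc_ball x e `<=` A.

Definition cc_bounded (A : set (eucl R n)) :=
  exists x, exists r : R, A `<=` cc_ball x r.

Section sobolev.
Variables (p s : R).
Implicit Types (u v g eta : eucl R n -> R) (A : set (eucl R n)).
Local Notation mu := (@lebesgue_tuple R n).

(* [powR 0 a = 0] for [a != 0]: the kernel is 0 on the (null) diagonal. *)
Definition cc_kernel x y : R := cc_dist x y `^ (- (hom_dim%:R + s * p)).

Definition frac_sobolev u :=
  u \in Lfun mu p%:E /\
  (\int[mu]_y \int[mu]_x (`|u x - u y| `^ p * cc_kernel x y)%:E < +oo)%E.

Definition frac_sobolev0 A v :=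
  frac_sobolev v /\ {ae mu, forall x, ~ A x -> v x = 0}.

Definition weak_supersolution A g u :=
  [/\ frac_sobolev g, frac_sobolev u, frac_sobolev0 A (g \- u)^\+ &
    forall eta, frac_sobolev0 A eta -> {ae mu, forall x, 0 <= eta x} ->
      (0 <= \int[mu]_y \int[mu]_x (cc_kernel x y *
         (`|u x - u y| `^ (p - 2) * (u x - u y)) * (eta x - eta y))%:E)%E].

Definition nonlocal_tail v x0 (r : R) : \bar R :=
  (((r `^ (s * p))%:E * \int[mu]_(x in ~` cc_ball x0 r)
      (`|v x| `^ (p - 1) * cc_kernel x x0)%:E) `^ (p - 1)^-1)%E.

End sobolev.
End grushin_space.

Arguments hom_dim : clear implicits.

(* Main.v *)
Require Import Defs.
From mathcomp Require Import all_boot all_order all_algebra.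
From mathcomp Require Import all_classical all_reals all_analysis.
From mathcomp Require Import measurable_realfun.
From mathcomp Require Import ring lra.
Import Order.TTheory GRing.Theory Num.Theory.
Import numFieldNormedType.Exports.

(** The supersolution inequality is tested with
    [eta = phi ^ p * (u^+ + d) ^ (1 - p)], where [phi] is a Lipschitz cut-off
    equal to [1] on the ball of radius [r] and to [0] outside the ball of radius
    [3 / 2 * r]. The inequality says that a double integral of a kernel times
    [|u x - u y| ^ (p - 2) * (u x - u y) * (eta x - eta y)] is nonnegative,
    while this integrand can be bounded from above at each pair of points.

    Write [a = u x + d] and [b = u y + d]. If both points lie in the large ball,
    where [u >= 0], the integrand is at most a multiple of
    [|phi x - phi y| ^ p] times the kernel ([jmap_caccioppoli]). If both lie in
    the small ball, [phi = 1] at both, and the convexity of the exponential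
    bounds it by a negative multiple of [|ln (a / b)| ^ p] times the kernel
    ([jmap_log]). If [y] lies outside the large ball and [eta x] does not
    vanish, then [d_C x y] is comparable to [d_C y x0], and besides the energy
    of [phi] only the negative part of [u y] contributes ([jmap_far]).
    Integrating these bounds ([pointwise_estimate]) and using that the whole
    form is nonnegative, one can estimate the logarithmic integral by the energy
    of [phi] plus the tail times the volume of the support of [phi]
    ([logarithmic_estimate]).

    The energy of [phi] is estimated in [cutoff_energy_le]. As [phi] is
    [2 / r]-Lipschitz for the Carnot-Caratheodory distance, [|phi x - phi y| ^ p]
    is at most the minimum of [1] and [(2 * d_C x y / r) ^ p], and the integral
    in one variable is computed on dyadic balls ([integral_cut_kernel]). Since a
    ball of radius [rho] around [x] has volume at most a multiple of
    [rho ^ n * (|x|_h + rho) ^ (m (n - h))] ([volume_cc_ball]), the small balls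
    contribute a convergent series exactly when [m (n - h) + s p < p], which is
    the upper bound assumed on [s], and the large ones because [s > 0]. The same
    energy bound shows that [eta] is an admissible test function
    ([test_frac_sobolev]).

    What is needed on the distance is its symmetry and triangle inequality,
    its finiteness and continuity, and the inclusion of balls in boxes. The
    first two come from reversing and concatenating curves ([horizontal_rev],
    [horizontal_cat]), the next ones from explicit curves that step away from
    the set where the vertical fields degenerate ([cc_edist_le]), and the last
    one from integrating the velocity along a curve, that is, from the
    inequality between the increments of an absolutely continuous function and
    the integral of its speed ([absolutely_continuous_le]). *)

Set Implicit Arguments.
Unset Strict Implicit.
Unset Printing Implicit Defensive.

Local Open Scope classical_set_scope.
Local Open Scope ring_scope.


(** * Inequalities between real powers *)

Section power_inequalities.
Context {R : realType}.
Implicit Types (a b p q x t al be : R).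

(** Young's inequality for the product [(1 - x) * 1]. *)
Lemma bernoulli_powR q x : 1 <= q -> 0 <= x <= 1 -> 1 - q * x <= (1 - x) `^ q.
Proof.
move=> q1 /andP[x0 x1].
have [->|q_neq1] := eqVneq q 1; first by rewrite mul1r powRr1// subr_ge0.
have {q1 q_neq1}q1 : 1 < q by rewrite lt_neqAle eq_sym q_neq1.
have q0 : 0 < q by lra.
have qc : 0 < q / (q - 1) by rewrite divr_gt0//; lra.
have conj : q^-1 + (q / (q - 1))^-1 = 1.
  by rewrite invf_div; field; lra.
have := @conjugate_powR R (1 - x) 1 q _ _ _ q0 qc conj.
rewrite subr_ge0 x1 ler01 => /(_ isT isT).
rewrite powR1 mulr1 invf_div mul1r => H.
have {}H : q * (1 - x) <= q * ((1 - x) `^ q / q + (q - 1) / q).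
  by rewrite ler_pM2l.
have E : q * ((1 - x) `^ q / q + (q - 1) / q) = (1 - x) `^ q + (q - 1).
  by field; lra.
rewrite E in H; lra.
Qed.

(** Bernoulli's inequality with [1 - x = be / al]. *)
Lemma powRB_le p al be : 1 <= p -> 0 <= be -> be <= al ->
  al `^ p - be `^ p <= p * al `^ (p - 1) * (al - be).
Proof.
move=> p1 be0 ba; have [al0|al0] := leP al 0.
  have -> : al = 0 by apply/eqP; rewrite eq_le al0 (le_trans be0).
  have -> : be = 0 by apply/eqP; rewrite eq_le be0 (le_trans ba).
  by rewrite !subrr mulr0.
pose x := (al - be) / al.
have x01 : 0 <= x <= 1.
  apply/andP; split; first by rewrite divr_ge0 ?subr_ge0 // ltW.
  by rewrite /x ler_pdivrMr// mul1r gerBl.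
have bE : be = al * (1 - x) by rewrite /x; field; lra.
have := bernoulli_powR p1 x01 => B.
rewrite [in be `^ p]bE powRM; [|lra|lra].
have -> : p * al `^ (p - 1) * (al - be) = p * al `^ p * x.
  rewrite -(@mulr_powRB1 _ al p); [|lra|lra]; rewrite /x; field; lra.
have := powR_ge0 al p => A.
suff : 0 <= al `^ p * ((1 - x) `^ p - (1 - p * x)) by lra.
by apply: mulr_ge0 => //; lra.
Qed.

Lemma powRD_le q a b : 0 <= q -> 0 <= a -> 0 <= b ->
  (a + b) `^ q <= 2 `^ q * (a `^ q + b `^ q).
Proof.
move=> q0 a0 b0; wlog ab : a b a0 b0 / a <= b => [H|].
  have [ab|/ltW ba] := leP a b; first exact: H.
  by rewrite addrC [a `^ q + _]addrC; exact: H.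
rewrite (@le_trans _ _ ((2 * b) `^ q))//.
  by apply: ge0_ler_powR; rewrite ?nnegrE//; lra.
by rewrite powRM// ler_wpM2l ?powR_ge0// lerDr powR_ge0.
Qed.

(** Through this bound the test function inherits the fractional regularity
    of the supersolution. *)
Lemma powR_neg_lipschitz p d a b : 1 < p -> 0 < d -> d <= a -> d <= b ->
  `|a `^ (1 - p) - b `^ (1 - p)| <= p * d `^ (- p) * `|a - b|.
Proof.
move=> p1 d0; wlog ab : a b / a <= b => [H|].
  have [ab|/ltW ba] := leP a b; first exact: H.
  by move=> da db; rewrite distrC [`|a - b|]distrC; exact: H.
move=> da db.
have a0 : 0 < a by lra.
have b0 : 0 < b by lra.
have mono : b `^ (1 - p) <= a `^ (1 - p).
  have -> : 1 - p = - (p - 1) by lra.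
  rewrite !powRN lef_pV2 ?posrE ?powR_gt0//.
  by apply: ge0_ler_powR; rewrite ?nnegrE//; lra.
rewrite [X in X <= _]ger0_norm ?subr_ge0// distrC [`|b - a|]ger0_norm ?subr_ge0//.
(* compare with the power p, to which Bernoulli applies *)
have bernoulli : b `^ p - a `^ p <= p * b `^ (p - 1) * (b - a).
  by apply: powRB_le => //; lra.
have Da : a `^ (1 - p) = a * a `^ (- p).
  by rewrite powRD ?powRr1//; [lra|apply/implyP => _; lra].
have Db : b `^ (1 - p) = b * b `^ (- p).
  by rewrite powRD ?powRr1//; [lra|apply/implyP => _; lra].
have Db' : b `^ (p - 1) = b `^ p / b.
  by rewrite powRD ?powR_inv1//; [lra|apply/implyP => _; lra].
have Pa := powR_gt0 p a0; have Pb := powR_gt0 p b0; have Pd := powR_gt0 p d0.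
have dap : d `^ p <= a `^ p by apply: ge0_ler_powR; rewrite ?nnegrE//; lra.
rewrite Da Db !powRN.
rewrite Db' in bernoulli.
have step : a / a `^ p - b / b `^ p <= p * (b - a) / a `^ p.
  rewrite -(ler_pM2r Pa) mulrBl !mulfVK ?gt_eqF//.
  have : a * a `^ p <= b * a `^ p by rewrite ler_pM2r.
  have {}bernoulli : (b `^ p - a `^ p) * (b / b `^ p) <= p * (b - a).
    have := bernoulli; rewrite -(ler_pM2r (divr_gt0 b0 Pb)) => /le_trans; apply.
    by rewrite le_eqVlt; apply/orP; left; apply/eqP; field; lra.
  have : (b `^ p - a `^ p) * (b / b `^ p) = b - b / b `^ p * a `^ p.
    by field; lra.
  lra.
apply: le_trans step _.
rewrite mulrAC ler_wpM2r ?subr_ge0// ler_wpM2l ?lef_pV2 ?posrE//; lra.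
Qed.

(** With [tau = ln (a / b)] the two factors on the right are
    [2 sinh (tau / 2)] to the power [p - 1] and [2 sinh ((p - 1) tau / 2)],
    up to exponentials that cancel; both are bounded below linearly. *)
Lemma log_powR_le p a b : 1 < p -> 0 < b -> b <= a ->
  (p - 1) * (ln (a / b) / 2) `^ p <=
  (a - b) `^ (p - 1) * (b `^ (1 - p) - a `^ (1 - p)).
Proof.
move=> p1 b0 ba; have a0 : 0 < a by lra.
have [s sdef] : exists s, s = ln (a / b) / 2 by eexists.
have s0 : 0 <= s by rewrite sdef divr_ge0// ln_ge0// ler_pdivlMr// mul1r.
pose E := expR s; have E1 : 1 <= E by rewrite /E -expR0 ler_expR.
have E0 : 0 < E by lra.
have sE : s <= E - E^-1.
  have : E^-1 <= 1 by rewrite invf_le1.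
  by have := expR_ge1Dx s; rewrite -/E; lra.
have aE : a = b * E * E.
  rewrite -mulrA -expRD; have -> : s + s = ln (a / b) by rewrite sdef; lra.
  by rewrite lnK ?posrE ?divr_gt0//; field; lra.
pose F := E `^ (p - 1).
have F0 : 0 < F by exact: powR_gt0.
have Fge : 1 + (p - 1) * s <= F.
  have -> : F = expR ((p - 1) * s) by rewrite /F /powR gt_eqF// /E expRK.
  exact: expR_ge1Dx.
have ps0 : 0 <= (p - 1) * s by rewrite mulr_ge0//; lra.
have F1 : (p - 1) * s <= F - F^-1.
  have : F^-1 <= 1 by rewrite invf_le1//; lra.
  lra.
rewrite -sdef.
have -> : a - b = b * E * (E - E^-1) by rewrite aE; field; lra.
have V y : 0 < y -> y `^ (1 - p) = (y `^ (p - 1))^-1.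
  by move=> y0; rewrite -powRN; congr powR; lra.
rewrite !V// aE !powRM; try nra.
rewrite -/F.
set B := b `^ (p - 1); have B0 : 0 < B by exact: powR_gt0.
have -> : B * F * (E - E^-1) `^ (p - 1) * (B^-1 - (B * F * F)^-1) =
    (E - E^-1) `^ (p - 1) * (F - F^-1) by field; lra.
have [s_eq0|s_neq0] := eqVneq s 0.
  have -> : (p - 1) * s `^ p = 0 by rewrite s_eq0 powR0 ?mulr0//; lra.
  by rewrite mulr_ge0 ?powR_ge0//; lra.
rewrite -(@mulr_powRB1 _ s p); [|lra|lra].
rewrite mulrA [X in X <= _]mulrC; apply: ler_pM; rewrite ?powR_ge0//.
by apply: ge0_ler_powR; rewrite ?nnegrE; lra.
Qed.

(** Here [t] stands for the quotient of two values of the supersolution. The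
    second factor is positive only if [(be / al) ^ p <= t ^ (p - 1)], and by
    Bernoulli's inequality this forces [1 - t <= p / (p - 1) * (1 - be / al)];
    then both factors are controlled by [al - be]. *)
Lemma caccioppoli_ratio_le p t al be : 1 < p -> 0 < t <= 1 -> 0 <= al -> 0 <= be ->
  (1 - t) `^ (p - 1) * (al `^ p - be `^ p * t `^ (1 - p)) <=
  p * (p / (p - 1)) `^ (p - 1) * `|al - be| `^ p.
Proof.
move=> p1 /andP[t0 t1] al0 be0.
have C0 : 0 <= p * (p / (p - 1)) `^ (p - 1) * `|al - be| `^ p.
  by rewrite !mulr_ge0 ?powR_ge0//; lra.
pose G := t `^ (p - 1).
have G0 : 0 < G by exact: powR_gt0.
have G1 : G <= 1.
  have : t `^ (p - 1) <= 1 `^ (p - 1) by apply: ge0_ler_powR; rewrite ?nnegrE; lra.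
  by rewrite powR1.
have -> : t `^ (1 - p) = G^-1 by rewrite -powRN; congr powR; lra.
have G1' : 1 <= G^-1 by rewrite invf_ge1.
have Bp := powR_ge0 be p.
have [neg|pos] := leP (al `^ p - be `^ p / G) 0.
  by apply: le_trans C0; rewrite mulr_ge0_le0 ?powR_ge0.
have ba : be < al.
  rewrite ltNge; apply/negP => ab.
  have : al `^ p <= be `^ p by apply: ge0_ler_powR; rewrite ?nnegrE//; lra.
  have : be `^ p <= be `^ p / G by rewrite ler_peMr.
  lra.
have al_gt0 : 0 < al by lra.
pose q := p / (p - 1).
have q1 : 1 <= q by rewrite /q ler_pdivlMr; lra.
pose x := (al - be) / al.
have x01 : 0 <= x <= 1.
  apply/andP; split; first by rewrite divr_ge0 ?subr_ge0 // ltW.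
  by rewrite /x ler_pdivrMr// mul1r gerBl.
have bE : be = al * (1 - x) by rewrite /x; field; lra.
(* positivity of the bracket forces [t] above [(be / al) ^ q] *)
have xt : (1 - x) `^ q <= t.
  have : (1 - x) `^ p <= G.
    move: pos; rewrite subr_gt0 ltr_pdivrMr// {1}bE powRM; [|lra|lra].
    by rewrite ltr_pM2l ?powR_gt0// => /ltW.
  move=> H; have -> : t = G `^ ((p - 1)^-1).
    by rewrite -powRrM divff ?powRr1//; lra.
  rewrite /q powRrM; apply: ge0_ler_powR; rewrite ?nnegrE ?powR_ge0 ?(ltW G0)//.
  by rewrite invr_ge0; lra.
have tx : 1 - t <= q * x by have := bernoulli_powR q1 x01; lra.
have x0 : 0 < x by rewrite divr_gt0//; lra.
rewrite [`|_|]gtr0_norm; last lra.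
have -> : p * q `^ (p - 1) * (al - be) `^ p =
    (q * x) `^ (p - 1) * (p * al `^ (p - 1) * (al - be)).
  have -> : al - be = al * x by rewrite /x; field; lra.
  have -> : (al * x) `^ p = al * x * (al `^ (p - 1) * x `^ (p - 1)).
    rewrite -powRM ?mulr_powRB1//; [exact: mulr_ge0 al0 (ltW x0)|lra|exact: ltW].
  have -> : (q * x) `^ (p - 1) = q `^ (p - 1) * x `^ (p - 1).
    apply: powRM; [lra|exact: ltW].
  ring.
apply: ler_pM; rewrite ?powR_ge0//; first exact: ltW.
- by apply: ge0_ler_powR; rewrite ?nnegrE; nra.
- apply: le_trans (powRB_le _ be0 (ltW ba)); last lra.
  have : be `^ p <= be `^ p / G by rewrite ler_peMr.
  lra.
Qed.

End power_inequalities.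

(** * Integrals of functions that need not be measurable *)

Section lower_integral.
Context d (T : measurableType d) (R : realType).
Variable mu : {measure set T -> \bar R}.
Local Open Scope ereal_scope.
Import HBNNSimple.

(** The integral of a nonnegative function is a supremum over the simple
    functions below it, hence monotone on arbitrary functions. The length of a
    curve is such an integral: [hnorm] is uncontrolled on a null set. *)
Lemma ge0_le_lower_integral (D : set T) (f g : T -> \bar R) :
  (forall x, D x -> 0 <= f x) -> (forall x, D x -> f x <= g x) ->
  \int[mu]_(x in D) f x <= \int[mu]_(x in D) g x.
Proof.
move=> f0 fg; rewrite !ge0_integralE//; last first.
  by move=> x Dx; exact: le_trans (f0 _ Dx) (fg _ Dx).
apply: le_ereal_sup => _ [k /= kf <-]; exists k => //= x.
apply: le_trans (kf x) _; rewrite /patch; case: ifPn => // xD.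
by apply: fg; rewrite inE in xD.
Qed.

(** The null set is removed from the simple functions below [f], which are
    measurable even when [f] is not. *)
Lemma ae_le_lower_integral (D N : set T) (f g : T -> \bar R) :
  measurable D -> measurable N -> mu N = 0 -> measurable_fun D g ->
  (forall x, D x -> 0 <= f x) -> (forall x, D x -> 0 <= g x) ->
  (forall x, D x -> ~ N x -> f x <= g x) ->
  \int[mu]_(x in D) f x <= \int[mu]_(x in D) g x.
Proof.
move=> mD mN N0 mg f0 g0 fg; rewrite ge0_integralE//.
apply: ge_ereal_sup => _ [k /= kf <-].
have mgD : @measurable_fun _ _ T (\bar R) setT (g \_ D).
  by apply/(measurable_restrictT _ _).1.
have gD0 x : 0 <= (g \_ D) x by exact: erestrict_ge0.
rewrite -integralT_nnsfun (integral_mkcond D).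
rewrite (ge0_negligible_integral mN)//; last 2 first.
- exact/measurable_EFinP.
- by move=> x _; rewrite lee_fin.
rewrite [leRHS](ge0_negligible_integral mN)//.
apply: ge0_le_integral => //.
- exact: measurableD.
- by move=> x _; rewrite lee_fin.
- by apply/measurable_funTS/measurable_EFinP.
- exact: measurable_funTS.
- move=> x [_ Nx]; apply: le_trans (kf x) _; rewrite /patch; case: ifPn => // xD.
  by apply: fg => //; rewrite inE in xD.
Qed.

End lower_integral.

(** * Covering arguments on the real line *)

Section interval_induction.
Context {R : realType}.

(** Cousin's covering principle; the supremum of the [x] with [P a x] can only
    be [b]. *)
Lemma interval_induction (P : R -> R -> Prop) (a b : R) : a <= b ->
  (forall x y z, a <= x -> x <= y -> y <= z -> z <= b -> P x y -> P y z -> P x z) ->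
  (forall t, a <= t <= b -> exists2 e : R, 0 < e &
    forall x y, a <= x -> x <= t -> t <= y -> y <= b -> y - x < e -> P x y) ->
  P a b.
Proof.
move=> ab Ptrans Ploc; pose S := [set x | a <= x <= b /\ P a x].
have Sa : S a.
  split; first by rewrite lexx.
  have [|e e0 Pe] := Ploc a; first by rewrite lexx.
  by apply: Pe => //; rewrite subrr.
have Sub : ubound S b by move=> x [/andP[]].
have supS : has_sup S by split; [exists a|exists b].
have as_ : a <= sup S by apply: ub_le_sup; [exists b|].
have sb : sup S <= b by apply: ge_sup; [exists a|].
have [|e e0 Pe] := Ploc (sup S); first by rewrite as_.
have e4 : 0 < e / 4 by rewrite divr_gt0.
have [x [/andP[ax xb] Pax] xs] := sup_adherent e4 supS.
have xsup : x <= sup S by apply: ub_le_sup; [exists b|split; [rewrite ax|]].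
pose s := Num.min b (sup S + e / 4).
have sS : sup S <= s by rewrite /s le_min sb/=; lra.
have Ps : P a s.
  apply: (Ptrans a x s) => //; first exact: le_trans xsup sS.
    by rewrite /s ge_min lexx.
  apply: Pe => //; first by rewrite /s ge_min lexx.
  have : s <= sup S + e / 4 by rewrite /s ge_min lexx orbT.
  lra.
have : s <= sup S.
  apply: ub_le_sup; first by exists b.
  by split => //; rewrite (le_trans as_ sS)/= /s ge_min lexx.
rewrite /s ge_min => /orP[bs|]; last by lra.
by move: Ps; rewrite /s min_l//; lra.
Qed.

End interval_induction.

Section local_majorant.
Context {R : realType}.
Local Notation lambda := (@lebesgue_measure R).
Local Notation RR := (measurableTypeR R).

Let level (g : RR -> R) (e : R) (k : nat) : set RR :=
  `[0, 1]%classic `&` [set t | k%:R * e <= g t < k.+1%:R * e].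

Let measurable_level g e k : measurable_fun setT g -> measurable (level g e k).
Proof.
move=> mg; apply: measurableI => //.
have -> : [set t | k%:R * e <= g t < k.+1%:R * e] =
    g @^-1` `[k%:R * e, k.+1%:R * e[%classic.
  by apply/seteqP; split => t; rewrite /= in_itv.
by rewrite -[X in measurable X]setTI; exact: mg.
Qed.

Let level_cover g e : 0 < e -> (forall t, 0 <= g t) ->
  \bigcup_k level g e k = `[0, 1]%classic.
Proof.
move=> e0 g0; apply/seteqP; split => [t [k _] []//|t t01].
exists (Num.truncn (g t / e)) => //; split => //=.
have ge0 : 0 <= g t / e by rewrite divr_ge0// ltW.
have /andP[] := truncn_itv ge0.
by rewrite ler_pdivlMr// ltr_pdivrMr// => -> ->.
Qed.

Let level_trivIset g e : 0 < e -> trivIset setT (level g e).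
Proof.
move=> e0; apply/trivIsetP => i j _ _ ij; rewrite -subset0 => t /=.
move=> [[_ /andP[it ti]] [_ /andP[jt tj]]].
have H k l : k%:R * e <= g t -> g t < l.+1%:R * e -> (k <= l)%N.
  move=> kt tl; have := le_lt_trans kt tl.
  by rewrite ltr_pM2r// ltr_nat ltnS.
by move: ij; rewrite eqn_leq (H _ _ it tj) (H _ _ jt ti).
Qed.

(** A weak form of the Vitali-Caratheodory theorem, obtained by covering the
    level sets of [g] by slightly larger open sets: around each point [w]
    dominates the value of [g] there, at a small cost in the integral. *)
Lemma local_majorant (g : RR -> R) (e : R) :
  measurable_fun setT g -> (forall t, 0 <= g t) -> 0 < e ->
  exists w : RR -> \bar R, [/\ measurable_fun setT w,
    forall t, (0 <= w t)%E,
    forall t : R, t \in `[0, 1] -> exists2 rho : R, 0 < rho &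
      forall y : R, `|y - t| < rho -> ((g t + e)%:E <= w y)%E &
    (\int[lambda]_t w t <= \int[lambda]_(t in `[0%R, 1%R]) (g t)%:E + (3 * e)%:E)%E].
Proof.
move=> mg g0 e0.
have mE k := measurable_level e k mg.
have Efin k : (lambda (level g e k) < +oo)%E.
  apply: (@le_lt_trans _ _ (lambda `[0%R, 1%R])).
    by apply: le_measure; rewrite ?inE// => t [].
  by rewrite lebesgue_measure_itv/= lte_fin ltr01 ltry.
(* [c k] bounds [g + e] on the level [k] and is at most [g + 2 * e] there *)
pose c k : R := k.+2%:R * e.
have c0 k : 0 < c k by rewrite mulr_gt0.
(* the excess of the open sets then costs at most [e] in total *)
pose dl k := e / (2 ^ k.+1)%:R / c k.
have dl0 k : 0 < dl k by rewrite !divr_gt0// ltr0n expn_gt0.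
have exU k : exists U : set R, [/\ open U, level g e k `<=` U &
    (lambda (U `\` level g e k) < (dl k)%:E)%E].
  exact: (@lebesgue_regularity_outer R _ _ (mE k) (Efin k) (dl0 k)).
pose O k : set RR := sval (cid (exU k)).
have OP k : [/\ open (O k), level g e k `<=` O k &
    (lambda (O k `\` level g e k) < (dl k)%:E)%E] by exact: (svalP (cid (exU k))).
have mO k : measurable (O k).
  by have [oO _ _] := OP k; exact: (@open_measurable R).
pose u k (t : RR) : \bar R := (c k * \1_(O k) t)%:E.
have u0 k t : (0 <= u k t)%E by rewrite lee_fin mulr_ge0// ltW.
have mu_ k : measurable_fun setT (u k).
  by apply/measurable_EFinP; apply: measurable_funM => //; exact: measurable_indic.
exists (fun t => \sum_(k <oo) u k t)%E; split.
- exact: ge0_emeasurable_sum.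
- by move=> t; apply: nneseries_ge0.
- move=> t t01; have : (\bigcup_k level g e k) t by rewrite level_cover.
  move=> [k _ Ekt]; have [oO EO _] := OP k.
  have /nbhs_ballP[rho /= rho0 Brho] := open_nbhs_nbhs (conj oO (EO _ Ekt)).
  exists rho => // y yt; have Oy : O k y by apply: Brho; rewrite /ball/= distrC.
  apply: (@le_trans _ _ (u k y)).
    rewrite /u indicE mem_set// mulr1 lee_fin /c.
    move: Ekt => [_ /andP[_ /ltW]]; rewrite -[k.+2%:R]natr1 mulrDl mul1r; lra.
  rewrite (@nneseriesD1 _ (u ^~ y) k)//.
  by rewrite leeDl//; apply: nneseries_ge0.
- rewrite integral_nneseries//.
  have int_u k : (\int[lambda]_t u k t <=
      \int[lambda]_(t in level g e k) (g t + 2 * e)%:E + (e / (2 ^ k.+1)%:R)%:E)%E.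
    have -> : (\int[lambda]_t u k t = (c k)%:E * lambda (O k))%E.
      under eq_integral do rewrite /u EFinM.
      rewrite ge0_integralZl//; last by rewrite lee_fin ltW.
        by rewrite integral_indic// setIT.
      by apply/measurable_EFinP; exact: measurable_indic.
    have [oO EO HO] := OP k.
    have -> : lambda (O k) = (lambda (level g e k) + lambda (O k `\` level g e k))%E.
      by rewrite -measureU//; [rewrite setDUK|exact: measurableD|rewrite setDIK].
    rewrite ge0_muleDr//; apply: leeD.
      rewrite -integral_cst//; apply: ge0_le_integral => //.
      - by move=> t _; rewrite lee_fin ltW.
      - apply/measurable_EFinP; apply: measurable_funD => //.
        exact: measurable_funTS.
      - move=> t [_ /andP[kt _]]; rewrite lee_fin /c.
        by rewrite -[k.+2%:R]natr1 -[k.+1%:R]natr1 !mulrDl; lra.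
    apply: (@le_trans _ _ ((c k)%:E * (dl k)%:E)%E).
      by rewrite lee_pmul2l// ?lte_fin// ltW.
    rewrite -EFinM lee_fin /dl mulrC divfK//.
    exact: lt0r_neq0.
  apply: (@le_trans _ _ (\sum_(k <oo) (\int[lambda]_(t in level g e k)
      (g t + 2 * e)%:E + (e / (2 ^ k.+1)%:R)%:E))%E).
    apply: lee_nneseries => // k _ _; exact: integral_ge0.
  have i0 k : (0 <= \int[lambda]_(t in level g e k) (g t + 2 * e)%:E)%E.
    by apply: integral_ge0 => t _; rewrite lee_fin addr_ge0// mulr_ge0// ltW.
  apply: le_trans (epsilon_trick _ i0 (ltW e0)) _.
  rewrite -ge0_integral_bigcup//; last 3 first.
  - apply/measurable_EFinP; apply: measurable_funD => //.
    exact: measurable_funTS.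
  - by move=> t _; rewrite lee_fin addr_ge0// mulr_ge0// ltW.
  - exact: level_trivIset.
  rewrite level_cover//.
  under eq_integral do rewrite EFinD.
  rewrite ge0_integralD//; last 3 first.
  - by move=> t _; rewrite lee_fin.
  - by apply/measurable_EFinP; exact: measurable_funTS.
  - by move=> t _; rewrite lee_fin mulr_ge0// ltW.
  rewrite integral_cst; last exact: measurable_itv.
  have l01 : lambda `[0%R, 1%R]%classic = 1%E.
    by rewrite lebesgue_measure_itv/= lte_fin ltr01 -EFinB subr0.
  rewrite [X in (_ + _ * X + _)%E](_ : _ = 1%E)// mule1.
  by rewrite -addeA -EFinD leeD2l// lee_fin; lra.
Qed.

End local_majorant.

(** * Absolutely continuous functions *)

Section absolute_continuity.
Context {R : realType}.
Local Notation lambda := (@lebesgue_measure R).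
Local Notation RR := (measurableTypeR R).
Implicit Types (f : R -> R) (t x y e : R).

Lemma derivable_approx f t e : derivable f t 1 -> 0 < e ->
  exists2 rho : R, 0 < rho & forall h, `|h| < rho ->
    `|f (t + h) - f t - derive1 f t * h| <= e * `|h|.
Proof.
move=> df e0; rewrite derive1E.
have {}df : (fun h => h^-1 *: ((f \o shift t) (h *: 1) - f t)) @ 0^' --> 'D_1 f t.
  exact: df.
move/cvgrPdist_le : df => /(_ _ e0) /nbhs_ballP[rho /= rho0 Brho].
exists rho => // h hrho; have [->|h0] := eqVneq h 0.
  by rewrite addr0 subrr mulr0 subr0 normr0 mulr0.
have /= := Brho h; rewrite /ball/= sub0r normrN => /(_ hrho h0).
rewrite /shift/= (_ : h *: 1 = h); last by rewrite /GRing.scale/= mulr1.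
rewrite [h^-1 *: _]/(h^-1 * _) [h + t]addrC => H.
have -> : f (t + h) - f t - 'D_1 f t * h = - (h * ('D_1 f t - h^-1 * (f (t + h) - f t))).
  by field.
by rewrite normrN normrM mulrC ler_wpM2r.
Qed.

Definition clamp t : R := Num.min 1 (Num.max 0 t).

Lemma clamp_id t : 0 <= t <= 1 -> clamp t = t.
Proof. by move=> /andP[t0 t1]; rewrite /clamp max_r// min_r. Qed.

Lemma clamp_itv t : 0 <= clamp t <= 1.
Proof. by rewrite /clamp le_min ler01 le_max lexx ge_min lexx. Qed.

Lemma clamp_homo x y : x <= y -> clamp x <= clamp y.
Proof.
move=> xy; rewrite /clamp le_min ge_min lexx/= ge_min; apply/orP; right.
by rewrite ge_max !le_max lexx xy orbT.
Qed.

Lemma clamp_lip x y : x <= y -> clamp y - clamp x <= y - x.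
Proof.
by move=> xy; rewrite /clamp /Num.min /Num.max; do 4 case: ifPn => //; rewrite -?leNgt; lra.
Qed.

Lemma ac_uniform f e : absolutely_continuous 0 1 f -> 0 < e ->
  exists2 dl : R, 0 < dl & forall x y, 0 <= x -> x <= y -> y <= 1 -> y - x < dl ->
    `|f y - f x| < e.
Proof.
move=> acf e0; have [dl dl0 H] := acf _ e0; exists dl => // x y x0 xy y1 yx.
have := H 1%N (fun=> (x, y)); rewrite !big_ord1/=; apply => //.
- by move=> _; rewrite x0 xy.
- by move=> i j; rewrite !ord1.
Qed.

Lemma ac_clamp_continuous f : absolutely_continuous 0 1 f -> continuous (f \o clamp).
Proof.
move=> acf t; apply/cvgrPdist_lt => e e0.
have [dl dl0 H] := ac_uniform acf e0.
near=> y; have ty : `|t - y| < dl.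
  by near: y; by apply/nbhs_ballP; exists dl.
have [cx0 cx1] := andP (clamp_itv t); have [cy0 cy1] := andP (clamp_itv y).
have [yt|/ltW yt] := leP y t.
  apply: H => //; first exact: clamp_homo.
  by apply: le_lt_trans (clamp_lip yt) _; move: ty; rewrite ger0_norm// subr_ge0.
rewrite /= distrC; apply: H => //; first exact: clamp_homo.
by apply: le_lt_trans (clamp_lip yt) _; move: ty; rewrite distrC ger0_norm// subr_ge0.
Unshelve. all: by end_near. Qed.

(** In the open interval the derivative is the limit of difference quotients of
    the clamped function, which is continuous on the whole line. *)
Lemma measurable_ac_speed f (N : set RR) : absolutely_continuous 0 1 f -> measurable N ->
  (forall t, t \in `]0, 1[ -> ~ N t -> derivable f t 1) ->
  measurable_fun (`]0, 1[%classic `\` N : set RR) (fun t : RR => derive1 f t : R).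
Proof.
move=> acf mN df.
pose q k (t : RR) : R := k.+1%:R * ((f \o clamp) (t + k.+1%:R^-1) - (f \o clamp) t).
have mF : measurable_fun setT (f \o clamp : RR -> R).
  exact (@continuous_measurable_fun R _ (ac_clamp_continuous acf)).
have mq k : measurable_fun setT (q k).
  apply: measurable_funM => //; apply: measurable_funB => //.
  apply: (@measurableT_comp _ _ _ _ _ _ (f \o clamp : RR -> R)) => //.
  by apply: measurable_funD.
apply: (@measurable_fun_cvg _ _ _ _ q).
  by move=> k; exact: measurable_funTS.
move=> t [t01 Nt]; rewrite /= in_itv/= in t01; have /andP[t0 t1] := t01.
apply/cvgrPdist_le => e e0.
have [|rho rho0 H] := derivable_approx (df t _ Nt) e0; first by rewrite in_itv.
have m0 : 0 < Num.min rho (1 - t) by rewrite lt_min rho0 subr_gt0.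
near=> k; have kp : k.+1%:R^-1 < Num.min rho (1 - t).
  near: k; exact: near_infty_natSinv_lt (PosNum m0).
move: kp; rewrite lt_min => /andP[krho kt].
have ki : 0 < k.+1%:R^-1 :> R by rewrite invr_gt0.
rewrite /q /= !clamp_id; [|by rewrite !ltW|apply/andP; split]; last 2 first.
- by rewrite addr_ge0 ?(ltW t0) ?(ltW ki).
- by rewrite -lerBrDl ltW.
have := H k.+1%:R^-1; rewrite gtr0_norm// => /(_ krho) {}H.
have -> : derive1 f t - k.+1%:R * (f (t + k.+1%:R^-1) - f t) =
   - (k.+1%:R * (f (t + k.+1%:R^-1) - f t - derive1 f t * k.+1%:R^-1)).
  by rewrite [in RHS]mulrBr mulrCA divff// mulr1 opprB.
rewrite normrN normrM gtr0_norm//.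
rewrite -(@ler_pM2l _ k.+1%:R^-1)// mulrA mulVf// mul1r [leRHS]mulrC.
Unshelve. all: by end_near. Qed.

Lemma itv_oc_setU x y z : x <= y -> y <= z ->
  `]x, y] `|` `]y, z] = `]x, z]%classic :> set R.
Proof.
move=> xy yz; apply/seteqP; split => t; rewrite /= !in_itv/=.
  by move=> [/andP[h1 h2]|/andP[h1 h2]]; apply/andP; split; lra.
by move=> /andP[h1 h2]; have [ty|ty] := leP t y; [left|right]; apply/andP; split; lra.
Qed.

Lemma itv_oc_setI x y z : `]x, y] `&` `]y, z] = set0 :> set R.
Proof.
rewrite -subset0 => t; rewrite /= !in_itv/= => -[/andP[_ ty] /andP[yt _]].
by move: yt; rewrite ltNge ty.
Qed.

Lemma distr_telescope x y z : `|z - x| <= `|y - x| + `|z - y|.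
Proof. by rewrite (_ : z - x = (y - x) + (z - y)) ?ler_normD//; ring. Qed.

Lemma derivable_le_local f t r e : derivable f t 1 -> `|derive1 f t| <= r -> 0 < e ->
  exists2 rho : R, 0 < rho & forall x y, x <= t -> t <= y -> y - x < rho ->
    `|f y - f x| <= (r + e) * (y - x).
Proof.
move=> df dr e0; have [rho rho0 Hrho] := derivable_approx df e0.
exists rho => // x y xt ty yx.
have H s : `|s - t| < rho -> `|f s - f t| <= (r + e) * `|s - t|.
  move=> st; have := Hrho _ st; rewrite [t + _]addrC subrK => h.
  have -> : f s - f t = derive1 f t * (s - t) + (f s - f t - derive1 f t * (s - t)) by lra.
  apply: le_trans (ler_normD _ _) _; rewrite mulrDl lerD// normrM.
  by rewrite ler_wpM2r.
have ey : `|y - t| = y - t by rewrite ger0_norm// subr_ge0.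
have ex : `|x - t| = t - x by rewrite distrC ger0_norm// subr_ge0.
have := H y; have := H x; rewrite ex ey => Hx Hy.
have {}Hx : `|f x - f t| <= (r + e) * (t - x) by apply: Hx; lra.
have {}Hy : `|f y - f t| <= (r + e) * (y - t) by apply: Hy; lra.
have := distr_telescope (f x) (f t) (f y); rewrite [`|f t - _|]distrC; lra.
Qed.

(** Cousin's principle applied to the relation [P] below. Near a point where
    [f] is differentiable, its increments are bounded by the integral of a
    local majorant of its speed. Near a point of the exceptional null set they
    are recorded as they stand: they belong to disjoint intervals inside an
    open set of small measure, so that absolute continuity makes their sum
    small. *)
Lemma absolutely_continuous_le f (G : R -> \bar R) (a b : R) :
  absolutely_continuous 0 1 f -> (forall t, 0 <= G t)%E ->
  {ae lambda, forall t : RR, t \in `]0, 1[ ->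
    derivable f t 1 /\ (`|derive1 f t|%:E <= G t)%E} ->
  0 <= a -> a <= b -> b <= 1 ->
  (`|f b - f a|%:E <= \int[lambda]_(t in `[0%R, 1%R]) G t)%E.
Proof.
move=> acf G0 [N [mN N0 HN]] a0 ab b1.
pose D : set RR := `]0, 1[%classic `\` N.
have mD : measurable D by apply: measurableD => //; exact: measurable_itv.
have DP t : D t -> derivable f t 1 /\ (`|derive1 f t|%:E <= G t)%E.
  move=> [t01 Nt]; apply: contrapT => H; apply: Nt; apply: HN => /= H'.
  by apply: H; exact: H'.
pose g : RR -> R := (fun t => `|derive1 f t|) \_ D.
have g0 t : 0 <= g t by rewrite /g /patch; case: ifP.
have mg : measurable_fun setT g.
  apply/(measurable_restrictT _ _).1 => //.
  apply: (@measurableT_comp _ _ _ _ _ _ (Num.norm : R -> R)) => //.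
  apply: measurable_ac_speed => // t t01 Nt; have [] := DP t => //; split => //.
apply: (@le_trans _ _ (\int[lambda]_(t in `[0%R, 1%R]) (g t)%:E)%E); last first.
  apply: ge0_le_lower_integral => t _; first by rewrite lee_fin.
  rewrite /g /patch; case: ifPn => //; rewrite inE => Dt.
  by have [] := DP t Dt.
apply/lee_addgt0Pr => e e0.
have e4 : 0 < e / 4 by rewrite divr_gt0.
have [w [mw w0 wloc wint]] := local_majorant mg g0 e4.
have [dl dl0 Hdl] := acf _ e4.
pose N' : set RR := N `|` [set 0] `|` [set 1].
have mN' : measurable N' by apply: measurableU => //; exact: measurableU.
have N'0 : lambda N' = 0%E.
  have s0 (c : R) : lambda.-negligible [set c].
    by exists [set c]; split => //; exact: lebesgue_measure_set1.
  have [M [mM M0 NM]] : lambda.-negligible N'.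
    apply: negligibleU => //; apply: negligibleU => //.
    by exists N; split.
  by apply/eqP; rewrite eq_le measure_ge0 andbT -M0 le_measure ?inE.
have [|O [oO NO lO]] := @lebesgue_regularity_outer R N' dl mN' _ dl0.
  by rewrite [X in (X < _)%E]N'0.
have mO : @measurable _ RR O by exact: (@open_measurable R).
have lOdl : (lambda O < dl%:E)%E.
  have -> : O = N' `|` (O `\` N') by rewrite setDUK.
  rewrite measureU//; [|exact: measurableD|by rewrite setDIK].
  by rewrite [X in (X + _)%E](N'0 : _ = 0%E) add0e.
have mI x y : @measurable _ RR `]x, y]%classic by exact: measurable_itv.
pose nonov k (I : 'I_k -> R * R) :=
  forall i j, i != j -> ((I i).2 <= (I j).1) || ((I j).2 <= (I i).1).
(* the intervals [I] are those on which the derivative gives no control *)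
pose P x y := exists k (I : 'I_k -> R * R),
  [/\ forall i, [&& x <= (I i).1, (I i).1 <= (I i).2 & (I i).2 <= y], nonov k I,
      ((\sum_i ((I i).2 - (I i).1))%:E <= lambda (O `&` `]x, y]))%E &
      (`|f y - f x|%:E <= \int[lambda]_(t in `]x, y]) w t +
         (\sum_i `|f (I i).2 - f (I i).1|)%:E)%E].
have Ptrans x y z : a <= x -> x <= y -> y <= z -> z <= b -> P x y -> P y z -> P x z.
  move=> ax xy yz zb [k [I [Ib Inov Il If]]] [l [J [Jb Jnov Jl Jf]]].
  pose K (i : 'I_(k + l)) : R * R :=
    match fintype.split i with inl i' => I i' | inr j => J j end.
  have KL i : K (lshift l i) = I i by rewrite /K (unsplitK (inl i)).
  have KR i : K (rshift k i) = J i by rewrite /K (unsplitK (inr i)).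
  have sumK (F : R * R -> R) : \sum_i F (K i) = \sum_i F (I i) + \sum_i F (J i).
    by rewrite big_split_ord; congr (_ + _); apply: eq_bigr => i _; rewrite ?KL ?KR.
  have xyz : `]x, y] `|` `]y, z] = `]x, z]%classic :> set R by exact: itv_oc_setU.
  have xyz0 : `]x, y] `&` `]y, z] = set0 :> set R by exact: itv_oc_setI.
  exists (k + l)%N, K; split.
  - move=> i; case: (split_ordP i) => j ->; rewrite ?KL ?KR.
      by have /and3P[-> -> h] := Ib j; rewrite /= (le_trans h).
    by have /and3P[h -> ->] := Jb j; rewrite !andbT (le_trans xy).
  - move=> i j; case: (split_ordP i) => i' ->; case: (split_ordP j) => j' -> ij;
      rewrite ?KL ?KR.
    + by apply: Inov; apply: contra ij => /eqP ->.
    + by have /and3P[_ _ h] := Ib i'; have /and3P[h' _ _] := Jb j'; rewrite (le_trans h h').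
    + by have /and3P[_ _ h] := Ib j'; have /and3P[h' _ _] := Jb i'; rewrite (le_trans h h') orbT.
    + by apply: Jnov; apply: contra ij => /eqP ->.
  - rewrite (sumK (fun q => q.2 - q.1)) -xyz setIUr measureU; [|exact: measurableI|exact: measurableI|].
      by rewrite EFinD leeD.
    by rewrite setIACA xyz0 setI0.
  - rewrite (sumK (fun q => `|f q.2 - f q.1|)) -xyz ge0_integral_setU//; [|exact: measurable_funTS|by apply/disj_setPS; rewrite xyz0].
    rewrite EFinD addeACA; apply: le_trans (leeD If Jf).
    by rewrite -EFinD lee_fin; exact: distr_telescope.
have Ploc t : a <= t <= b -> exists2 e : R, 0 < e &
    forall x y, a <= x -> x <= t -> t <= y -> y <= b -> y - x < e -> P x y.
  move=> /andP[at_ tb]; have [N't|N't] := pselect (N' t).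
    have /nbhs_ballP[rho /= rho0 Brho] := open_nbhs_nbhs (conj oO (NO _ N't)).
    exists rho => // x y ax xt ty yb yx.
    exists 1%N, (fun=> (x, y)); rewrite !big_ord1/=; split.
    - by move=> _; rewrite !lexx/= (le_trans xt).
    - by move=> i j; rewrite !ord1.
    - rewrite (_ : O `&` _ = `]x, y]%classic); last first.
        apply/setIidPr => s; rewrite /= in_itv/= => /andP[xs sy].
        apply: Brho; rewrite /ball/= ltr_norml; clear - xt ty yx xs sy.
        by apply/andP; split; lra.
      rewrite lebesgue_measure_itv/= lte_fin; case: ifPn => // xy.
      by rewrite lee_fin; clear - xy; lra.
    - by rewrite leeDr// integral_ge0.
  have Dt : D t.
    have t01 : 0 <= t <= 1 by rewrite (le_trans a0)//= (le_trans tb).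
    split.
      rewrite /= in_itv/= !lt_neqAle; have /andP[-> ->] := t01.
      by rewrite !andbT; apply/andP; split; apply/eqP => tE; apply: N't;
        [left; right|right]; rewrite /= tE.
    by move=> Nt; apply: N't; left; left.
  have gt : `|derive1 f t| <= g t by rewrite /g /patch mem_set.
  have [rho rho0 Hrho] := derivable_le_local (DP t Dt).1 gt e4.
  have [|rho' rho'0 Hw] := wloc t.
    by rewrite in_itv/= (le_trans a0)//= (le_trans tb).
  exists (Num.min rho rho'); first by rewrite lt_min rho0.
  move=> x y ax xt ty yb; rewrite lt_min => /andP[yx yx'].
  exists 0%N, (fun=> (x, x)); rewrite !big_ord0 adde0; split => //; try by case.
  apply: (@le_trans _ _ ((g t + e / 4) * (y - x))%:E).
    by rewrite lee_fin; exact: Hrho.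
  apply: (@le_trans _ _ (\int[lambda]_(s in `]x, y]) (cst (g t + e / 4)%:E s))%E).
    rewrite integral_cst; last exact: mI.
    rewrite [X in (_ <= _ * X)%E](_ : _ = (y - x)%:E) ?EFinM//.
    have := lebesgue_measure_itv `]x, y]; rewrite /= lte_fin => ->.
    case: ifPn => [_|]; first by rewrite -EFinB.
    by rewrite -leNgt => yx''; congr EFin; apply/eqP; rewrite eq_sym subr_eq0 eq_le yx'' (le_trans xt).
  apply: ge0_le_lower_integral => s; rewrite /= in_itv/= => /andP[xs sy].
    by rewrite lee_fin addr_ge0// ltW.
  apply: Hw; rewrite ltr_norml; clear - xt ty yx' xs sy.
  by apply/andP; split; lra.
have [k [I [Ib Inov Il If]]] := interval_induction ab Ptrans Ploc.
apply: (le_trans If).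
have Ie : \sum_i `|f (I i).2 - f (I i).1| < e / 4.
  apply: Hdl => //.
    by move=> i; have /and3P[h1 -> h2] := Ib i; rewrite (le_trans a0)//= (le_trans h2).
  rewrite -lte_fin; apply: le_lt_trans Il _; apply: le_lt_trans lOdl.
  by apply: le_measure; rewrite ?inE//; exact: measurableI.
apply: (@le_trans _ _ (\int[lambda]_t w t + (e / 4)%:E)%E).
  by apply: leeD; [exact: ge0_subset_integral|rewrite lee_fin ltW].
apply: le_trans (leeD2r _ wint) _.
by rewrite -addeA -EFinD leeD2l// lee_fin; clear - e0; lra.
Qed.

End absolute_continuity.

(** * Affine reparametrization *)

Section affine_change_of_variable.
Context {R : realType}.
Local Notation lambda := (@lebesgue_measure R).
Local Notation RR := (measurableTypeR R).
Implicit Types (c e : R).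

Definition affine c e (t : RR) : RR := c * t + e.

Lemma measurable_affine c e : measurable_fun setT (affine c e).
Proof. by apply: measurable_funD => //; apply: measurable_funM. Qed.

Let lebesgue_affine_gt0 c e (A : set RR) : 0 < c -> measurable A ->
  lambda (affine c e @^-1` A) = (c^-1%:E * lambda A)%E.
Proof.
move=> c0 mA; have c0' : 0 <= c by exact: ltW.
(* [pose] abstracts over the proof that [affine c e] is measurable *)
pose nu := mscale (NngNum c0') (pushforward lambda (affine c e)).
have nuE B : measurable B -> lambda B = nu (measurable_affine c e) B.
  move=> mB; apply: lebesgue_measure_unique mB => _ [[a b] _ <-].
  rewrite /nu /= /mscale /= /pushforward.
  rewrite (_ : affine c e @^-1` _ = `](a - e) / c, (b - e) / c]%classic); last first.
    apply/seteqP; split => t; rewrite /affine /= !in_itv/=;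
    by rewrite ltr_pdivrMr// ler_pdivlMr// ltrBlDr lerBrDr mulrC.
  rewrite !lebesgue_measure_itv/= !lte_fin ltr_pM2r ?invr_gt0// ltrD2r.
  case: ifPn => _; rewrite ?mule0// -EFinM; congr EFin.
  by field; rewrite gt_eqF.
by rewrite [in RHS]nuE// /nu /mscale/= muleA -EFinM mulVf ?gt_eqF// mul1e.
Qed.

Lemma lebesgue_affine c e (A : set RR) : c != 0 -> measurable A ->
  lambda (affine c e @^-1` A) = (`|c|^-1%:E * lambda A)%E.
Proof.
rewrite neq_lt => /orP[c0|c0] mA; last first.
  by rewrite gtr0_norm// lebesgue_affine_gt0.
rewrite ltr0_norm//.
have -> : affine c e @^-1` A = (-%R : _ -> RR) @^-1` (affine (- c) e @^-1` A).
  by apply/seteqP; split => t; rewrite /affine /= mulrNN.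
have := @lebesgue_measureN R (affine (- c) e @^-1` A).
rewrite /pushforward => ->; first by rewrite lebesgue_affine_gt0 ?oppr_gt0.
by rewrite -[X in measurable X]setTI; exact: measurable_affine.
Qed.

Lemma integral_affine c e (D : set RR) (f : RR -> \bar R) : c != 0 ->
  measurable D -> measurable_fun D f -> (forall t, 0 <= f t)%E ->
  (\int[lambda]_(t in affine c e @^-1` D) (`|c|%:E * f (affine c e t)) =
   \int[lambda]_(t in D) f t)%E.
Proof.
move=> c0 mD mf f0.
have mphi := measurable_affine c e.
have mpre : measurable (affine c e @^-1` D).
  by rewrite -[X in measurable X]setTI; exact: mphi.
have mfphi : measurable_fun (affine c e @^-1` D) (fun t => f (affine c e t)).
  by apply: (measurable_comp mD _ mf); [by move=> _ [t Dt <-]|exact: measurable_funTS].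
have c0' : 0 <= `|c|^-1 by rewrite invr_ge0.
rewrite ge0_integralZl//.
rewrite -[X in (_ * X)%E](ge0_integral_pushforward mphi)//.
rewrite (@eq_measure_integral _ _ _ _ (mscale (NngNum c0') lambda)); last first.
  by move=> A mA _; rewrite /= /pushforward lebesgue_affine.
by rewrite ge0_integral_mscale//= muleA -EFinM divff ?normr_eq0// mul1e.
Qed.

End affine_change_of_variable.

Section derivative_of_reparametrization.
Context {R : realType}.
Implicit Types (f g : R -> R) (t c l : R).

Lemma approx_derivable f t l :
  (forall e, 0 < e -> exists2 rho : R, 0 < rho & forall k, `|k| < rho ->
    `|f (t + k) - f t - l * k| <= e * `|k|) ->
  derivable f t 1 /\ derive1 f t = l.
Proof.
move=> H; suff L : (fun k => k^-1 *: ((f \o shift t) (k *: 1) - f t)) @ 0^' --> l.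
  split; first by apply/cvg_ex; exists l.
  by rewrite derive1E; apply/cvg_lim.
apply/cvgrPdist_le => e e0; have [rho rho0 Hrho] := H _ e0.
apply/nbhs_ballP; exists rho => //= k; rewrite /ball/= sub0r normrN => krho k0.
rewrite /shift/= (_ : k *: 1 = k); last by rewrite /GRing.scale/= mulr1.
rewrite [k^-1 *: _]/(k^-1 * _) [k + t]addrC.
have -> : l - k^-1 * (f (t + k) - f t) = - (k^-1 * (f (t + k) - f t - l * k)).
  by field.
rewrite normrN normrM normfV ler_pdivrMl ?normr_gt0//.
by apply: le_trans (Hrho _ krho) _; rewrite mulrC.
Qed.

(** Differentiation is local, so that each half of a concatenated curve is
    differentiated as a reparametrization of one of the two curves. *)
Lemma derive_affine f g c e C t : c != 0 -> derivable f (affine c e t) 1 ->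
  (exists2 rho : R, 0 < rho & forall y, `|y - t| < rho -> g y = f (affine c e y) + C) ->
  derivable g t 1 /\ derive1 g t = c * derive1 f (affine c e t).
Proof.
move=> c0 df [r r0 gf]; apply: approx_derivable => eps eps0.
have ec : 0 < eps / `|c| by rewrite divr_gt0 ?normr_gt0.
have [rho rho0 Hrho] := derivable_approx df ec.
exists (Num.min r (rho / `|c|)); first by rewrite lt_min r0 divr_gt0 ?normr_gt0.
move=> k; rewrite lt_min => /andP[kr krho].
rewrite !gf; [|by rewrite subrr normr0|by rewrite addrC addKr].
have -> : affine c e (t + k) = affine c e t + c * k by rewrite /affine; ring.
have ck : `|c * k| < rho by rewrite normrM mulrC -ltr_pdivlMr ?normr_gt0.
have h := Hrho _ ck.
have -> : eps * `|k| = eps / `|c| * `|c * k| by rewrite normrM mulrA divfK ?normr_eq0.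
apply: le_trans h; rewrite le_eqVlt; apply/orP; left; apply/eqP; congr `|_|.
ring.
Qed.

End derivative_of_reparametrization.

Section absolute_continuity_closure.
Context {R : realType}.
Implicit Types (f g tau : R -> R).

Lemma ac_lipschitz f L : (forall x y, 0 <= x -> x <= y -> y <= 1 ->
  `|f y - f x| <= L * (y - x)) -> absolutely_continuous 0 1 f.
Proof.
move=> H e e0; pose L' := `|L| + 1.
have L'0 : 0 < L' by rewrite ltr_wpDl.
exists (e / L') => [|k I Ib _ Il]; first by rewrite divr_gt0.
apply: (@le_lt_trans _ _ (L' * \sum_i ((I i).2 - (I i).1))).
  rewrite mulr_sumr; apply: ler_sum => i _; have /and3P[h1 h2 h3] := Ib i.
  apply: le_trans (H _ _ h1 h2 h3) _; rewrite ler_wpM2r ?subr_ge0//.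
  by rewrite (le_trans (ler_norm _))// lerDl.
by rewrite mulrC -ltr_pdivlMr.
Qed.

Lemma ac_add f g : absolutely_continuous 0 1 f -> absolutely_continuous 0 1 g ->
  absolutely_continuous 0 1 (fun t => f t + g t).
Proof.
move=> acf acg e e0; have e2 : 0 < e / 2 by rewrite divr_gt0.
have [d1 d10 H1] := acf _ e2; have [d2 d20 H2] := acg _ e2.
exists (Num.min d1 d2) => [|k I Ib In]; first by rewrite lt_min d10.
rewrite lt_min => /andP[l1 l2].
apply: (@le_lt_trans _ _ (\sum_i `|f (I i).2 - f (I i).1| + \sum_i `|g (I i).2 - g (I i).1|)).
  rewrite -big_split/=; apply: ler_sum => i _.
  rewrite (_ : f _ + g _ - _ = (f (I i).2 - f (I i).1) + (g (I i).2 - g (I i).1)); last by ring.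
  exact: ler_normD.
by have := H1 _ I Ib In l1; have := H2 _ I Ib In l2; lra.
Qed.

Lemma ac_cst (a : R) : absolutely_continuous 0 1 (fun=> a).
Proof. by apply: (@ac_lipschitz _ 0) => *; rewrite subrr normr0 mul0r. Qed.

Lemma ac_comp_homo f tau L : 0 < L -> absolutely_continuous 0 1 f ->
  (forall t, 0 <= tau t <= 1) ->
  (forall x y, x <= y -> tau x <= tau y <= tau x + L * (y - x)) ->
  absolutely_continuous 0 1 (f \o tau).
Proof.
move=> L0 acf tau01 tauL e e0; have [dl dl0 H] := acf _ e0.
exists (dl / L) => [|k I Ib In Il]; first by rewrite divr_gt0.
apply: (H k (fun i => (tau (I i).1, tau (I i).2))) => /=.
- move=> i; have /and3P[_ h _] := Ib i.
  have /andP[-> _] := tauL _ _ h.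
  by have /andP[-> _] := tau01 (I i).1; have /andP[_ ->] := tau01 (I i).2.
- move=> i j /In /orP[h|h]; apply/orP; [left|right];
  by have /andP[] := tauL _ _ h.
- apply: (@le_lt_trans _ _ (L * \sum_i ((I i).2 - (I i).1))).
    rewrite mulr_sumr; apply: ler_sum => i _; have /and3P[_ h _] := Ib i.
    by have /andP[_] := tauL _ _ h; rewrite lerBlDl.
  by rewrite mulrC -ltr_pdivlMr.
Qed.

Lemma ac_reverse f : absolutely_continuous 0 1 f ->
  absolutely_continuous 0 1 (fun t => f (1 - t)).
Proof.
move=> acf e e0; have [dl dl0 H] := acf _ e0.
exists dl => // k I Ib In Il.
rewrite (eq_bigr (fun i => `|f (1 - (I i).1) - f (1 - (I i).2)|)); last first.
  by move=> i _; rewrite distrC.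
apply: (H k (fun i => (1 - (I i).2, 1 - (I i).1))) => /=.
- by move=> i; have /and3P[h1 h2 h3] := Ib i; rewrite !subr_ge0 h3 lerD2l lerN2 h2 gerBl.
- move=> i j /In; rewrite !lerD2l !lerN2 orbC.
  by [].
- rewrite (eq_bigr (fun i => (I i).2 - (I i).1))// => i _; ring.
Qed.

End absolute_continuity_closure.

(** * Horizontal curves *)

Section almost_everywhere.
Context d (T : measurableType d) (R : realType).
Variable mu : {measure set T -> \bar R}.

Lemma ae_elim (P : T -> Prop) : {ae mu, forall t, P t} ->
  exists N, [/\ measurable N, mu N = 0%E & forall t, ~ N t -> P t].
Proof.
move=> [N [mN N0 HN]]; exists N; split => // t Nt.
by apply: contrapT => nP; apply: Nt; exact: HN.
Qed.

Lemma ae_intro (P : T -> Prop) N : measurable N -> mu N = 0%E ->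
  (forall t, ~ N t -> P t) -> {ae mu, forall t, P t}.
Proof.
move=> mN N0 H; exists N; split => // t /= nP.
by apply: contrapT => Nt; apply: nP; exact: H.
Qed.

End almost_everywhere.

Section horizontal_speed.
Context {R : realType} {n : nat}.
Variables (h m : nat).
Local Notation lambda := (@lebesgue_measure R).
Local Notation RR := (measurableTypeR R).
Implicit Types (x y z : eucl R n) (w : 'rV[R]_n) (gamma : R -> eucl R n).

Definition weight x (i : 'I_n) : R := if (i < h)%N then 1 else normh h x ^+ m.

Lemma normh_ge0 x : 0 <= normh h x.
Proof. exact: sqrtr_ge0. Qed.

Lemma weight_ge0 x i : 0 <= weight x i.
Proof. by rewrite /weight; case: ifP => // _; rewrite exprn_ge0// normh_ge0. Qed.

Lemma horizontal_coeffsP x w a :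
  horizontal_coeffs h m x w a <-> forall i, w 0 i = a i * weight x i.
Proof.
have E i : (\sum_j a j *: grushin_field h m j x) 0 i = a i * weight x i.
  rewrite summxE (bigD1 i)//= big1 ?addr0; last first.
    by move=> j ji; rewrite /grushin_field !mxE eq_sym (negbTE ji) mulr0 mulr0.
  by rewrite /grushin_field !mxE !eqxx mulr1.
split => [-> i//|H]; apply/rowP => i; rewrite E; exact: H.
Qed.

(** The coefficients of a horizontal vector are the quotients of its coordinates
    by the weights. Where a weight vanishes the coordinate does too, and the
    convention [0 / 0 = 0] selects the coefficient of least norm. *)
Definition speed x w : R := Num.sqrt (\sum_i (w 0 i / weight x i) ^+ 2).

Lemma hnorm_ge0 x w : (0 <= hnorm h m x w)%E.
Proof. by apply: le_ereal_inf_tmp => _ [a _ <-]; rewrite lee_fin sqrtr_ge0. Qed.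

Lemma hnorm_le x w a : (forall i, w 0 i = a i * weight x i) ->
  (hnorm h m x w <= (Num.sqrt (\sum_i a i ^+ 2))%:E)%E.
Proof.
by move=> wa; apply: ereal_inf_lbound; exists a => //; exact/horizontal_coeffsP.
Qed.

Lemma horizontal_div x w : horizontal_coeffs h m x w !=set0 ->
  forall i, w 0 i = w 0 i / weight x i * weight x i.
Proof.
move=> [a /horizontal_coeffsP wa] i; have [c0|c0] := eqVneq (weight x i) 0.
  by rewrite c0 mulr0 wa c0 mulr0.
by rewrite divfK.
Qed.

Lemma hnormE x w : horizontal_coeffs h m x w !=set0 ->
  hnorm h m x w = (speed x w)%:E.
Proof.
move=> H; apply/eqP; rewrite eq_le hnorm_le/=; last exact: horizontal_div.
apply: le_ereal_inf_tmp => _ [a /horizontal_coeffsP wa <-].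
rewrite lee_fin ler_sqrt ?sumr_ge0// => [|i _]; last exact: sqr_ge0.
apply: ler_sum => i _; rewrite wa; have [->|c0] := eqVneq (weight x i) 0.
  by rewrite mulr0 mul0r expr0n/= sqr_ge0.
by rewrite mulfK.
Qed.

Lemma speed_ge0 x w : 0 <= speed x w.
Proof. exact: sqrtr_ge0. Qed.

Lemma coord_le_sqrt_sum (a : 'I_n -> R) i : `|a i| <= Num.sqrt (\sum_j a j ^+ 2).
Proof.
rewrite -sqrtr_sqr ler_sqrt ?sumr_ge0// => [|j _]; last exact: sqr_ge0.
by rewrite (bigD1 i)//= lerDl sumr_ge0// => j _; exact: sqr_ge0.
Qed.

Lemma coord_le_speed x w i : horizontal_coeffs h m x w !=set0 ->
  `|w 0 i| <= weight x i * speed x w.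
Proof.
move=> H; rewrite (horizontal_div H i) normrM mulrC (ger0_norm (weight_ge0 _ _)).
apply: ler_wpM2l; first exact: weight_ge0.
exact: (coord_le_sqrt_sum (fun i => w 0 i / weight x i)).
Qed.

Lemma speedZ x w (c : R) : speed x (c *: w) = `|c| * speed x w.
Proof.
rewrite /speed -sqrtr_sqr -sqrtrM ?sqr_ge0// mulr_sumr; congr Num.sqrt.
by apply: eq_bigr => i _; rewrite mxE -mulrA exprMn.
Qed.

Lemma horizontal_coeffsZ x w (c : R) : horizontal_coeffs h m x w !=set0 ->
  horizontal_coeffs h m x (c *: w) !=set0.
Proof.
move=> [a /horizontal_coeffsP wa]; exists (fun i => c * a i).
by apply/horizontal_coeffsP => i; rewrite mxE wa mulrA.
Qed.

(** The exceptional null set of a curve may spoil the measurability of the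
    integrand of its length; a measurable majorant [v] makes changes of
    variable possible. *)
Definition speed_bound gamma (v : RR -> R) := [/\ measurable_fun setT v,
  forall t, 0 <= v t &
  {ae lambda, forall t : RR, t \in `]0, 1[ ->
    [/\ forall i, derivable (curve_coord gamma i) t 1,
        horizontal_coeffs h m (gamma t) (velocity gamma t) !=set0 &
        speed (gamma t) (velocity gamma t) <= v t]}].

Lemma curve_length_le gamma v : speed_bound gamma v ->
  (curve_length h m gamma <= \int[lambda]_(t in `[0%R, 1%R]) (v t)%:E)%E.
Proof.
move=> [mv v0 /ae_elim[N [mN N0 HN]]].
pose N' : set RR := N `|` [set 0] `|` [set 1].
have mN' : measurable N' by apply: measurableU => //; exact: measurableU.
have N'0 : lambda N' = 0%E.
  have s0 (c : R) : lambda.-negligible [set c].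
    by exists [set c]; split => //; exact: lebesgue_measure_set1.
  have [M [mM M0 NM]] : lambda.-negligible N'.
    apply: negligibleU => //; apply: negligibleU => //.
    by exists N; split.
  by apply/eqP; rewrite eq_le measure_ge0 andbT -M0 le_measure ?inE.
apply: (ae_le_lower_integral _ mN' N'0) => //.
- by apply/measurable_EFinP; exact: measurable_funTS.
- by move=> t _; exact: hnorm_ge0.
- by move=> t _; rewrite lee_fin.
move=> t; rewrite /= in_itv/= => t01 N't.
have t01' : t \in `]0, 1[.
  rewrite in_itv/= !lt_neqAle; have /andP[-> ->] := t01.
  by rewrite !andbT; apply/andP; split; apply/eqP => tE; apply: N't;
    [left; right|right]; rewrite /= tE.
have [|_ H1 H2] := HN t _ t01'; first by move=> Nt; apply: N't; left; left.
by rewrite hnormE.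
Qed.

Lemma measurable_invr : measurable_fun setT (fun t : R => `|t|^-1).
Proof.
rewrite (_ : (fun _ => _) = fun t : R => `|t| `^ (-1)).
  by apply: (@measurableT_comp _ _ _ _ _ _ (fun t : R => t `^ (-1))).
by apply/funext => t; rewrite powR_inv1.
Qed.

Lemma measurable_sqrt_abs : measurable_fun setT (fun t : R => Num.sqrt `|t|).
Proof.
rewrite (_ : (fun _ => _) = fun t : R => `|t| `^ (2^-1)).
  by apply: (@measurableT_comp _ _ _ _ _ _ (fun t : R => t `^ 2^-1)).
by apply/funext => t; rewrite powR12_sqrt.
Qed.

Lemma measurable_curve_speed gamma (N : set RR) :
  (forall i, absolutely_continuous 0 1 (curve_coord gamma i)) -> measurable N ->
  (forall t, t \in `]0, 1[ -> ~ N t -> forall i, derivable (curve_coord gamma i) t 1) ->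
  measurable_fun (`]0, 1[%classic `\` N : set RR)
    (fun t : RR => speed (gamma t) (velocity gamma t) : R).
Proof.
move=> acg mN dg; set D := (_ `\` _).
have mD : measurable D by apply: measurableD => //; exact: measurable_itv.
have mcoord i : measurable_fun D (fun t => curve_coord gamma i t).
  apply: (@eq_measurable_fun _ _ _ _ _ (curve_coord gamma i \o clamp)).
    move=> t; rewrite inE => -[/= + _]; rewrite in_itv/= => /andP[t0 t1].
    by rewrite /= clamp_id// !ltW.
  apply: measurable_funTS.
  exact (@continuous_measurable_fun R _ (ac_clamp_continuous (acg i))).
have mnormh : measurable_fun D (fun t => normh h (gamma t)).
  have -> : (fun t => normh h (gamma t)) =
      (fun t => Num.sqrt `|t|) \o
      (fun t => \sum_(i < n | (i < h)%N) curve_coord gamma i t ^+ 2).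
    apply/funext => t /=; rewrite /normh ger0_norm// sumr_ge0// => i _.
    exact: sqr_ge0.
  apply: (measurableT_comp measurable_sqrt_abs).
  under eq_fun do rewrite big_mkcond/=.
  apply: measurable_sum => i; case: (i < h)%N; last exact: measurable_cst.
  exact: measurable_funX.
have mweight i : measurable_fun D (fun t => weight (gamma t) i).
  rewrite /weight; case: (i < h)%N; first exact: measurable_cst.
  exact: measurable_funX.
have -> : (fun t => speed (gamma t) (velocity gamma t)) =
    (fun t => Num.sqrt `|t|) \o
    (fun t => \sum_i (derive1 (curve_coord gamma i) t * `|weight (gamma t) i|^-1) ^+ 2).
  apply/funext => t /=; rewrite /speed ger0_norm; last by apply: sumr_ge0 => i _; exact: sqr_ge0.
  congr Num.sqrt; apply: eq_bigr => i _.
  by rewrite ger0_norm ?weight_ge0// mxE.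
apply: (measurableT_comp measurable_sqrt_abs).
apply: measurable_sum => i; apply: measurable_funX.
apply: measurable_funM.
  by apply: measurable_ac_speed => // t t01 Nt; exact: dg.
apply: (@measurableT_comp _ _ _ _ _ _ (fun t : R => `|t|^-1)).
  exact: measurable_invr.
exact: mweight.
Qed.

(** The speed, set to [0] on the exceptional set, lies below [hnorm] everywhere. *)
Lemma horizontal_speed_bound x y gamma : horizontal_curve h m x y gamma ->
  exists2 v, speed_bound gamma v &
    (\int[lambda]_(t in `[0%R, 1%R]) (v t)%:E <= curve_length h m gamma)%E.
Proof.
move=> [_ _ acg /ae_elim[N [mN N0 HN]]].
pose D : set RR := `]0, 1[%classic `\` N.
have mD : measurable D by apply: measurableD => //; exact: measurable_itv.
have DP t : D t -> (forall i, derivable (curve_coord gamma i) t 1) /\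
    horizontal_coeffs h m (gamma t) (velocity gamma t) !=set0.
  by move=> [t01 Nt]; exact: HN.
pose v : RR -> R := (fun t => speed (gamma t) (velocity gamma t)) \_ D.
have vD t : D t -> v t = speed (gamma t) (velocity gamma t).
  by move=> Dt; rewrite /v /patch mem_set.
exists v.
  split.
  - apply/(measurable_restrictT _ _).1 => //.
    apply: measurable_curve_speed => // t t01 Nt.
    by have [] := DP t => //; split.
  - by move=> t; rewrite /v /patch; case: ifP => // _; exact: speed_ge0.
  - apply: (ae_intro mN N0) => t Nt t01; have Dt : D t by split.
    by have [d1 d2] := DP t Dt; split => //; rewrite vD.
apply: ge0_le_lower_integral => t _.
  by rewrite lee_fin /v /patch; case: ifP => // _; exact: speed_ge0.
rewrite /v /patch; case: ifPn => [|_]; last exact: hnorm_ge0.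
by rewrite inE => Dt; rewrite hnormE//; have [] := DP t Dt.
Qed.

End horizontal_speed.

Section curve_operations.
Context {R : realType} {n : nat}.
Variables (h m : nat).
Local Notation lambda := (@lebesgue_measure R).
Local Notation RR := (measurableTypeR R).
Implicit Types (x y z : eucl R n) (w : 'rV[R]_n) (gamma : R -> eucl R n).

Lemma null_affine (c e : R) (N : set RR) : c != 0 -> measurable N ->
  lambda N = 0%E ->
  measurable (affine c e @^-1` N) /\ lambda (affine c e @^-1` N) = 0%E.
Proof.
move=> c0 mN N0; split; last by rewrite lebesgue_affine// N0 mule0.
by rewrite -[X in measurable X]setTI; exact: measurable_affine.
Qed.

Let rev gamma : R -> eucl R n := fun t => gamma (1 - t).

Let affine_rev (t : R) : affine (-1) 1 t = 1 - t.
Proof. by rewrite /affine mulN1r addrC. Qed.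

Lemma horizontal_rev x y gamma : horizontal_curve h m x y gamma ->
  exists2 gamma', horizontal_curve h m y x gamma' &
    (curve_length h m gamma' <= curve_length h m gamma)%E.
Proof.
move=> H; have [v [mv v0 Hv] vl] := horizontal_speed_bound H.
have [g0 g1 acg _] := H.
have n1 : -1 != 0 :> R by rewrite oppr_eq0 oner_eq0.
have /ae_elim[N [mN N0 HN]] := Hv.
have [mN' N'0] := null_affine 1 n1 mN N0.
have velE t : t \in `]0, 1[ -> ~ (affine (-1) 1 @^-1` N) t ->
    (forall i, derivable (curve_coord (rev gamma) i) t 1) /\
    velocity (rev gamma) t = -1 *: velocity gamma (1 - t).
  move=> t01 Nt; have [|d1 _ _] := HN _ Nt.
    by rewrite affine_rev; move: t01; rewrite !in_itv/= subr_gt0 gtrBl => /andP[-> ->].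
  have K i := @derive_affine R (curve_coord gamma i) (curve_coord (rev gamma) i)
      (-1) 1 0 t n1 (d1 i).
  have {}K i : derivable (curve_coord (rev gamma) i) t 1 /\
      derive1 (curve_coord (rev gamma) i) t =
      -1 * derive1 (curve_coord gamma i) (affine (-1) 1 t).
    by apply: K; exists 1 => // s _; rewrite addr0 affine_rev.
  split=> [i|]; first by have [] := K i.
  by apply/rowP => i; rewrite !mxE (K i).2 affine_rev.
pose v' : RR -> R := fun t => v (affine (-1) 1 t).
have bound : forall t : R, ~ (affine (-1) 1 @^-1` N) t -> t \in `]0, 1[ ->
    [/\ forall i, derivable (curve_coord (rev gamma) i) t 1,
      horizontal_coeffs h m (rev gamma t) (velocity (rev gamma) t) !=set0 &
      speed h m (rev gamma t) (velocity (rev gamma) t) <= v' t].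
  move=> t Nt t01; have [d1 ->] := velE _ t01 Nt.
  have [|_ d2 d3] := HN _ Nt.
    by rewrite affine_rev; move: t01; rewrite !in_itv/= subr_gt0 gtrBl => /andP[-> ->].
  rewrite /v' /rev -affine_rev; split => //; first exact: horizontal_coeffsZ.
  by rewrite speedZ normrN1 mul1r.
have sb : speed_bound h m (rev gamma) v'.
  split; [|by move=> t; exact: v0|exact: (ae_intro mN' N'0)].
  by apply: (@measurableT_comp _ _ _ _ _ _ v) => //; exact: measurable_affine.
exists (rev gamma).
  split; [by rewrite /rev subr0|by rewrite /rev subrr|by move=> i; exact: (ac_reverse (acg i))|].
  by apply: (ae_intro mN' N'0) => t Nt t01; have [] := bound t Nt t01.
apply: le_trans (curve_length_le sb) _; apply: le_trans vl.
rewrite -(@integral_affine _ (-1) 1 _ (fun t => (v t)%:E))//.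
- rewrite normrN1 (_ : affine (-1) 1 @^-1` _ = `[0, 1]%classic).
    by under [leRHS]eq_integral do rewrite mul1e.
  apply/seteqP; split => t; rewrite /preimage/mkset !affine_rev /= !in_itv/=;
  by rewrite subr_ge0 gerBl andbC.
- by apply/measurable_EFinP; exact: measurable_funTS.
Qed.

Let preimage_half_left : affine 2 0 @^-1` `[0, 1[ = `[0, 1/2[%classic :> set RR.
Proof.
by apply/seteqP; split => t; rewrite /preimage /mkset /affine /= !in_itv/=;
  move=> /andP[h1 h2]; apply/andP; split; lra.
Qed.

Let preimage_half_right : affine 2 (-1) @^-1` `[0, 1] = `[1/2, 1]%classic :> set RR.
Proof.
by apply/seteqP; split => t; rewrite /preimage /mkset /affine /= !in_itv/=;
  move=> /andP[h1 h2]; apply/andP; split; lra.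
Qed.

(** Concatenation as a sum: on each half of the unit interval one of the two
    clamped curves rests at the common point [y], which is subtracted. Absolute
    continuity of the sum is then immediate. *)
Let cat gamma1 gamma2 y : R -> eucl R n := fun t =>
  [tuple curve_coord gamma1 i (clamp (affine 2 0 t)) +
         (curve_coord gamma2 i (clamp (affine 2 (-1) t)) - tnth y i) | i < n].

Let clamp_affine01 e t : 0 <= clamp (affine 2 e t : R) <= 1.
Proof. exact: clamp_itv. Qed.

Let clamp_affine_lip e (s t : R) : s <= t ->
  clamp (affine 2 e s) <= clamp (affine 2 e t) <= clamp (affine 2 e s) + 2 * (t - s).
Proof.
move=> st; have st' : affine 2 e s <= affine 2 e t by rewrite /affine; lra.
rewrite clamp_homo//=; have := clamp_lip st'; rewrite /affine; lra.
Qed.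

Let cat_left gamma1 gamma2 y (t : R) : gamma2 0 = y -> 0 <= t -> t <= 1/2 ->
  cat gamma1 gamma2 y t = gamma1 (affine 2 0 t).
Proof.
move=> g2 t0 t1; apply: eq_from_tnth => i; rewrite tnth_mktuple.
rewrite clamp_id; last by rewrite /affine; apply/andP; split; lra.
have -> : clamp (affine 2 (-1) t) = 0.
  by rewrite /clamp max_l ?min_r// /affine; lra.
by rewrite /curve_coord g2 subrr addr0.
Qed.

Let cat_right gamma1 gamma2 y (t : R) : gamma1 1 = y -> 1/2 <= t -> t <= 1 ->
  cat gamma1 gamma2 y t = gamma2 (affine 2 (-1) t).
Proof.
move=> g1 t0 t1; apply: eq_from_tnth => i; rewrite tnth_mktuple.
rewrite [in X in _ + X]clamp_id; last by rewrite /affine; apply/andP; split; lra.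
have -> : clamp (affine 2 0 t) = 1.
  by rewrite /clamp min_l// le_max; apply/orP; right; rewrite /affine; lra.
by rewrite /curve_coord g1 addrC subrK.
Qed.

Lemma horizontal_cat x y z gamma1 gamma2 :
  horizontal_curve h m x y gamma1 -> horizontal_curve h m y z gamma2 ->
  exists2 gamma, horizontal_curve h m x z gamma &
    (curve_length h m gamma <= curve_length h m gamma1 + curve_length h m gamma2)%E.
Proof.
move=> H1 H2.
have [v1 [mv1 v10 Hv1] vl1] := horizontal_speed_bound H1.
have [v2 [mv2 v20 Hv2] vl2] := horizontal_speed_bound H2.
have [g10 g11 acg1 _] := H1; have [g20 g21 acg2 _] := H2.
have n2 : 2 != 0 :> R by [].
have /ae_elim[N1 [mN1 N10 HN1]] := Hv1.
have /ae_elim[N2 [mN2 N20 HN2]] := Hv2.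
have [mN1' N1'0] := null_affine 0 n2 mN1 N10.
have [mN2' N2'0] := null_affine (-1) n2 mN2 N20.
pose N' : set RR := (affine 2 0 @^-1` N1) `|` (affine 2 (-1) @^-1` N2) `|` [set 1/2].
have mN' : measurable N' by apply: measurableU => //; exact: measurableU.
have N'0 : lambda N' = 0%E.
  have [M [mM M0 NM]] : lambda.-negligible N'.
    apply: negligibleU; last first.
      by exists [set 1/2]; split => //; exact: lebesgue_measure_set1.
    by apply: negligibleU; [exists (affine 2 0 @^-1` N1); split|
      exists (affine 2 (-1) @^-1` N2); split].
  by apply/eqP; rewrite eq_le measure_ge0 andbT -M0 le_measure ?inE.
pose g := cat gamma1 gamma2 y.
pose v : RR -> R := fun t => if t < 1/2 then 2 * v1 (affine 2 0 t) else 2 * v2 (affine 2 (-1) t).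
have mv : measurable_fun setT v.
  apply: measurable_fun_ifT.
  - exact: measurable_fun_ltr.
  - apply: measurable_funM => //; apply: (@measurableT_comp _ _ _ _ _ _ v1) => //.
    exact: measurable_affine.
  - apply: measurable_funM => //; apply: (@measurableT_comp _ _ _ _ _ _ v2) => //.
    exact: measurable_affine.
have v0 t : 0 <= v t by rewrite /v; case: ifP => _; rewrite mulr_ge0.
have bound : forall t : R, ~ N' t -> t \in `]0, 1[ ->
    [/\ forall i, derivable (curve_coord g i) t 1,
      horizontal_coeffs h m (g t) (velocity g t) !=set0 &
      speed h m (g t) (velocity g t) <= v t].
  move=> t Nt; rewrite in_itv/= => /andP[t0 t1]; have [th|th] := ltP t (1/2).
    have [||d1 d2 d3] := HN1 (affine 2 0 t).
    - by move=> H; apply: Nt; left; left.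
    - by rewrite in_itv/= /affine; apply/andP; split; lra.
    have K i : derivable (curve_coord g i) t 1 /\
        derive1 (curve_coord g i) t = 2 * derive1 (curve_coord gamma1 i) (affine 2 0 t).
      apply: (@derive_affine R (curve_coord gamma1 i) _ 2 0 0) => //.
      exists (Num.min t (1/2 - t)); first by rewrite lt_min t0 subr_gt0.
      move=> s; rewrite lt_min !ltr_norml => /andP[/andP[s1 s2] /andP[s3 s4]].
      by rewrite /curve_coord /g cat_left ?addr0//; lra.
    have -> : velocity g t = 2 *: velocity gamma1 (affine 2 0 t).
      by apply/rowP => i; rewrite !mxE (K i).2.
    have -> : g t = gamma1 (affine 2 0 t) by rewrite /g cat_left//; lra.
    split; [by move=> i; have [] := K i|exact: horizontal_coeffsZ|].
    by rewrite speedZ ger0_norm// /v th ler_wpM2l.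
  have {}th : 1/2 < t.
    by rewrite lt_neqAle th andbT; apply/eqP => tE; apply: Nt; right.
  have [||d1 d2 d3] := HN2 (affine 2 (-1) t).
  - by move=> H; apply: Nt; left; right.
  - by rewrite in_itv/= /affine; apply/andP; split; lra.
  have K i : derivable (curve_coord g i) t 1 /\
      derive1 (curve_coord g i) t = 2 * derive1 (curve_coord gamma2 i) (affine 2 (-1) t).
    apply: (@derive_affine R (curve_coord gamma2 i) _ 2 (-1) 0) => //.
    exists (Num.min (1 - t) (t - 1/2)); first by rewrite lt_min !subr_gt0 t1.
    move=> s; rewrite lt_min !ltr_norml => /andP[/andP[s1 s2] /andP[s3 s4]].
    by rewrite /curve_coord /g cat_right ?addr0//; lra.
  have -> : velocity g t = 2 *: velocity gamma2 (affine 2 (-1) t).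
    by apply/rowP => i; rewrite !mxE (K i).2.
  have -> : g t = gamma2 (affine 2 (-1) t) by rewrite /g cat_right//; lra.
  split; [by move=> i; have [] := K i|exact: horizontal_coeffsZ|].
  by rewrite speedZ ger0_norm// /v ltNge (ltW th) ler_wpM2l.
have sb : speed_bound h m g v by split => //; exact: (ae_intro mN' N'0).
exists g.
  split.
  - by rewrite /g cat_left// /affine mulr0 addr0.
  - rewrite /g cat_right//; last lra.
    by rewrite /affine (_ : 2 * 1 - 1 = 1)//; lra.
  - move=> i; rewrite (_ : curve_coord g i = fun t =>
      (curve_coord gamma1 i \o (fun t => clamp (affine 2 0 t))) t +
      ((curve_coord gamma2 i \o (fun t => clamp (affine 2 (-1) t))) t + - tnth y i)); last first.
      by apply/funext => t; rewrite /curve_coord /g tnth_mktuple.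
    apply: ac_add; first by apply: (@ac_comp_homo _ _ _ 2) => //; exact: clamp_affine_lip.
    apply: ac_add; last exact: ac_cst.
    by apply: (@ac_comp_homo _ _ _ 2) => //; exact: clamp_affine_lip.
  - by apply: (ae_intro mN' N'0) => t Nt t01; have [] := bound t Nt t01.
apply: le_trans (curve_length_le sb) _; apply: le_trans (leeD vl1 vl2).
have I01 : `[0, 1]%classic = `[0, 1/2[%classic `|` `[1/2, 1]%classic :> set RR.
  apply/seteqP; split => t; rewrite /= !in_itv/=.
    by move=> /andP[h1 h2]; have [th|th] := ltP t (1/2); [left|right]; rewrite ?h1 ?h2 ?th.
  by move=> [/andP[h1 h2]|/andP[h1 h2]]; apply/andP; split; lra.
have mI1 : @measurable _ RR `[0, 1/2[%classic by exact: measurable_itv.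
have mI2 : @measurable _ RR `[1/2, 1]%classic by exact: measurable_itv.
rewrite [in leLHS]I01 ge0_integral_setU//; last 3 first.
- by apply/measurable_EFinP; exact: measurable_funTS.
- by move=> t _; rewrite lee_fin.
- by apply/disj_setPS => t; rewrite /= !in_itv/= => -[/andP[_ h1] /andP[h2 _]]; move: h1; rewrite ltNge h2.
apply: leeD.
- apply: (@le_trans _ _ (\int[lambda]_(t in `[0%R, 1%R[) (v1 t)%:E)%E).
    rewrite -(@integral_affine _ 2 0 _ (fun t => (v1 t)%:E))//.
    + rewrite (_ : affine 2 0 @^-1` _ = `[0, 1/2[%classic); last first.
        exact: preimage_half_left.
      apply: ge0_le_lower_integral => t; rewrite ?lee_fin//.
      rewrite /= in_itv/= => /andP[_ th].
      by rewrite /v th ger0_norm.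
    + by apply/measurable_EFinP; exact: measurable_funTS.
  apply: ge0_subset_integral => //; try exact: measurable_itv.
  + by apply/measurable_EFinP; exact: measurable_funTS.
  + by move=> t _; rewrite lee_fin.
  + by move=> t; rewrite /= !in_itv/= => /andP[h1 h2]; rewrite h1 ltW.
- rewrite -(@integral_affine _ 2 (-1) _ (fun t => (v2 t)%:E))//.
  + rewrite (_ : affine 2 (-1) @^-1` _ = `[1/2, 1]%classic); last first.
      exact: preimage_half_right.
    apply: ge0_le_lower_integral => t; rewrite ?lee_fin//.
    rewrite /= in_itv/= => /andP[th _].
    by rewrite /v ltNge th ger0_norm.
  + by apply/measurable_EFinP; exact: measurable_funTS.
Qed.

(** The hypothesis says that the weights of the moving coordinates are constant
    along the segment, which is therefore run with constant coefficients. *)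
Lemma horizontal_segment x y (a : 'I_n -> R) :
  (forall t : R, 0 <= t <= 1 -> forall i, tnth y i - tnth x i =
     a i * weight h m [tuple tnth x j + t * (tnth y j - tnth x j) | j < n] i) ->
  exists2 gamma, horizontal_curve h m x y gamma &
    (curve_length h m gamma <= (Num.sqrt (\sum_i a i ^+ 2))%:E)%E.
Proof.
move=> xya.
pose g : R -> eucl R n := fun t => [tuple tnth x j + t * (tnth y j - tnth x j) | j < n].
have gE i : curve_coord g i = fun t => tnth x i + t * (tnth y i - tnth x i).
  by apply/funext => t; rewrite /curve_coord tnth_mktuple.
have K t i : derivable (curve_coord g i) t 1 /\
    derive1 (curve_coord g i) t = tnth y i - tnth x i.
  apply: approx_derivable => e e0; exists 1 => // k _.
  rewrite gE (_ : _ - _ - _ = 0); last by ring.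
  by rewrite normr0 mulr_ge0// ltW.
have hor t : t \in `]0, 1[ -> horizontal_coeffs h m (g t) (velocity g t) a.
  rewrite in_itv/= => /andP[t0 t1]; apply/horizontal_coeffsP => i.
  by rewrite mxE (K t i).2; apply: xya; rewrite !ltW.
have z0 : lambda set0 = 0%E by rewrite measure0.
have sb : speed_bound h m g (cst (Num.sqrt (\sum_i a i ^+ 2))).
  split; [exact: measurable_cst|by move=> t; exact: sqrtr_ge0|].
  apply: (ae_intro _ z0) => // t _ t01; split.
  - by move=> i; have [] := K t i.
  - by exists a; exact: hor.
  - rewrite -lee_fin -hnormE; last by exists a; exact: hor.
    by apply: hnorm_le; apply/horizontal_coeffsP; exact: hor.
exists g.
  split.
  - by apply: eq_from_tnth => i; rewrite tnth_mktuple mul0r addr0.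
  - by apply: eq_from_tnth => i; rewrite tnth_mktuple mul1r addrC subrK.
  - move=> i; rewrite gE; apply: (@ac_lipschitz _ _ `|tnth y i - tnth x i|) => s t _ st _.
    rewrite (_ : _ - _ = (tnth y i - tnth x i) * (t - s)); last by ring.
    by rewrite normrM [`|t - s|]ger0_norm// subr_ge0.
  - apply: (ae_intro _ z0) => // t _ t01; split; first by move=> i; have [] := K t i.
    by exists a; exact: hor.
apply: le_trans (curve_length_le sb) _.
rewrite (@integral_cst _ _ _ lambda `[0%R, 1%R]%classic _ (Num.sqrt (\sum_i a i ^+ 2))%:E); last exact: measurable_itv.
have := lebesgue_measure_itv `[0%R : R, 1%R]; rewrite /= lte_fin ltr01 => l01.
by rewrite [X in (_ * X)%E](l01 : _ = _) -EFinB subr0 mule1.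
Qed.

End curve_operations.

(** * The Carnot-Caratheodory distance *)

Section cc_metric.
Context {R : realType} {n : nat}.
Variables (h m : nat).
Local Notation lambda := (@lebesgue_measure R).
Local Notation RR := (measurableTypeR R).
Implicit Types (x y z : eucl R n) (gamma : R -> eucl R n) (e r rho : R).

Lemma coord_le_normh x (i : 'I_n) : (i < h)%N -> `|tnth x i| <= normh h x.
Proof.
move=> ih; rewrite -sqrtr_sqr ler_sqrt ?sumr_ge0// => [|j _]; last exact: sqr_ge0.
by rewrite (bigD1 i)//= lerDl sumr_ge0// => j _; exact: sqr_ge0.
Qed.

Lemma sqrt_sum_sqr_le (P : pred 'I_n) (a : 'I_n -> R) :
  Num.sqrt (\sum_(i | P i) a i ^+ 2) <= \sum_(i | P i) `|a i|.
Proof.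
have [S0 SS] : 0 <= \sum_(i | P i) `|a i| /\
    \sum_(i | P i) a i ^+ 2 <= (\sum_(i | P i) `|a i|) ^+ 2.
  elim/big_rec2 : _ => [|i s t Pi [t0 st]]; first by rewrite expr0n.
  split; first by rewrite addr_ge0.
  have na : `|a i| ^+ 2 = a i ^+ 2 by rewrite -normrX ger0_norm ?sqr_ge0.
  by rewrite sqrrD na; have := mulr_ge0 (normr_ge0 (a i)) t0; lra.
by rewrite -[leRHS]ger0_norm// -[leRHS]sqrtr_sqr ler_wsqrtr.
Qed.

Lemma curve_length_ge0 gamma : (0 <= curve_length h m gamma)%E.
Proof. by apply: integral_ge0 => t _; exact: hnorm_ge0. Qed.

Section bounds_along_a_curve.
Variables (x y : eucl R n) (gamma : R -> eucl R n) (rho : R).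
Hypothesis H : horizontal_curve h m x y gamma.
Hypothesis Hrho : (curve_length h m gamma < rho%:E)%E.

Lemma curve_rho_gt0 : 0 < rho.
Proof. by rewrite -lte_fin; apply: le_lt_trans Hrho; exact: curve_length_ge0. Qed.

(** A coordinate moves at most at the speed of the curve times its weight. *)
Let coord_bound (i : 'I_n) (K t : R) : 0 <= K -> 0 <= t <= 1 ->
  (forall s, 0 <= s <= 1 -> weight h m (gamma s) i <= K) ->
  (`|curve_coord gamma i t - tnth x i|%:E <= K%:E * curve_length h m gamma)%E.
Proof.
move=> K0 /andP[t0 t1] HK.
have [v [mv v0 Hv] vl] := horizontal_speed_bound H; have [g0 _ acg _] := H.
apply: (@le_trans _ _ (K%:E * \int[lambda]_(t in `[0%R, 1%R]) (v t)%:E)%E); last first.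
  by rewrite lee_wpmul2l.
rewrite -ge0_integralZl//; last first.
- by move=> s _; rewrite lee_fin.
- by apply/measurable_EFinP; exact: measurable_funTS.
rewrite (_ : tnth x i = curve_coord gamma i 0); last by rewrite /curve_coord g0.
apply: (@absolutely_continuous_le _ _ (fun t => (K%:E * (v t)%:E)%E)) => //.
  by move=> s; rewrite -EFinM lee_fin mulr_ge0.
move/ae_elim : Hv => [N [mN N0 HN]]; apply: (ae_intro mN N0) => s Ns s01.
have [d1 d2 d3] := HN s Ns s01; split => //.
rewrite -EFinM lee_fin; have := coord_le_speed i d2; rewrite mxE => /le_trans; apply.
apply: ler_pM => //; [exact: weight_ge0|exact: speed_ge0|].
by apply: HK; move: s01; rewrite in_itv/= => /andP[s0 s1]; rewrite !ltW.
Qed.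

Lemma curve_coord_lt (i : 'I_n) t : (i < h)%N -> 0 <= t <= 1 ->
  `|curve_coord gamma i t - tnth x i| < rho.
Proof.
move=> ih t01; rewrite -lte_fin; apply: le_lt_trans Hrho.
have := @coord_bound i 1 t ler01 t01; rewrite mul1e; apply => s _.
by rewrite /weight ih.
Qed.

(** The factor [n] comes from bounding the Euclidean norm by the sum of the
    coordinates. *)
Lemma curve_normh_le t : 0 <= t <= 1 ->
  normh h (gamma t) <= n%:R * (normh h x + rho).
Proof.
move=> t01; apply: le_trans (sqrt_sum_sqr_le _ _) _.
have nr : 0 <= normh h x + rho by rewrite addr_ge0 ?normh_ge0// ltW// curve_rho_gt0.
apply: (@le_trans _ _ (\sum_(i < n) (normh h x + rho))); last first.
  by rewrite sumr_const card_ord -[leLHS]mulr_natl.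
rewrite big_mkcond/=; apply: ler_sum => i _; case: ifPn => // ih.
have -> : tnth (gamma t) i = tnth x i + (curve_coord gamma i t - tnth x i).
  by rewrite addrC subrK.
apply: le_trans (ler_normD _ _) _; apply: lerD; first exact: coord_le_normh.
by apply/ltW/curve_coord_lt.
Qed.

Lemma curve_vcoord_le (i : 'I_n) : ~~ (i < h)%N ->
  `|tnth y i - tnth x i| <= (n%:R * (normh h x + rho)) ^+ m * rho.
Proof.
move=> ih; have [_ g1 _ _] := H.
have nr : 0 <= n%:R * (normh h x + rho).
  by rewrite mulr_ge0// addr_ge0 ?normh_ge0// ltW// curve_rho_gt0.
have K0 : 0 <= (n%:R * (normh h x + rho)) ^+ m by rewrite exprn_ge0.
have -> : tnth y i = curve_coord gamma i 1 by rewrite /curve_coord g1.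
rewrite -lee_fin; apply: le_trans (coord_bound K0 _ _) _.
- by rewrite ler01 lexx.
- move=> s s01; rewrite /weight (negbTE ih) lerXn2r ?nnegrE//; first exact: normh_ge0.
  exact: curve_normh_le.
- by rewrite EFinM lee_wpmul2l// ltW.
Qed.

End bounds_along_a_curve.

(** With extended values, symmetry and the triangle inequality precede the
    finiteness of the distance, whose proof uses them. *)
Definition cc_edist x y : \bar R :=
  ereal_inf [set curve_length h m gamma | gamma in horizontal_curve h m x y].

Lemma cc_edist_ge0 x y : (0 <= cc_edist x y)%E.
Proof. by apply: le_ereal_inf_tmp => _ [g _ <-]; exact: curve_length_ge0. Qed.

Let cc_edist_sym_le x y : (cc_edist x y <= cc_edist y x)%E.
Proof.
apply: le_ereal_inf_tmp => _ [g Hg <-].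
have [g' Hg' l'] := horizontal_rev Hg.
by apply: le_trans l'; apply: ereal_inf_lbound; exists g'.
Qed.

Lemma cc_edist_sym x y : cc_edist x y = cc_edist y x.
Proof. by apply/eqP; rewrite eq_le !cc_edist_sym_le. Qed.

Lemma cc_edist_triangle x y z : (cc_edist x z <= cc_edist x y + cc_edist y z)%E.
Proof.
have [->|dxy] := eqVneq (cc_edist x y) +oo%E.
  by rewrite addye ?leey// gt_eqF// (lt_le_trans _ (cc_edist_ge0 _ _)).
have [->|dyz] := eqVneq (cc_edist y z) +oo%E.
  by rewrite addey ?leey// gt_eqF// (lt_le_trans _ (cc_edist_ge0 _ _)).
have fin (d : \bar R) : (0 <= d)%E -> d != +oo%E -> d \is a fin_num.
  by move=> d0 dy; rewrite ge0_fin_numE// ltey.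
have f1 := fin _ (cc_edist_ge0 _ _) dxy; have f2 := fin _ (cc_edist_ge0 _ _) dyz.
apply/lee_addgt0Pr => e e0; have e2 : 0 < e / 2 by rewrite divr_gt0.
have [_ [g1 H1 <-] l1] := lb_ereal_inf_adherent e2 f1.
have [_ [g2 H2 <-] l2] := lb_ereal_inf_adherent e2 f2.
have [g Hg lg] := horizontal_cat H1 H2.
apply: (@le_trans _ _ (curve_length h m g)); first by apply: ereal_inf_lbound; exists g.
apply: (le_trans lg); apply: le_trans (leeD (ltW l1) (ltW l2)) _.
by rewrite addeACA -EFinD leeD2l// lee_fin -splitr.
Qed.

Lemma cc_edist_segment x y (a : 'I_n -> R) :
  (forall t : R, 0 <= t <= 1 -> forall i, tnth y i - tnth x i =
     a i * weight h m [tuple tnth x j + t * (tnth y j - tnth x j) | j < n] i) ->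
  (cc_edist x y <= (\sum_i `|a i|)%:E)%E.
Proof.
move=> Ha; have [g Hg lg] := horizontal_segment Ha.
apply: (@le_trans _ _ (curve_length h m g)); first by apply: ereal_inf_lbound; exists g.
by apply: (le_trans lg); rewrite lee_fin; exact: sqrt_sum_sqr_le.
Qed.

Lemma cc_edist_horizontal x y : (forall i : 'I_n, ~~ (i < h)%N -> tnth y i = tnth x i) ->
  (cc_edist x y <= (\sum_(i < n | (i < h)%N) `|tnth y i - tnth x i|)%:E)%E.
Proof.
move=> xy; apply: le_trans (cc_edist_segment (a := fun i => tnth y i - tnth x i) _) _.
  move=> t _ i; rewrite /weight; case: ifPn => [_|/xy ->]; first by rewrite mulr1.
  by rewrite subrr mul0r.
rewrite lee_fin [leRHS]big_mkcond/=; apply: ler_sum => i _.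
by case: ifPn => // /xy ->; rewrite subrr normr0.
Qed.

Lemma cc_edist_vertical x y e : 0 < e -> e <= normh h x ->
  (forall i : 'I_n, (i < h)%N -> tnth y i = tnth x i) ->
  (cc_edist x y <= (e ^- m * \sum_(i < n | ~~ (i < h)%N) `|tnth y i - tnth x i|)%:E)%E.
Proof.
move=> e0 ex xy; have nx : 0 < normh h x by exact: lt_le_trans ex.
apply: le_trans (cc_edist_segment (a := fun i => if (i < h)%N then 0 else
    (tnth y i - tnth x i) / normh h x ^+ m) _) _.
  move=> t _ i; rewrite /weight; case: ifPn => [/xy ->|_]; first by rewrite subrr mul0r.
  rewrite (_ : normh h [tuple _ | _ < _] = normh h x) ?divfK//.
    by rewrite expf_neq0// gt_eqF.
  congr Num.sqrt; apply: eq_bigr => j jh.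
  by rewrite tnth_mktuple xy// subrr mulr0 addr0.
rewrite lee_fin mulr_sumr [leRHS]big_mkcond/=; apply: ler_sum => i _.
case: ifPn => _ /=; first by rewrite normr0.
rewrite normrM mulrC ler_wpM2r// normfV ger0_norm ?exprn_ge0 ?normh_ge0//.
by rewrite lef_pV2 ?posrE ?exprn_gt0// lerXn2r// nnegrE// ltW.
Qed.

Hypotheses (h_gt0 : (0 < h)%N) (h_le_n : (h <= n)%N).

Let i0 : 'I_n := Ordinal (leq_trans h_gt0 h_le_n).

(** Step aside to reach distance [e] from the singular set [normh h x = 0],
    move vertically there, and come back. *)
Lemma cc_edist_le x y e : 0 < e ->
  (cc_edist x y <= (2 * e + \sum_(i < n | (i < h)%N) `|tnth y i - tnth x i| +
    e ^- m * \sum_(i < n | ~~ (i < h)%N) `|tnth y i - tnth x i|)%:E)%E.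
Proof.
move=> e0; pose s := if 0 <= tnth x i0 then e else - e.
have sE : `|s| = e by rewrite /s; case: ifP => _; rewrite ?normrN gtr0_norm.
have s1 : e <= `|tnth x i0 + s|.
  rewrite /s; case: ifPn => [x0|]; first by rewrite ger0_norm ?addr_ge0 ?lerDr// ltW.
  by rewrite -ltNge => x0; rewrite ltr0_norm; lra.
pose x1 : eucl R n := [tuple if i == i0 then tnth x i + s else tnth x i | i < n].
pose x2 : eucl R n := [tuple if (i < h)%N then tnth x1 i else tnth y i | i < n].
have i0h : (i0 < h)%N by [].
have x1E i : tnth x1 i - tnth x i = if i == i0 then s else 0.
  by rewrite tnth_mktuple; case: ifP => _; [rewrite addrC addKr|rewrite subrr].
have A1 : (cc_edist x x1 <= e%:E)%E.
  apply: le_trans (cc_edist_horizontal _) _.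
    move=> i ih; rewrite tnth_mktuple; case: ifPn => // /eqP ii0.
    by move: ih; rewrite ii0 i0h.
  rewrite lee_fin (bigD1 i0)//= x1E eqxx big1 ?addr0 ?sE//.
  by move=> i /andP[_ ii0]; rewrite x1E (negbTE ii0) normr0.
have A2 : (cc_edist x1 x2 <= (e ^- m * \sum_(i < n | ~~ (i < h)%N) `|tnth y i - tnth x i|)%:E)%E.
  apply: le_trans (cc_edist_vertical e0 _ _) _.
  - apply: (le_trans s1); have := coord_le_normh x1 i0h.
    by rewrite tnth_mktuple eqxx.
  - by move=> i ih; rewrite [LHS]tnth_mktuple ih.
  - rewrite lee_fin ler_wpM2l ?invr_ge0 ?exprn_ge0 ?(ltW e0)//.
    apply: ler_sum => i ih; rewrite tnth_mktuple (negbTE ih).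
    rewrite tnth_mktuple; case: ifPn => // /eqP ii0.
    by move: ih; rewrite ii0 i0h.
have A3 : (cc_edist x2 y <= (e + \sum_(i < n | (i < h)%N) `|tnth y i - tnth x i|)%:E)%E.
  apply: le_trans (cc_edist_horizontal _) _.
    by move=> i ih; rewrite tnth_mktuple (negbTE ih).
  rewrite lee_fin (bigD1 i0)//= [in leRHS](bigD1 i0)//= addrA; apply: lerD.
    rewrite !tnth_mktuple i0h eqxx opprD addrA addrC -sE -[`|s|]normrN.
    exact: ler_normD.
  apply: ler_sum => i /andP[ih ii0].
  by rewrite !tnth_mktuple ih (negbTE ii0).
apply: le_trans (cc_edist_triangle _ x1 _) _.
apply: le_trans (leeD A1 (cc_edist_triangle _ x2 _)) _.
apply: le_trans (leeD2l _ (leeD A2 A3)) _.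
by rewrite -!EFinD lee_fin; lra.
Qed.

Lemma cc_edist_fin x y : cc_edist x y \is a fin_num.
Proof.
rewrite ge0_fin_numE; last exact: cc_edist_ge0.
by apply: le_lt_trans (cc_edist_le x y ltr01) _; rewrite ltry.
Qed.

Lemma cc_distE x y : (cc_dist h m x y)%:E = cc_edist x y.
Proof. by rewrite /cc_dist fineK//; exact: cc_edist_fin. Qed.

Lemma cc_dist_ge0 x y : 0 <= cc_dist h m x y.
Proof. by rewrite -lee_fin cc_distE cc_edist_ge0. Qed.

Lemma cc_dist_sym x y : cc_dist h m x y = cc_dist h m y x.
Proof. by apply/EFin_inj; rewrite !cc_distE cc_edist_sym. Qed.

Lemma cc_dist_triangle x y z : cc_dist h m x z <= cc_dist h m x y + cc_dist h m y z.
Proof. by rewrite -lee_fin EFinD !cc_distE cc_edist_triangle. Qed.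

Lemma cc_dist_le x y e : 0 < e ->
  cc_dist h m x y <= 2 * e + \sum_(i < n | (i < h)%N) `|tnth y i - tnth x i| +
    e ^- m * \sum_(i < n | ~~ (i < h)%N) `|tnth y i - tnth x i|.
Proof. by move=> e0; rewrite -lee_fin cc_distE cc_edist_le. Qed.

Let cc_dist_curve x y rho : cc_dist h m x y < rho ->
  exists2 g, horizontal_curve h m x y g & (curve_length h m g < rho%:E)%E.
Proof.
by rewrite -lte_fin cc_distE => /ereal_inf_lt[_ [g Hg <-] lg]; exists g.
Qed.

Lemma cc_dist_coord x y (i : 'I_n) : (i < h)%N -> `|tnth y i - tnth x i| <= cc_dist h m x y.
Proof.
move=> ih; apply/ler_addgt0Pr => e e0.
have [|g Hg lg] := @cc_dist_curve x y (cc_dist h m x y + e); first by rewrite ltrDl.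
have [_ g1 _ _] := Hg; have := @curve_coord_lt x y _ _ Hg lg i 1 ih.
by rewrite /curve_coord g1 ler01 lexx => /(_ isT)/ltW.
Qed.

Lemma cc_dist_normh x y rho : cc_dist h m x y < rho ->
  normh h y <= n%:R * (normh h x + rho).
Proof.
move=> /cc_dist_curve[g Hg lg]; have [_ g1 _ _] := Hg.
by have := @curve_normh_le x y _ _ Hg lg 1; rewrite g1 ler01 lexx; apply.
Qed.

Lemma cc_dist_vcoord x y rho (i : 'I_n) : ~~ (i < h)%N -> cc_dist h m x y < rho ->
  `|tnth y i - tnth x i| <= (n%:R * (normh h x + rho)) ^+ m * rho.
Proof. by move=> ih /cc_dist_curve[g Hg lg]; exact: (curve_vcoord_le Hg lg). Qed.

(** Balls have the expected radius: a geodesic of any given length leaves [x]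
    along the first coordinate axis. *)
Lemma cc_dist_axis x e : 0 <= e -> exists y, cc_dist h m y x = e.
Proof.
move=> e0; pose y : eucl R n := [tuple if i == i0 then tnth x i + e else tnth x i | i < n].
have yE i : tnth y i - tnth x i = if i == i0 then e else 0.
  by rewrite tnth_mktuple; case: ifP => _; [rewrite addrC addKr|rewrite subrr].
have i0h : (i0 < h)%N by [].
exists y; rewrite cc_dist_sym; apply/eqP; rewrite eq_le; apply/andP; split.
  rewrite -lee_fin cc_distE; apply: le_trans (cc_edist_horizontal _) _.
    move=> i ih; rewrite tnth_mktuple; case: ifPn => // /eqP ii0.
    by move: ih; rewrite ii0 i0h.
  rewrite lee_fin (bigD1 i0)//= yE eqxx big1 ?addr0 ?ger0_norm//.
  by move=> i /andP[_ ii0]; rewrite yE (negbTE ii0) normr0.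
by have := cc_dist_coord x y i0h; rewrite yE eqxx ger0_norm.
Qed.

Lemma cc_ball_radius_le x r R0 : 0 < R0 -> cc_ball h m x r `<=` cc_ball h m x R0 ->
  r <= R0.
Proof.
move=> R00 sub; rewrite leNgt; apply/negP => rR.
have [y yx] := cc_dist_axis x (ltW R00).
by have := sub y; rewrite /cc_ball/= yx ltxx => /(_ rR).
Qed.

End cc_metric.

(** * Measurability and volume of balls *)

Section euclidean_measurability.
Context {R : realType} {n : nat}.
Local Notation RR := (measurableTypeR R).
Implicit Types (x y : eucl R n).

Lemma measurable_tnth_preimage (i : 'I_n) (A : set RR) : measurable A ->
  measurable [set x : eucl R n | A (tnth x i)].
Proof.
move=> mA; rewrite -[X in measurable X]setTI.
exact: (@measurable_tnth _ RR n i).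
Qed.

Lemma measurable_box (c w : 'I_n -> R) :
  measurable [set x : eucl R n | forall i, `|tnth x i - c i| <= w i].
Proof.
rewrite (_ : [set _ | _] =
    \bigcap_(i in [set: 'I_n]) [set x : eucl R n | `[c i - w i, c i + w i]%classic (tnth x i)]).
  apply: fin_bigcap_measurable => // i _.
  by apply: measurable_tnth_preimage; exact: measurable_itv.
apply/seteqP; split => x /= H i; have := H i; rewrite /= in_itv/=;
by rewrite ler_distl // => /(_ I).
Qed.

Let qbox (q : n.-tuple rat) (k : nat) : set (eucl R n) :=
  [set x | forall i, `|tnth x i - ratr (tnth q i)| <= k.+1%:R^-1].

Let qbox_exists x (e : R) : 0 < e -> exists q, exists k : nat,
  qbox q k x /\ 2 * k.+1%:R^-1 < e.
Proof.
move=> e0; have e2 : 0 < e / 2 by rewrite divr_gt0.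
have [k _ Hk] : \forall k \near \oo, k.+1%:R^-1 < e / 2.
  exact: near_infty_natSinv_lt (PosNum e2).
have {}Hk := Hk k (leqnn k).
have k0 : 0 < k.+1%:R^-1 :> R by rewrite invr_gt0.
have H i : exists q : rat, `|tnth x i - ratr q| <= k.+1%:R^-1.
  have [q] : exists q, ratr q \in `](tnth x i - k.+1%:R^-1), (tnth x i)[.
    by apply: rat_in_itvoo; rewrite ltrBlDr ltrDl.
  rewrite in_itv/= => /andP[q1 q2]; exists q; rewrite ger0_norm ?subr_ge0 ?(ltW q2)//.
  by rewrite lerBlDr addrC -lerBlDr ltW.
exists [tuple sval (cid (H i)) | i < n], k; split; last by rewrite mulrC -ltr_pdivlMr.
by move=> i; rewrite tnth_mktuple; exact: (svalP (cid (H i))).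
Qed.

(** An open subset of the product is a countable union of rational boxes;
    openness is phrased in coordinates. *)
Lemma euclidean_open_measurable (A : set (eucl R n * eucl R n)) :
  (forall x y, A (x, y) -> exists2 e : R, 0 < e & forall x' y',
     (forall i, `|tnth x' i - tnth x i| < e) ->
     (forall i, `|tnth y' i - tnth y i| < e) -> A (x', y')) ->
  measurable A.
Proof.
move=> Aopen.
pose P (u : (n.-tuple rat * n.-tuple rat) * (nat * nat)) :=
  qbox u.1.1 u.2.1 `*` qbox u.1.2 u.2.2.
rewrite (_ : A = \bigcup_u (if pselect (P u `<=` A) then P u else set0)).
  apply: countable_bigcupT_measurable; first exact: countableP.
  move=> u; case: pselect => PA /=; last exact: measurable0.
  by apply: measurableX; exact: measurable_box.
apply/seteqP; split => [[x y] Axy|z [u _]]; last by case: pselect => //= PA /PA.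
have [e e0 He] := Aopen _ _ Axy.
have [q [k [xq ke]]] := qbox_exists x e0.
have [q' [k' [yq ke']]] := qbox_exists y e0.
have near (z z' : eucl R n) p j : 2 * j.+1%:R^-1 < e -> qbox p j z -> qbox p j z' ->
    forall i, `|tnth z' i - tnth z i| < e.
  move=> je zp z'p i; apply: le_lt_trans je.
  rewrite (_ : tnth z' i - _ = (tnth z' i - ratr (tnth p i)) - (tnth z i - ratr (tnth p i))).
    apply: le_trans (ler_normB _ _) _; by rewrite [2]mulrSr mulrDl mul1r lerD; [|exact: z'p|exact: zp].
  by ring.
exists ((q, q'), (k, k')) => //; case: pselect => [PA|nPA] /=; first by split.
exfalso; apply: nPA; move=> [x' y'] [/= x'q y'q]; apply: He.
  exact: near ke xq x'q.
exact: near ke' yq y'q.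
Qed.

End euclidean_measurability.

Section volume_of_boxes.
Context {R : realType}.
Local Notation RR := (measurableTypeR R).

Lemma lebesgue_tuple_box n (c w : 'I_n -> R) : (forall i, 0 <= w i) ->
  (lebesgue_tuple n [set x : eucl R n | (forall i, `|tnth x i - c i| <= w i)%R]
     <= (\prod_i (2 * w i))%:E)%E.
Proof.
elim: n c w => [|n IH] c w w0.
  rewrite big_ord0/= /dirac indicE lee_fin.
  by case: (_ \in _).
rewrite big_ord_recl /= /lebesgue_step /pushforward.
pose w' i := w (lift ord0 i); pose c' i := c (lift ord0 i).
pose B : set (eucl R n) := [set x | forall i, `|tnth x i - c' i| <= w' i].
pose I : set RR := `[c ord0 - w ord0, c ord0 + w ord0]%classic.
rewrite (_ : _ @^-1` _ = I `*` B); last first.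
  apply/seteqP; split => -[t x] /=.
    move=> H; split.
      by have := H ord0; rewrite /I/= in_itv/= -ler_distl tnth0.
    by move=> i; have := H (lift ord0 i); rewrite tnthS.
  move=> [tI xB] i; rewrite /=; case: (unliftP ord0 i) => [j ->|->].
    by rewrite tnthS; exact: xB.
  by rewrite tnth0 ler_distl; move: tI; rewrite /I/= in_itv.
rewrite product_measure1E; [|exact: measurable_itv|exact: measurable_box].
have lI : lebesgue_measure I = (2 * w ord0)%:E.
  rewrite /I lebesgue_measure_itv/= lte_fin; case: ifPn => [_|].
    by rewrite -EFinB; congr EFin; lra.
  by rewrite -leNgt => h; have w00 := w0 ord0; rewrite (_ : 2 * w ord0 = 0)//; lra.
rewrite [X in (X * _)%E](lI : _ = _).
by rewrite [leRHS]EFinM lee_wpmul2l ?lee_fin ?mulr_ge0//; apply: IH => i; exact: w0.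
Qed.

End volume_of_boxes.

Section cc_balls.
Context {R : realType} {n : nat}.
Variables (h m : nat).
Hypotheses (h_gt0 : (0 < h)%N) (h_le_n : (h <= n)%N).
Local Notation d := (@cc_dist R n h m).
Implicit Types (x y : eucl R n).

(** The detour of [cc_dist_le] at distance [e / 8] from the singular set. *)
Lemma cc_dist_locally_small x (e : R) : 0 < e -> exists2 dl : R, 0 < dl &
  forall y, (forall i, `|tnth y i - tnth x i| < dl) -> d x y < e.
Proof.
move=> e0; pose a := e / 8; have a0 : 0 < a by rewrite divr_gt0.
pose K := n%:R * (1 + a ^- m) + 1.
have am : 0 < a ^- m by rewrite invr_gt0 exprn_gt0.
have K0 : 0 < K by rewrite ltr_wpDl// mulr_ge0// addr_ge0// ltW.
exists (a / K); first by rewrite divr_gt0.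
move=> y Hy; apply: le_lt_trans (cc_dist_le m h_gt0 h_le_n x y a0) _.
have S (P : pred 'I_n) : \sum_(i < n | P i) `|tnth y i - tnth x i| <= n%:R * (a / K).
  rewrite mulr_natl -[X in _ *+ X]card_ord -sumr_const big_mkcond/=.
  apply: ler_sum => i _; case: ifP => _; first exact/ltW.
  by rewrite divr_ge0// ltW.
have S1 := S (fun i => (i < h)%N); have S2 := S (fun i => ~~ (i < h)%N).
have {}S2 : a ^- m * \sum_(i < n | ~~ (i < h)%N) `|tnth y i - tnth x i| <=
    a ^- m * (n%:R * (a / K)) by rewrite ler_pM2l.
have aK : n%:R * (a / K) + a ^- m * (n%:R * (a / K)) <= a.
  rewrite (_ : _ + _ = (n%:R * (1 + a ^- m)) * a / K); last by ring.
  by rewrite ler_pdivrMr// mulrC ler_wpM2l ?ltW// /K ltrDl.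
have ae : 8 * a = e by rewrite /a mulrC divfK.
lra.
Qed.

Lemma measurable_cc_dist : measurable_fun setT (fun z : eucl R n * eucl R n => d z.1 z.2).
Proof.
move=> mT; apply: (measurability _ (RGenInftyO.measurableE R)) => //.
move=> /= _ [_ [r ->] <-]; rewrite setTI.
apply: euclidean_open_measurable => x y /=; rewrite in_itv/= => xyr.
have e0 : 0 < (r - d x y) / 2 by rewrite divr_gt0// subr_gt0.
have [d1 d10 H1] := cc_dist_locally_small x e0.
have [d2 d20 H2] := cc_dist_locally_small y e0.
exists (Num.min d1 d2); first by rewrite lt_min d10.
move=> x' y' Hx Hy; rewrite in_itv/=.
have {}Hx : d x x' < (r - d x y) / 2.
  by apply: H1 => i; have := Hx i; rewrite lt_min => /andP[].
have {}Hy : d y y' < (r - d x y) / 2.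
  by apply: H2 => i; have := Hy i; rewrite lt_min => /andP[].
have := cc_dist_triangle m h_gt0 h_le_n x' x y'.
have := cc_dist_triangle m h_gt0 h_le_n x y y'.
rewrite (cc_dist_sym m h_gt0 h_le_n x' x); lra.
Qed.

Lemma measurable_cc_distl y : measurable_fun setT (fun x : eucl R n => d x y).
Proof.
apply: (@measurableT_comp _ _ _ _ _ _ (fun z : eucl R n * eucl R n => d z.1 z.2) setT
  (fun x => (x, y))); first exact: measurable_cc_dist.
exact: (pair2_measurable y).
Qed.

Lemma measurable_cc_ball x (r : R) : measurable (cc_ball h m x r).
Proof.
rewrite (_ : cc_ball h m x r = (fun y => d y x) @^-1` `]-oo, r[%classic).
  rewrite -[X in measurable X]setTI; apply: measurable_cc_distl => //.
by apply/seteqP; split => y; rewrite /cc_ball/= in_itv.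
Qed.

Lemma prod_vertical (a : R) : \prod_(i < n | ~~ (i < h)%N) a = a ^+ (n - h).
Proof.
rewrite -[RHS]prodr_const_nat big_geq_mkord/=.
by apply: eq_bigl => i; rewrite -leqNgt.
Qed.

(** Along a curve of length less than [r] the weight of a vertical coordinate
    stays below [(n * (normh h x + r)) ^ m], which encloses the ball in a box. *)
Lemma volume_cc_ball x (r : R) : 0 < r ->
  (lebesgue_tuple n (cc_ball h m x r) <=
   ((2 * r) ^+ n * (n%:R * (normh h x + r)) ^+ (m * (n - h)))%:E)%E.
Proof.
move=> r0; pose K := (n%:R * (normh h x + r)) ^+ m.
have K0 : 0 <= K by rewrite exprn_ge0// mulr_ge0// addr_ge0 ?normh_ge0// ltW.
pose w (i : 'I_n) := if (i < h)%N then r else K * r.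
have w0 i : 0 <= w i by rewrite /w; case: ifP => _; rewrite ?mulr_ge0// ltW.
apply: le_trans (_ : (lebesgue_tuple n [set y : eucl R n |
    (forall i, `|tnth y i - tnth x i| <= w i)%R] <= _)%E).
  apply: le_measure; rewrite ?inE; [exact: measurable_cc_ball|exact: measurable_box|].
  move=> y; rewrite /cc_ball/= (cc_dist_sym m h_gt0 h_le_n) => xy i.
  rewrite /w; case: ifPn => ih; last exact: cc_dist_vcoord.
  by apply: le_trans (cc_dist_coord m h_gt0 h_le_n x y ih) _; exact: ltW.
apply: le_trans (lebesgue_tuple_box _ w0) _; rewrite lee_fin.
rewrite exprM -prod_vertical -/K.
have -> : (2 * r) ^+ n = \prod_(i < n) (2 * r) by rewrite prodr_const card_ord.
rewrite [X in _ <= _ * X]big_mkcond -big_split/=.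
rewrite le_eqVlt; apply/orP; left; apply/eqP; apply: eq_bigr => i _.
by rewrite /w; case: ifP => _ /=; [rewrite mulr1|ring].
Qed.

End cc_balls.

(** * Integration of the kernel over dyadic balls *)

Section dyadic.
Context {R : realType}.

Lemma dyadic_scale (a : R) : 1 <= a -> exists k : nat, 2 ^+ k <= a < 2 ^+ k.+1.
Proof.
move=> a1; have a0 : 0 <= a by lra.
have /andP[Na aN] := truncn_itv a0.
set N := Num.truncn a in Na aN.
have N0 : (0 < N)%N by rewrite -(ltr_nat R); case: N Na aN => // _; lra.
exists (trunc_log 2 N); have /andP[l1 l2] := trunc_log_bounds (isT : (1 < 2)%N) N0.
apply/andP; split.
  by apply: le_trans Na; rewrite -natrX ler_nat.
by apply: (lt_le_trans aN); rewrite -natrX ler_nat.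
Qed.

Lemma geometric_sum_le (C theta : R) N : 0 <= C -> 0 < theta < 1 ->
  \sum_(k < N) C * theta ^+ k <= C / (1 - theta).
Proof.
move=> C0 /andP[t0 t1]; have t1' : 0 < 1 - theta by rewrite subr_gt0.
rewrite -mulr_sumr ler_pdivlMr// -mulrA ler_piMr//.
rewrite mulrC -opprB mulNr -subrX1 opprB gerBl exprn_ge0// ltW//.
Qed.

(** Domination of [f] by the sum of the functions [A k * \1_(S k)], whose
    integrals form a geometric series. *)
Lemma integral_dyadic_le d (T : measurableType d) (mu : {measure set T -> \bar R})
    (f : T -> R) (S : nat -> set T) (A : nat -> R) (C theta : R) :
  measurable_fun setT f -> (forall t, 0 <= f t) ->
  (forall k, measurable (S k)) -> (forall k, 0 <= A k) ->
  0 <= C -> 0 < theta < 1 ->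
  (forall k, (A k)%:E * mu (S k) <= (C * theta ^+ k)%:E)%E ->
  (forall t, f t = 0 \/ exists2 k, S k t & f t <= A k) ->
  (\int[mu]_t (f t)%:E <= (C / (1 - theta))%:E)%E.
Proof.
move=> mf f0 mS A0 C0 t01 HA Hf.
have u0 k t : (0 <= (A k * \1_(S k) t)%:E)%E by rewrite lee_fin mulr_ge0.
have mu_ k : measurable_fun setT (fun t => (A k * \1_(S k) t)%:E).
  by apply/measurable_EFinP; apply: measurable_funM => //; exact: measurable_indic.
apply: (@le_trans _ _ (\int[mu]_t \sum_(k <oo) (A k * \1_(S k) t)%:E)%E).
  apply: ge0_le_integral => //.
  - by move=> t _; rewrite lee_fin.
  - exact/measurable_EFinP.
  - exact: ge0_emeasurable_sum.
  - move=> t _; have [->|[k Sk fk]] := Hf t; first exact: nneseries_ge0.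
    apply: (@le_trans _ _ (A k * \1_(S k) t)%:E).
      by rewrite indicE mem_set// mulr1 lee_fin.
    rewrite (@nneseriesD1 _ (fun k => (A k * \1_(S k) t)%:E) k)//.
    by rewrite leeDl//; apply: nneseries_ge0.
rewrite integral_nneseries//.
apply: (@le_trans _ _ (\sum_(k <oo) (C * theta ^+ k)%:E)%E).
  apply: lee_nneseries => [k _ _|k _]; first exact: integral_ge0.
  under eq_integral do rewrite EFinM.
  rewrite ge0_integralZl ?lee_fin//; last first.
    by apply/measurable_EFinP; exact: measurable_indic.
  by rewrite integral_indic// setIT.
have [t0 _] := andP t01.
apply: lime_le.
  by apply: is_cvg_nneseries => k _ _; rewrite lee_fin mulr_ge0// exprn_ge0// ltW.
near=> N; rewrite /= sumEFin lee_fin big_mkord.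
exact: geometric_sum_le.
Unshelve. all: by end_near. Qed.

End dyadic.

Section kernel_integral.
Context {R : realType} {n : nat}.
Variables (h m : nat) (p s : R).
Hypotheses (h_gt0 : (0 < h)%N) (h_le_n : (h <= n)%N).
Hypotheses (p_gt1 : 1 < p) (s_gt0 : 0 < s).
Local Notation M := (m * (n - h))%N.
Hypothesis gap : M%:R + s * p < p.
Local Notation d := (@cc_dist R n h m).
Local Notation mu := (@lebesgue_tuple R n).
Local Notation q := ((hom_dim n h m)%:R + s * p : R).
Implicit Types (x y : eucl R n) (r t : R).

Lemma cc_kernelE x y : cc_kernel h m p s x y = d x y `^ (- q).
Proof. by []. Qed.

Lemma cc_kernel_ge0 x y : 0 <= cc_kernel h m p s x y.
Proof. exact: powR_ge0. Qed.

Lemma cc_kernel_sym x y : cc_kernel h m p s x y = cc_kernel h m p s y x.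
Proof. by rewrite !cc_kernelE (cc_dist_sym m h_gt0 h_le_n). Qed.

Let q_gt0 : 0 < q.
Proof. by rewrite ltr_wpDl// mulr_gt0// (lt_trans ltr01). Qed.

(** A majorant of [`|phi x - phi y| `^ p * cc_kernel x y] for any function [phi]
    with values in the unit interval that is [2 / r]-Lipschitz. *)
Definition cut_kernel r x y : R :=
  Num.min 1 ((2 / r * d x y) `^ p) * cc_kernel h m p s x y.

Lemma cut_kernel_ge0 r x y : 0 <= cut_kernel r x y.
Proof. by rewrite mulr_ge0 ?cc_kernel_ge0// le_min ler01 powR_ge0. Qed.

Lemma cut_kernel_sym r x y : cut_kernel r x y = cut_kernel r y x.
Proof. by rewrite /cut_kernel cc_kernel_sym (cc_dist_sym m h_gt0 h_le_n). Qed.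

Let volume_scaled x r dl L : 0 < r -> 0 < dl -> 1 <= L -> dl <= L ->
  (mu (cc_ball h m x (2 * dl * r)) <=
   (4 ^+ n * (2 * n%:R) ^+ M * L ^+ M * dl ^+ n * r ^+ n * (normh h x + r) ^+ M)%:E)%E.
Proof.
move=> r0 dl0 L1 dlL; apply: le_trans (volume_cc_ball _ _ _ _ _) _ => //.
  by rewrite !mulr_gt0.
rewrite lee_fin (_ : 2 * (2 * dl * r) = 4 * (dl * r)); last by ring.
rewrite !exprMn.
have nx := normh_ge0 h x.
have step : (normh h x + 2 * dl * r) ^+ M <= (2 * L * (normh h x + r)) ^+ M.
  apply: lerXn2r; rewrite ?nnegrE; [nra|nra|].
  have : 2 * dl * r <= 2 * L * r by rewrite ler_wpM2r ?ler_wpM2l// ltW.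
  have : normh h x <= 2 * L * normh h x by rewrite ler_peMl//; lra.
  lra.
rewrite !exprMn in step.
rewrite (_ : 4 ^+ n * (2 ^+ M * n%:R ^+ M) * _ * _ * _ * _ =
   (4 ^+ n * (dl ^+ n * r ^+ n)) * (n%:R ^+ M * (2 ^+ M * L ^+ M * (normh h x + r) ^+ M))); last by ring.
by rewrite ler_wpM2l ?ler_wpM2l ?mulr_ge0 ?exprn_ge0// ltW.
Qed.

(** Ratios of the geometric series over the dyadic balls inside and outside the
    scale [r]. The first one is less than [1] because [M + s * p < p], the
    second one because [s * p] is positive. *)
Let theta1 := (2 : R) `^ (- (p - q + n%:R)).
Let theta2 := (2 : R) `^ (- (s * p)).

Let powR2_lt1 (a : R) : 0 < a -> 0 < (2 : R) `^ (- a) < 1.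
Proof.
move=> a0; have := @gt0_ltr_powR R a a0 1 2; rewrite !nnegrE powR1.
move=> /(_ ler01 (ler0n R 2) (ltr1n R 2)) a1.
by rewrite powRN invr_gt0 invf_lt1 (lt_trans ltr01 a1).
Qed.

Let hom_dimE : (hom_dim n h m)%:R = n%:R + M%:R :> R.
Proof. by rewrite /hom_dim natrD. Qed.

Let theta1_itv : 0 < theta1 < 1.
Proof.
apply: powR2_lt1; rewrite (_ : _ + _ = p - (M%:R + s * p)) ?subr_gt0//.
by rewrite hom_dimE; ring.
Qed.

Let theta2_itv : 0 < theta2 < 1.
Proof. by apply: powR2_lt1; rewrite mulr_gt0// (lt_trans ltr01). Qed.

Let pow2 (a : R) k : (2 ^+ k) `^ a = (2 `^ a) ^+ k.
Proof.
by rewrite -powR_mulrn// -powRrM mulrC powRrM powR_mulrn ?powR_ge0.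
Qed.

Definition cut_const : R :=
  2 `^ p * 2 `^ q * 4 ^+ n * (2 * n%:R) ^+ M / (1 - 2 `^ (- (p - q + n%:R))) +
  4 ^+ n * (2 * n%:R) ^+ M / (1 - 2 `^ (- (s * p))).

Lemma cut_const_ge0 : 0 <= cut_const.
Proof.
have /andP[_ t1] := theta1_itv; have /andP[_ t2] := theta2_itv.
by rewrite addr_ge0// divr_ge0 ?mulr_ge0 ?powR_ge0 ?exprn_ge0 ?mulr_ge0// subr_ge0 ltW.
Qed.

Lemma measurable_cc_kernel :
  measurable_fun setT (fun z : eucl R n * eucl R n => cc_kernel h m p s z.1 z.2).
Proof.
apply: (@measurableT_comp _ _ _ _ _ _ (fun t : R => t `^ (- q)) setT).
  exact: measurable_powR.
exact: measurable_cc_dist.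
Qed.

Lemma measurable_cut_kernel r :
  measurable_fun setT (fun z : eucl R n * eucl R n => cut_kernel r z.1 z.2).
Proof.
apply: measurable_funM; last exact: measurable_cc_kernel.
apply: measurable_minr; first exact: measurable_cst.
apply: (@measurableT_comp _ _ _ _ _ _ (fun t : R => t `^ p) setT).
  exact: measurable_powR.
by apply: measurable_funM; [exact: measurable_cst|exact: measurable_cc_dist].
Qed.

Let near_part r x y : R := if d x y < r then cut_kernel r x y else 0.
Let far_part r x y : R := if d x y < r then 0 else cut_kernel r x y.

Let measurable_section r x : measurable_fun setT (fun y => cut_kernel r x y).
Proof.
apply: (@measurableT_comp _ _ _ _ _ _
  (fun z : eucl R n * eucl R n => cut_kernel r z.1 z.2) setT (fun y => (x, y))).
  exact: measurable_cut_kernel.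
exact: (pair1_measurable x).
Qed.

Let measurable_lt r x : measurable_fun setT (fun y => d x y < r).
Proof.
apply: measurable_fun_ltr; last exact: measurable_cst.
apply: (@eq_measurable_fun _ _ _ _ _ (fun y => d y x)); last exact: measurable_cc_distl.
by move=> y _; rewrite (cc_dist_sym m h_gt0 h_le_n).
Qed.

Let near_bound r x : 0 < r ->
  (\int[mu]_y (near_part r x y)%:E <=
   (2 `^ p * 2 `^ q * 4 ^+ n * (2 * n%:R) ^+ M * (r `^ (n%:R - q) * (normh h x + r) ^+ M) /
     (1 - theta1))%:E)%E.
Proof.
move=> r0.
have nxr : 0 <= normh h x + r by rewrite addr_ge0 ?normh_ge0// ltW.
have d2 k : 0 < (2 ^+ k)^-1 :> R by rewrite invr_gt0 exprn_gt0.
have d2' k : (2 ^+ k)^-1 <= 1 :> R by rewrite invf_le1 ?exprn_gt0// exprn_ege1// ler1n.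
apply: (@integral_dyadic_le _ _ _ _ _ (fun k => cc_ball h m x (2 * (2 ^+ k)^-1 * r))
   (fun k => (2 * (2 ^+ k)^-1) `^ p * (2^-1 * ((2 ^+ k)^-1 * r)) `^ (- q))).
- apply: measurable_fun_ifT => //.
- by move=> y; rewrite /near_part; case: ifP => // _; exact: cut_kernel_ge0.
- by move=> k; exact: measurable_cc_ball.
- by move=> k; rewrite mulr_ge0 ?powR_ge0.
- by rewrite !mulr_ge0 ?powR_ge0 ?exprn_ge0 ?mulr_ge0.
- exact: theta1_itv.
- move=> k; set dl := (2 ^+ k)^-1; have dl0 : 0 < dl by exact: d2.
  apply: (@le_trans _ _ (((2 * dl) `^ p * (2^-1 * (dl * r)) `^ (- q))%:E *
     (4 ^+ n * (2 * n%:R) ^+ M * 1 ^+ M * dl ^+ n * r ^+ n * (normh h x + r) ^+ M)%:E)%E).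
    apply: lee_wpmul2l; first by rewrite lee_fin mulr_ge0 ?powR_ge0.
    by apply: volume_scaled => //; exact: d2'.
  rewrite -EFinM lee_fin expr1n le_eqVlt; apply/orP; left; apply/eqP.
  have -> : theta1 ^+ k = dl `^ p * dl `^ (- q) * dl ^+ n.
    have dln0 : dl != 0 by exact: lt0r_neq0.
    rewrite -[dl ^+ n]powR_mulrn ?(ltW dl0)// -!powRD ?dln0 ?implybT//.
    by rewrite /theta1 -pow2 /dl -powR_inv1 ?exprn_ge0// -powRrM mulN1r.
  have -> : r `^ (n%:R - q) = r `^ (- q) * r ^+ n.
    rewrite addrC powRD ?powR_mulrn ?(ltW r0)//.
    by apply/implyP => _; exact: lt0r_neq0.
  rewrite powRM ?(ltW dl0)// [(2^-1 * _) `^ _]powRM ?mulr_ge0 ?(ltW dl0) ?(ltW r0)//.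
  rewrite [(dl * r) `^ _]powRM ?(ltW dl0) ?(ltW r0)//.
  have -> : (2^-1 : R) `^ (- q) = 2 `^ q.
    by rewrite -powR_inv1// -powRrM mulN1r opprK.
  ring.
- move=> y; rewrite /near_part; case: ifPn => [dr|_]; last by left.
  have [d0|dn0] := eqVneq (d x y) 0.
    left; rewrite /cut_kernel cc_kernelE d0 [0 `^ (- _)]powR0 ?mulr0//.
    by rewrite oppr_eq0 gt_eqF.
  have dp : 0 < d x y by rewrite lt_neqAle eq_sym dn0 cc_dist_ge0.
  have [|k /andP[k1 k2]] := @dyadic_scale R (r / d x y).
    by rewrite ler_pdivlMr// mul1r ltW.
  have k0 : 0 < 2 ^+ k :> R by rewrite exprn_gt0.
  rewrite ler_pdivlMr// in k1; rewrite ltr_pdivrMr// exprS in k2.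
  have dk : d x y <= (2 ^+ k)^-1 * r by rewrite ler_pdivlMl.
  right; exists k.
    rewrite /cc_ball/= (cc_dist_sym m h_gt0 h_le_n); apply: (le_lt_trans dk).
    by rewrite -mulrA ltr_pMl ?mulr_gt0// ltr1n.
  rewrite /cut_kernel; apply: ler_pM; rewrite ?cc_kernel_ge0 ?le_min ?ler01 ?powR_ge0//.
    rewrite ge_min; apply/orP; right; apply: ge0_ler_powR; rewrite ?nnegrE.
    + exact: le_trans ler01 (ltW p_gt1).
    + by rewrite mulr_ge0 ?(ltW dp)// divr_ge0// ltW.
    + by rewrite mulr_ge0.
    + by rewrite -mulrA ler_pM2l// mulrC ler_pdivrMr.
  rewrite cc_kernelE !powRN lef_pV2 ?posrE ?powR_gt0 ?mulr_gt0//.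
  apply: ge0_ler_powR; rewrite ?nnegrE ?mulr_ge0 ?(ltW (d2 k)) ?(ltW dp) ?(ltW r0) ?(ltW q_gt0)//.
  by rewrite mulrA -invfM ler_pdivrMl ?mulr_gt0// ltW.
Qed.

Let far_bound r x : 0 < r ->
  (\int[mu]_y (far_part r x y)%:E <=
   (4 ^+ n * (2 * n%:R) ^+ M * (r `^ (n%:R - q) * (normh h x + r) ^+ M) /
     (1 - theta2))%:E)%E.
Proof.
move=> r0.
have nxr : 0 <= normh h x + r by rewrite addr_ge0 ?normh_ge0// ltW.
have d2 k : 0 < 2 ^+ k :> R by rewrite exprn_gt0.
have d2' k : 1 <= 2 ^+ k :> R by rewrite exprn_ege1// ler1n.
apply: (@integral_dyadic_le _ _ _ _ _ (fun k => cc_ball h m x (2 * 2 ^+ k * r))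
   (fun k => (2 ^+ k * r) `^ (- q))).
- apply: measurable_fun_ifT => //.
- by move=> y; rewrite /far_part; case: ifP => // _; exact: cut_kernel_ge0.
- by move=> k; exact: measurable_cc_ball.
- by move=> k; rewrite powR_ge0.
- by rewrite !mulr_ge0 ?powR_ge0 ?exprn_ge0 ?mulr_ge0.
- exact: theta2_itv.
- move=> k; set dl := 2 ^+ k; have dl0 : 0 < dl by exact: d2.
  apply: (@le_trans _ _ (((dl * r) `^ (- q))%:E *
     (4 ^+ n * (2 * n%:R) ^+ M * dl ^+ M * dl ^+ n * r ^+ n * (normh h x + r) ^+ M)%:E)%E).
    apply: lee_wpmul2l; first by rewrite lee_fin powR_ge0.
    by apply: volume_scaled => //; exact: d2'.
  rewrite -EFinM lee_fin le_eqVlt; apply/orP; left; apply/eqP.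
  have -> : theta2 ^+ k = dl `^ (- q) * dl ^+ n * dl ^+ M.
    have dln0 : dl != 0 by exact: lt0r_neq0.
    rewrite -[dl ^+ n]powR_mulrn ?(ltW dl0)// -[dl ^+ M]powR_mulrn ?(ltW dl0)//.
    rewrite -!powRD ?dln0 ?implybT//.
    by rewrite /dl /theta2 -pow2 hom_dimE; congr powR; ring.
  have -> : r `^ (n%:R - q) = r `^ (- q) * r ^+ n.
    rewrite addrC powRD ?powR_mulrn ?(ltW r0)//.
    by apply/implyP => _; exact: lt0r_neq0.
  rewrite [(dl * r) `^ _]powRM ?(ltW dl0) ?(ltW r0)//.
  ring.
- move=> y; rewrite /far_part; case: ifPn => [_|]; first by left.
  rewrite -leNgt => rd; have dp : 0 < d x y by exact: lt_le_trans rd.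
  have [|k /andP[k1 k2]] := @dyadic_scale R (d x y / r).
    by rewrite ler_pdivlMr// mul1r.
  rewrite ler_pdivlMr// in k1; rewrite ltr_pdivrMr// exprS in k2.
  right; exists k; first by rewrite /cc_ball/= (cc_dist_sym m h_gt0 h_le_n).
  rewrite /cut_kernel -[leRHS]mul1r; apply: ler_pM;
    rewrite ?cc_kernel_ge0 ?le_min ?ler01 ?powR_ge0 ?ge_min ?lexx//.
  rewrite cc_kernelE !powRN lef_pV2 ?posrE ?powR_gt0 ?mulr_gt0//.
  by apply: ge0_ler_powR; rewrite ?nnegrE ?mulr_ge0 ?(ltW (d2 k)) ?(ltW dp) ?(ltW r0) ?(ltW q_gt0).
Qed.

Lemma integral_cut_kernel r x : 0 < r ->
  (\int[mu]_y (cut_kernel r x y)%:E <=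
   (cut_const * (r `^ (n%:R - q) * (normh h x + r) ^+ M))%:E)%E.
Proof.
move=> r0; have E y : (cut_kernel r x y)%:E = ((near_part r x y)%:E + (far_part r x y)%:E)%E.
  by rewrite /near_part /far_part; case: ifP => _; rewrite ?adde0 ?add0e.
under eq_integral do rewrite E.
have pos b y : (0 <= (if b then cut_kernel r x y else 0)%:E)%E.
  by rewrite lee_fin; case: b => //; exact: cut_kernel_ge0.
rewrite ge0_integralD//; last 4 first.
- by move=> y _; exact: pos.
- by apply/measurable_EFinP; apply: measurable_fun_ifT.
- by move=> y _; rewrite /far_part lee_fin; case: ifP => // _; exact: cut_kernel_ge0.
- by apply/measurable_EFinP; apply: measurable_fun_ifT.
apply: le_trans (leeD (near_bound x r0) (far_bound x r0)) _.
rewrite -EFinD lee_fin le_eqVlt; apply/orP; left; apply/eqP.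
have /andP[_ t1] := theta1_itv; have /andP[_ t2] := theta2_itv.
rewrite /cut_const -/theta1 -/theta2; field.
by rewrite !subr_eq0 !gt_eqF.
Qed.

End kernel_integral.

(** * The cut-off function and its energy *)

Section cutoff.
Context {R : realType} {n : nat}.
Variables (h m : nat) (p s : R).
Hypotheses (h_gt0 : (0 < h)%N) (h_le_n : (h <= n)%N).
Hypotheses (p_gt1 : 1 < p) (s_gt0 : 0 < s).
Local Notation M := (m * (n - h))%N.
Hypothesis gap : M%:R + s * p < p.
Local Notation d := (@cc_dist R n h m).
Local Notation mu := (@lebesgue_tuple R n).
Local Notation q := ((hom_dim n h m)%:R + s * p : R).
Local Notation k := (@cc_kernel R n h m p s).
Variables (x0 : eucl R n) (r : R).
Hypothesis r_gt0 : 0 < r.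
Implicit Types (x y : eucl R n).
Local Notation P := (normh h x0 + 2 * r).

Definition cutoff x : R := clamp (3 - 2 / r * d x x0).

Local Notation B' := (cc_ball h m x0 (3 / 2 * r)).

Lemma cutoff_itv x : 0 <= cutoff x <= 1.
Proof. exact: clamp_itv. Qed.

Lemma cutoff_eq1 x : cc_ball h m x0 r x -> cutoff x = 1.
Proof.
rewrite /cc_ball/= => xr; rewrite /cutoff /clamp min_l// le_max; apply/orP; right.
have : 2 / r * d x x0 <= 2 by rewrite mulrAC ler_pdivrMr// ler_pM2l// ltW.
lra.
Qed.

Lemma cutoff_eq0 x : ~ B' x -> cutoff x = 0.
Proof.
rewrite /cc_ball/= => /negP; rewrite -leNgt => xr.
rewrite /cutoff /clamp max_l ?min_r//.
have : 2 / r * (3 / 2 * r) <= 2 / r * d x x0 by rewrite ler_wpM2l// divr_ge0// ltW.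
rewrite (_ : 2 / r * (3 / 2 * r) = 3); [lra|].
by field; rewrite gt_eqF.
Qed.

Lemma cutoff_lip x y : `|cutoff x - cutoff y| <= 2 / r * d x y.
Proof.
wlog xy : x y / d x x0 <= d y x0 => [H|].
  have [xy|/ltW yx] := leP (d x x0) (d y x0); first exact: H.
  by rewrite distrC (cc_dist_sym m h_gt0 h_le_n); exact: H.
have r2 : 0 < 2 / r by rewrite divr_gt0.
have dd : 3 - 2 / r * d y x0 <= 3 - 2 / r * d x x0 by rewrite lerD2l lerN2 ler_pM2l.
rewrite ger0_norm; last by rewrite subr_ge0; exact: clamp_homo.
apply: le_trans (clamp_lip dd) _.
rewrite (_ : _ - _ = 2 / r * (d y x0 - d x x0)); last by ring.
rewrite ler_pM2l// lerBlDr (cc_dist_sym m h_gt0 h_le_n x y).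
exact: cc_dist_triangle.
Qed.

Lemma measurable_cutoff : measurable_fun setT cutoff.
Proof.
apply: measurable_minr; first exact: measurable_cst.
apply: measurable_maxr; first exact: measurable_cst.
apply: measurable_funB; first exact: measurable_cst.
apply: measurable_funM; first exact: measurable_cst.
exact: measurable_cc_distl.
Qed.

Let P_gt0 : 0 < P.
Proof. by rewrite ltr_wpDl ?normh_ge0// mulr_gt0. Qed.

Definition support_const : R := 3 ^+ n * n%:R ^+ M.

Lemma volume_support : (mu B' <= (support_const * (r ^+ n * P ^+ M))%:E)%E.
Proof.
apply: le_trans (volume_cc_ball _ _ _ _ _) _ => //; first by rewrite mulr_gt0.
rewrite lee_fin (_ : 2 * (3 / 2 * r) = 3 * r); last by field.
rewrite !exprMn /support_const (_ : 3 ^+ n * n%:R ^+ M * _ =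
  3 ^+ n * r ^+ n * (n%:R ^+ M * P ^+ M)); last by ring.
rewrite ler_wpM2l ?mulr_ge0 ?exprn_ge0 ?(ltW r_gt0)// ler_wpM2l ?exprn_ge0//.
have nx := normh_ge0 h x0; have r0 := r_gt0.
apply: lerXn2r; rewrite ?nnegrE; [lra|lra|].
by rewrite lerD2l ler_wpM2r ?(ltW r_gt0)//; lra.
Qed.

Lemma normh_support x : B' x -> normh h x + r <= n.+1%:R * P.
Proof.
rewrite /cc_ball/= (cc_dist_sym m h_gt0 h_le_n) => xB.
have := cc_dist_normh h_gt0 h_le_n xB.
have nx := normh_ge0 h x0; have r0 := r_gt0.
have : n%:R * (normh h x0 + 3 / 2 * r) <= n%:R * P.
  by rewrite ler_wpM2l// lerD2l ler_wpM2r ?(ltW r_gt0)//; lra.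
rewrite -[n.+1%:R]natr1 mulrDl mul1r; lra.
Qed.

Definition energy_const : R :=
  2 * (@cut_const R n h m p s * n.+1%:R ^+ M * support_const).

Let energy_half : (\int[mu]_y ((\1_B' y)%:E * \int[mu]_x (cut_kernel h m p s r y x)%:E) <=
  (@cut_const R n h m p s * n.+1%:R ^+ M * support_const *
    (r `^ (2 * n%:R - q) * (P ^+ M * P ^+ M)))%:E)%E.
Proof.
pose K := @cut_const R n h m p s * (r `^ (n%:R - q) * (n.+1%:R * P) ^+ M).
have K0 : 0 <= K.
  by rewrite !mulr_ge0 ?powR_ge0 ?exprn_ge0 ?mulr_ge0 ?(ltW P_gt0)//; exact: cut_const_ge0.
have mB : measurable B' by exact: measurable_cc_ball.
apply: (@le_trans _ _ (\int[mu]_y (K%:E * (\1_B' y)%:E))%E).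
  apply: ge0_le_lower_integral => y _.
    by rewrite mule_ge0 ?lee_fin//; apply: integral_ge0 => x _; rewrite lee_fin cut_kernel_ge0.
  rewrite indicE; case: (boolP (y \in B')) => yB /=; last by rewrite mul0e mule0.
  rewrite mul1e mule1; apply: le_trans (integral_cut_kernel _ _ _ _ _ _ _) _ => //.
  rewrite lee_fin /K ler_wpM2l ?cut_const_ge0// ler_wpM2l ?powR_ge0//.
  apply: lerXn2r; rewrite ?nnegrE.
  - by rewrite addr_ge0 ?normh_ge0// ltW.
  - by rewrite mulr_ge0 ?(ltW P_gt0).
  - by apply: normh_support; rewrite inE in yB.
rewrite ge0_integralZl ?lee_fin//; last first.
  by apply/measurable_EFinP; exact: measurable_indic.
rewrite integral_indic// setIT.
apply: le_trans (lee_wpmul2l _ volume_support) _; first by rewrite lee_fin.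
rewrite -EFinM lee_fin le_eqVlt; apply/orP; left; apply/eqP.
have -> : r `^ (2 * n%:R - q) = r `^ (n%:R - q) * r ^+ n.
  rewrite -powR_mulrn ?(ltW r_gt0)// -powRD; last by apply/implyP => _; rewrite gt_eqF.
  by congr powR; ring.
rewrite /K exprMn; ring.
Qed.

Let measurable_half (f : eucl R n * eucl R n -> eucl R n) : measurable_fun setT f ->
  measurable_fun setT (fun z => (\1_B' (f z) * cut_kernel h m p s r z.1 z.2)%:E).
Proof.
move=> mf; apply/measurable_EFinP; apply: measurable_funM; last exact: measurable_cut_kernel.
apply: (@measurableT_comp _ _ _ _ _ _ (\1_B' : _ -> R) setT) => //.
by apply: measurable_indic; exact: measurable_cc_ball.
Qed.

Let measurable_cutkernel_section y :
  measurable_fun setT (fun x => (cut_kernel h m p s r y x)%:E).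
Proof.
apply/measurable_EFinP; apply: (@measurableT_comp _ _ _ _ _ _
  (fun z : eucl R n * eucl R n => cut_kernel h m p s r z.1 z.2) setT (fun x => (y, x))).
  exact: measurable_cut_kernel.
exact: (pair1_measurable y).
Qed.

Let pull (y : eucl R n) (f : eucl R n -> R) : measurable_fun setT (fun x => (f x)%:E) ->
  (forall x, 0 <= f x) ->
  (\int[mu]_x (\1_B' y * f x)%:E = (\1_B' y)%:E * \int[mu]_x (f x)%:E)%E.
Proof.
move=> mf f0; under eq_integral do rewrite EFinM.
by rewrite ge0_integralZl ?lee_fin// => x _; rewrite lee_fin.
Qed.

(** Unless the integrand vanishes, one of the two points lies in the support of
    the cut-off; the other variable is integrated first, by
    [integral_cut_kernel]. *)
Lemma cutoff_energy_le : (\int[mu \x mu]_z (`|cutoff z.1 - cutoff z.2| `^ p * k z.1 z.2)%:E <=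
  (energy_const * (r `^ (2 * n%:R - q) * (P ^+ M * P ^+ M)))%:E)%E.
Proof.
pose f1 z : R := \1_B' z.1 * cut_kernel h m p s r z.1 z.2.
pose f2 z : R := \1_B' z.2 * cut_kernel h m p s r z.1 z.2.
have mf1 : measurable_fun setT (fun z => (f1 z)%:E) by exact: measurable_half measurable_fst.
have mf2 : measurable_fun setT (fun z => (f2 z)%:E) by exact: measurable_half measurable_snd.
have f10 z : (0 <= (f1 z)%:E)%E by rewrite lee_fin mulr_ge0// cut_kernel_ge0.
have f20 z : (0 <= (f2 z)%:E)%E by rewrite lee_fin mulr_ge0// cut_kernel_ge0.
apply: (@le_trans _ _ (\int[mu \x mu]_z ((f1 z)%:E + (f2 z)%:E))%E).
  apply: ge0_le_lower_integral => -[x y] _.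
    by rewrite lee_fin mulr_ge0 ?powR_ge0// cc_kernel_ge0.
  rewrite -EFinD lee_fin /f1 /f2 -mulrDl /cut_kernel mulrA /=.
  apply: ler_wpM2r; first exact: cc_kernel_ge0.
  have [/andP[x1 x2] /andP[y1 y2]] := (cutoff_itv x, cutoff_itv y).
  have p0 : 0 <= p by exact: le_trans ler01 (ltW p_gt1).
  have E : `|cutoff x - cutoff y| `^ p <= Num.min 1 ((2 / r * d x y) `^ p).
    rewrite le_min; apply/andP; split.
      apply: (@le_trans _ _ (1 `^ p)); last by rewrite powR1.
      apply: ge0_ler_powR; rewrite ?nnegrE//.
      by rewrite ler_norml; apply/andP; split; lra.
    apply: ge0_ler_powR; rewrite ?nnegrE//; last exact: cutoff_lip.
    by rewrite mulr_ge0 ?cc_dist_ge0// divr_ge0// ltW.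
  have m0 : 0 <= Num.min 1 ((2 / r * d x y) `^ p) by rewrite le_min ler01 powR_ge0.
  rewrite !indicE; case: (boolP (x \in B')) => xB /=.
    by rewrite (le_trans E)// ler_peMl// lerDl.
  case: (boolP (y \in B')) => yB /=; first by rewrite add0r mul1r.
  rewrite (@cutoff_eq0 x); last by move=> H; move: xB; rewrite (mem_set H).
  rewrite (@cutoff_eq0 y); last by move=> H; move: yB; rewrite (mem_set H).
  by rewrite subrr normr0 powR0 ?addr0 ?mul0r// gt_eqF// (lt_trans ltr01).
rewrite ge0_integralD//.
set X := r `^ _ * _; set c := @cut_const R n h m p s * n.+1%:R ^+ M * support_const.
rewrite (_ : energy_const * X = c * X + c * X); last by rewrite /energy_const -/c; ring.
rewrite EFinD; apply: leeD.
- rewrite fubini_tonelli1// /fubini_F /f1 /=.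
  under eq_integral => y _.
    rewrite pull; [over|exact: measurable_cutkernel_section|].
    by move=> x; exact: cut_kernel_ge0.
  exact: energy_half.
- rewrite fubini_tonelli2// /fubini_G /f2 /=.
  under eq_integral => y _.
    under eq_integral do rewrite (cut_kernel_sym m p s h_gt0 h_le_n).
    rewrite pull; [over|exact: measurable_cutkernel_section|].
    by move=> x; exact: cut_kernel_ge0.
  exact: energy_half.
Qed.

End cutoff.

(** * Algebraic inequalities for the test function *)

Section logarithmic_test.
Context {R : realType}.
Variable p : R.
Hypothesis p_gt1 : 1 < p.
Implicit Types (a b t al be e : R).

(** The nonlinearity of the [p]-Laplacian. *)
Definition jmap t : R := `|t| `^ (p - 2) * t.

Lemma jmapN t : jmap (- t) = - jmap t.
Proof. by rewrite /jmap normrN mulrN. Qed.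

Lemma jmap_ge0 t : 0 <= t -> jmap t = t `^ (p - 1).
Proof.
move=> t0; rewrite /jmap ger0_norm//; have [->|tn0] := eqVneq t 0.
  by rewrite mulr0 powR0// gt_eqF// subr_gt0.
rewrite -[X in _ * X]powRr1// -powRD ?tn0 ?implybT//.
by congr powR; ring.
Qed.

Lemma norm_jmap t : `|jmap t| = `|t| `^ (p - 1).
Proof.
have -> : `|jmap t| = jmap `|t| by rewrite /jmap normrM normr_id (ger0_norm (powR_ge0 _ _)).
by rewrite jmap_ge0.
Qed.

Definition caccioppoli_const : R := p * (p / (p - 1)) `^ (p - 1).

Lemma caccioppoli_const_ge0 : 0 <= caccioppoli_const.
Proof. by rewrite mulr_ge0 ?powR_ge0// ltW// (lt_trans ltr01). Qed.

(** By symmetry [b <= a]; homogeneity then reduces the inequality to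
    [caccioppoli_ratio_le] with [t = b / a]. *)
Lemma jmap_caccioppoli a b al be : 0 < a -> 0 < b -> 0 <= al -> 0 <= be ->
  jmap (a - b) * (al `^ p * a `^ (1 - p) - be `^ p * b `^ (1 - p)) <=
  caccioppoli_const * `|al - be| `^ p.
Proof.
wlog ba : a b al be / b <= a => [H|].
  have [ba|/ltW ab] := leP b a; first exact: H.
  move=> a0 b0 al0 be0; rewrite -opprB jmapN distrC.
  by rewrite mulNr -mulrN opprB; exact: H.
move=> a0 b0 al0 be0; rewrite jmap_ge0 ?subr_ge0//.
have t01 : 0 < b / a <= 1 by rewrite divr_gt0//= ler_pdivrMr// mul1r.
apply: le_trans (caccioppoli_ratio_le p_gt1 t01 al0 be0).
have -> : a - b = a * (1 - b / a) by field; rewrite gt_eqF.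
have tp : 0 <= 1 - b / a by rewrite subr_ge0; have /andP[] := t01.
rewrite powRM ?(ltW a0)//.
have -> : b `^ (1 - p) = a `^ (1 - p) * (b / a) `^ (1 - p).
  rewrite -powRM ?(ltW a0)//; last by rewrite divr_ge0// ltW.
  by congr powR; field; rewrite gt_eqF.
rewrite le_eqVlt; apply/orP; left; apply/eqP.
have aa : a `^ (p - 1) * a `^ (1 - p) = 1.
  rewrite -powRD; last by apply/implyP => _; rewrite gt_eqF.
  by rewrite (_ : p - 1 + (1 - p) = 0) ?powRr0//; ring.
transitivity ((a `^ (p - 1) * a `^ (1 - p)) *
  ((1 - b / a) `^ (p - 1) * (al `^ p - be `^ p * (b / a) `^ (1 - p)))); first by ring.
by rewrite aa mul1r.
Qed.

Definition log_const : R := (p - 1) / 2 `^ p.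

Lemma log_const_gt0 : 0 < log_const.
Proof. by rewrite divr_gt0 ?powR_gt0// subr_gt0. Qed.

(** By symmetry [b <= a]; this is the source of the logarithm. *)
Lemma jmap_log a b : 0 < a -> 0 < b ->
  log_const * `|ln (a / b)| `^ p + jmap (a - b) * (a `^ (1 - p) - b `^ (1 - p)) <= 0.
Proof.
wlog ba : a b / b <= a => [H|].
  have [ba|/ltW ab] := leP b a; first exact: H.
  move=> a0 b0; rewrite -[a - b]opprB jmapN mulNr -mulrN opprB.
  have -> : ln (a / b) = - ln (b / a).
    by rewrite -[a / b]invf_div lnV// posrE divr_gt0.
  by rewrite normrN; exact: H.
move=> a0 b0; rewrite jmap_ge0 ?subr_ge0//.
have := log_powR_le p_gt1 b0 ba.
have l0 : 0 <= ln (a / b) by rewrite ln_ge0// ler_pdivlMr// mul1r.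
rewrite powRM// ger0_norm// /log_const.
have -> : (2^-1 : R) `^ p = (2 `^ p)^-1 by rewrite -powR_inv1// powRAC powR_inv1 ?powR_ge0.
set L := _ `^ p; set W := (a - b) `^ (p - 1) => H.
have -> : (p - 1) / 2 `^ p * L = (p - 1) * (L * (2 `^ p)^-1) by rewrite mulrAC mulrA.
have -> : W * (a `^ (1 - p) - b `^ (1 - p)) = - (W * (b `^ (1 - p) - a `^ (1 - p))).
  by rewrite -mulrN opprB.
by rewrite subr_le0.
Qed.

(** Here [b] is a value outside the large ball, of any sign. Only its negative
    part can make [a - b] larger than [a], and it produces the tail. *)
Lemma jmap_far a b e al : 0 <= a -> 0 < e -> 0 <= al ->
  jmap (a - b) * (al `^ p * (a + e) `^ (1 - p)) <=
  2 `^ (p - 1) * (al `^ p * (1 + e `^ (1 - p) * Num.max (- b) 0 `^ (p - 1))).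
Proof.
move=> a0 e0 al0; set c := Num.max (- b) 0.
have c0 : 0 <= c by rewrite le_max lexx orbT.
have bc : - b <= c by rewrite le_max lexx.
have ae0 : 0 < a + e by rewrite ltr_wpDl.
have p10 : 0 <= p - 1 by rewrite subr_ge0 ltW.
have V t : t `^ (1 - p) = (t `^ (p - 1))^-1 by rewrite -powRN opprB.
have rhs0 : 0 <= 2 `^ (p - 1) * (al `^ p * (1 + e `^ (1 - p) * c `^ (p - 1))).
  by rewrite !mulr_ge0 ?powR_ge0// addr_ge0// mulr_ge0 ?powR_ge0.
have [ab|/ltW ab] := leP 0 (a - b); last first.
  apply: le_trans rhs0; rewrite mulr_le0_ge0 ?mulr_ge0 ?powR_ge0//.
  by rewrite -oppr_ge0 -jmapN jmap_ge0 ?powR_ge0// oppr_ge0.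
rewrite jmap_ge0// mulrCA [leRHS]mulrCA ler_wpM2l ?powR_ge0//.
have step : (a - b) `^ (p - 1) <= 2 `^ (p - 1) * ((a + e) `^ (p - 1) + c `^ (p - 1)).
  apply: le_trans (powRD_le p10 (ltW ae0) c0).
  apply: ge0_ler_powR; rewrite ?nnegrE//; first by rewrite addr_ge0// ltW.
  by rewrite -addrA lerD2l (le_trans bc)// lerDr ltW.
rewrite !V ler_pdivrMr ?powR_gt0//; apply: (le_trans step).
rewrite -mulrA ler_wpM2l ?powR_ge0// mulrDl mul1r lerD2l.
rewrite mulrAC ler_peMl ?powR_ge0//.
rewrite mulrC ler_pdivlMr ?powR_gt0// mul1r.
by apply: ge0_ler_powR; rewrite ?nnegrE ?(ltW ae0) ?(ltW e0)// lerDr.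
Qed.

End logarithmic_test.

(** * The test function *)

Lemma max0_lip (R : realType) (a b : R) :
  `|Num.max a 0 - Num.max b 0| <= `|a - b|.
Proof.
wlog ba : a b / b <= a => [H|].
  have [ba|/ltW ab] := leP b a; first exact: H.
  by rewrite distrC [`|a - b|]distrC; exact: H.
rewrite [leRHS]ger0_norm ?subr_ge0//.
have [a0|a0] := leP a 0; have [b0|b0] := leP b 0.
- by rewrite subrr normr0 subr_ge0.
- by rewrite ler_norml; apply/andP; split; lra.
- by rewrite subr0 gtr0_norm//; lra.
- by rewrite ger0_norm// subr_ge0.
Qed.

Section test_function.
Context {R : realType} {n : nat}.
Variables (h m : nat) (p s : R).
Hypotheses (h_gt0 : (0 < h)%N) (h_le_n : (h <= n)%N).
Hypotheses (p_gt1 : 1 < p) (s_gt0 : 0 < s).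
Local Notation M := (m * (n - h))%N.
Hypothesis gap : M%:R + s * p < p.
Local Notation d := (@cc_dist R n h m).
Local Notation mu := (@lebesgue_tuple R n).
Local Notation q := ((hom_dim n h m)%:R + s * p : R).
Local Notation k := (@cc_kernel R n h m p s).
Variables (u : eucl R n -> R) (x0 : eucl R n) (r e : R).
Hypotheses (r_gt0 : 0 < r) (e_gt0 : 0 < e).
Hypothesis mu_u : measurable_fun setT u.
Implicit Types (x y : eucl R n) (z : eucl R n * eucl R n).
Local Notation phi := (cutoff h m x0 r).
Local Notation B' := (cc_ball h m x0 (3 / 2 * r)).

Let p_gt0 : 0 < p. Proof. exact: lt_trans ltr01 p_gt1. Qed.

(** The positive part makes [test] bounded everywhere; it agrees with
    [phi ^ p * (u + e) ^ (1 - p)] where [u >= 0]. *)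
Definition test x : R := phi x `^ p * (Num.max (u x) 0 + e) `^ (1 - p).

Let base_ge x : e <= Num.max (u x) 0 + e.
Proof. by rewrite lerDr le_max lexx orbT. Qed.

Let weight_le x : (Num.max (u x) 0 + e) `^ (1 - p) <= e `^ (1 - p).
Proof.
have -> : 1 - p = - (p - 1) by ring.
rewrite !powRN lef_pV2 ?posrE ?powR_gt0//; last exact: lt_le_trans (base_ge x).
by apply: ge0_ler_powR; rewrite ?nnegrE ?subr_ge0 ?(ltW e_gt0) ?(le_trans (ltW e_gt0) (base_ge x)) ?(ltW p_gt1).
Qed.

Lemma test_ge0 x : 0 <= test x.
Proof. by rewrite mulr_ge0 ?powR_ge0. Qed.

Lemma test_eq0 x : ~ B' x -> test x = 0.
Proof. by move=> xB; rewrite /test cutoff_eq0// powR0 ?mul0r// gt_eqF. Qed.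

Let phi_pow_le1 x : phi x `^ p <= 1.
Proof.
have /andP[x1 x2] := cutoff_itv h m x0 r x.
apply: (@le_trans _ _ (1 `^ p)); last by rewrite powR1.
by apply: ge0_ler_powR; rewrite ?nnegrE// ltW.
Qed.

Lemma test_le x : test x <= e `^ (1 - p) * \1_B' x.
Proof.
rewrite indicE; case: (boolP (x \in B')) => xB.
  rewrite mulr1 -[leRHS]mul1r; apply: ler_pM; rewrite ?powR_ge0//.
by rewrite mulr0 test_eq0// => H; move: xB; rewrite (mem_set H).
Qed.

Lemma measurable_test : measurable_fun setT test.
Proof.
apply: measurable_funM.
  apply: (@measurableT_comp _ _ _ _ _ _ (fun t : R => t `^ p) setT).
    exact: measurable_powR.
  exact: measurable_cutoff.
apply: (@measurableT_comp _ _ _ _ _ _ (fun t : R => t `^ (1 - p)) setT).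
  exact: measurable_powR.
apply: measurable_funD => //; apply: measurable_maxr => //; exact: measurable_cst.
Qed.

Let phi_pow_lip x y : `|phi x `^ p - phi y `^ p| <= p * `|phi x - phi y|.
Proof.
wlog yx : x y / phi y <= phi x => [H|].
  have [yx|/ltW xy] := leP (phi y) (phi x); first exact: H.
  by rewrite distrC [`|phi x - _|]distrC; exact: H.
have /andP[x1 x2] := cutoff_itv h m x0 r x; have /andP[y1 y2] := cutoff_itv h m x0 r y.
have pp : phi y `^ p <= phi x `^ p by apply: ge0_ler_powR; rewrite ?nnegrE// ltW.
rewrite [X in X <= _]ger0_norm ?subr_ge0// [in leRHS]ger0_norm ?subr_ge0//.
apply: le_trans (powRB_le (ltW p_gt1) y1 yx) _.
apply: ler_wpM2r; first by rewrite subr_ge0.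
rewrite ler_piMr ?(ltW p_gt0)//.
apply: (@le_trans _ _ (1 `^ (p - 1))); last by rewrite powR1.
by apply: ge0_ler_powR; rewrite ?nnegrE// subr_ge0 ltW.
Qed.

Definition test_const : R := 2 `^ p * ((p * e `^ (1 - p)) `^ p + (p * e `^ (- p)) `^ p).

(** The factors [phi ^ p] and [(u^+ + e) ^ (1 - p)] are bounded and depend in a
    Lipschitz way on [phi] and [u]. *)
Lemma test_diff_le x y : `|test x - test y| `^ p <=
  test_const * (`|phi x - phi y| `^ p + `|u x - u y| `^ p).
Proof.
set w := fun x => (Num.max (u x) 0 + e) `^ (1 - p).
have wlip : `|w x - w y| <= p * e `^ (- p) * `|u x - u y|.
  apply: le_trans (powR_neg_lipschitz p_gt1 e_gt0 (base_ge x) (base_ge y)) _.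
  apply: ler_wpM2l; first by rewrite mulr_ge0 ?powR_ge0// ltW.
  rewrite (_ : _ - _ = Num.max (u x) 0 - Num.max (u y) 0); last by ring.
  exact: max0_lip.
have w0 : 0 <= w x by exact: powR_ge0.
have D : `|test x - test y| <= p * e `^ (1 - p) * `|phi x - phi y| + p * e `^ (- p) * `|u x - u y|.
  rewrite (_ : test x - test y = (phi x `^ p - phi y `^ p) * w x + phi y `^ p * (w x - w y)); last first.
    have G (a b c f : R) : a * c - b * f = (a - b) * c + b * (c - f) by ring.
    exact: G.
  apply: le_trans (ler_normD _ _) _; rewrite !normrM; apply: lerD.
    rewrite [leRHS]mulrAC; apply: ler_pM => //.
    by rewrite ger0_norm//; exact: weight_le.
  rewrite [`|phi y `^ p|]ger0_norm ?powR_ge0//.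
  by apply: le_trans wlip; rewrite ler_piMl.
have A0 : 0 <= p * e `^ (1 - p) by rewrite mulr_ge0 ?powR_ge0// ltW.
have C0 : 0 <= p * e `^ (- p) by rewrite mulr_ge0 ?powR_ge0// ltW.
apply: (@le_trans _ _ ((p * e `^ (1 - p) * `|phi x - phi y| + p * e `^ (- p) * `|u x - u y|) `^ p)).
  apply: ge0_ler_powR; [exact: ltW|by rewrite nnegrE| |exact: D].
  by rewrite nnegrE addr_ge0// mulr_ge0.
apply: le_trans (powRD_le (ltW p_gt0) (mulr_ge0 A0 (normr_ge0 _)) (mulr_ge0 C0 (normr_ge0 _))) _.
rewrite /test_const -mulrA ler_wpM2l ?powR_ge0//.
rewrite [(p * e `^ (1 - p) * _) `^ p]powRM// [(p * e `^ (- p) * _) `^ p]powRM//.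
have G (a b f g : R) : 0 <= a -> 0 <= b -> 0 <= f -> 0 <= g ->
    a * f + b * g <= (a + b) * (f + g).
  move=> a0 b0 f0 g0; rewrite [leRHS](_ : _ = (a * f + b * g) + (a * g + b * f)).
    by rewrite lerDl addr_ge0// mulr_ge0.
  by ring.
by apply: G; exact: powR_ge0.
Qed.

Local Notation pi := (mu \x mu)%E.

(** The second component of [z] is the inner variable of the iterated integrals. *)
Definition gagliardo (v : eucl R n -> R) z : R := `|v z.2 - v z.1| `^ p * k z.2 z.1.

Lemma gagliardo_ge0 v z : 0 <= gagliardo v z.
Proof. by rewrite mulr_ge0 ?powR_ge0. Qed.

Lemma measurable_kernel_swap : measurable_fun setT (fun z => k z.2 z.1).
Proof.
apply: (@measurableT_comp _ _ _ _ _ _ (fun z => k z.1 z.2) setT (fun z => (z.2, z.1))).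
  exact: measurable_cc_kernel.
by apply/measurable_fun_pair; [exact: measurable_snd|exact: measurable_fst].
Qed.

Lemma measurable_comp_fst (v : eucl R n -> R) : measurable_fun setT v ->
  measurable_fun setT (fun z => v z.1).
Proof.
move=> mv; apply: (@measurableT_comp _ _ _ _ _ _ v setT) => //; exact: measurable_fst.
Qed.

Lemma measurable_comp_snd (v : eucl R n -> R) : measurable_fun setT v ->
  measurable_fun setT (fun z => v z.2).
Proof.
move=> mv; apply: (@measurableT_comp _ _ _ _ _ _ v setT) => //; exact: measurable_snd.
Qed.

Lemma measurable_diff_powR (v : eucl R n -> R) (a : R) : measurable_fun setT v ->
  measurable_fun setT (fun z => `|v z.2 - v z.1| `^ a).
Proof.
move=> mv; apply: (@measurableT_comp _ _ _ _ _ _ (fun t : R => t `^ a) setT).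
  exact: measurable_powR.
apply: (@measurableT_comp _ _ _ _ _ _ (Num.norm : R -> R) setT) => //.
by apply: measurable_funB; [exact: measurable_comp_snd|exact: measurable_comp_fst].
Qed.

Lemma measurable_gagliardo v : measurable_fun setT v ->
  measurable_fun setT (fun z => (gagliardo v z)%:E).
Proof.
move=> mv; apply/measurable_EFinP; apply: measurable_funM; last exact: measurable_kernel_swap.
exact: measurable_diff_powR.
Qed.

Lemma gagliardoE v : measurable_fun setT v ->
  (\int[pi]_z (gagliardo v z)%:E =
   \int[mu]_y \int[mu]_x (`|v x - v y| `^ p * k x y)%:E)%E.
Proof.
move=> mv; rewrite fubini_tonelli1//; first exact: measurable_gagliardo.
by move=> z; rewrite lee_fin gagliardo_ge0.
Qed.

Lemma gagliardo_cutoff_le : (\int[pi]_z (gagliardo phi z)%:E <=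
  (@energy_const R n h m p s * (r `^ (2 * n%:R - q) *
     ((normh h x0 + 2 * r) ^+ M * (normh h x0 + 2 * r) ^+ M)))%:E)%E.
Proof.
apply: le_trans (cutoff_energy_le h_gt0 h_le_n p_gt1 s_gt0 gap x0 r_gt0).
apply: ge0_le_lower_integral => z _; first by rewrite lee_fin gagliardo_ge0.
by rewrite /gagliardo distrC (cc_kernel_sym m p s h_gt0 h_le_n).
Qed.

Hypothesis u_energy : (\int[pi]_z (gagliardo u z)%:E < +oo)%E.

Lemma gagliardo_test_lty : (\int[pi]_z (gagliardo test z)%:E < +oo)%E.
Proof.
have c0 : 0 <= test_const by rewrite mulr_ge0 ?addr_ge0 ?powR_ge0.
apply: (@le_lt_trans _ _ (\int[pi]_z
    (test_const%:E * ((gagliardo phi z)%:E + (gagliardo u z)%:E)))%E).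
  apply: ge0_le_lower_integral => z _; first by rewrite lee_fin gagliardo_ge0.
  rewrite -EFinD -EFinM lee_fin /gagliardo -mulrDl mulrA ler_wpM2r ?cc_kernel_ge0//.
  exact: test_diff_le.
have mphi : measurable_fun setT phi by exact: measurable_cutoff.
rewrite ge0_integralZl ?lee_fin//; last 2 first.
- by apply: emeasurable_funD; exact: measurable_gagliardo.
- by move=> z _; rewrite -EFinD lee_fin addr_ge0// gagliardo_ge0.
rewrite ge0_integralD//; last 4 first.
- by move=> z _; rewrite lee_fin gagliardo_ge0.
- exact: measurable_gagliardo.
- by move=> z _; rewrite lee_fin gagliardo_ge0.
- exact: measurable_gagliardo.
apply: lte_mul_pinfty; rewrite ?lee_fin//.
apply: lte_add_pinfty; last exact: u_energy.
by apply: le_lt_trans gagliardo_cutoff_le _; rewrite ltry.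
Qed.

Lemma test_frac_sobolev : frac_sobolev h m p s test.
Proof.
have mt := measurable_test.
split; last by rewrite -(gagliardoE mt); exact: gagliardo_test_lty.
apply/andP; split; rewrite inE//=.
rewrite /finite_norm unlock /=.
apply: poweR_lty.
apply: (@le_lt_trans _ _ (\int[mu]_x (((e `^ (1 - p)) `^ p)%:E * (\1_B' x)%:E))%E).
  apply: ge0_le_lower_integral => x _; first by rewrite lee_fin powR_ge0.
  rewrite -EFinM lee_fin ger0_norm ?test_ge0//.
  have := test_le x; rewrite indicE; case: (x \in B') => /= t1.
    rewrite mulr1 in t1; rewrite mulr1; apply: ge0_ler_powR => //; rewrite ?nnegrE ?test_ge0 ?powR_ge0//.
    exact: ltW.
  rewrite mulr0 in t1; have -> : test x = 0 by apply/eqP; rewrite eq_le t1 test_ge0.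
  by rewrite mulr0 powR0// gt_eqF.
have mB : measurable B' by exact: measurable_cc_ball.
rewrite ge0_integralZl ?lee_fin ?powR_ge0//; last first.
  by apply/measurable_EFinP; exact: measurable_indic.
rewrite integral_indic// setIT; apply: lte_mul_pinfty; rewrite ?lee_fin ?powR_ge0//.
by apply: le_lt_trans (volume_support m h_gt0 h_le_n x0 r_gt0) _; rewrite ltry.
Qed.

End test_function.

(** * The logarithmic estimate *)

Lemma add4_ge (R : realType) (a b c f : R) : 0 <= a -> 0 <= b -> 0 <= c -> 0 <= f ->
  [/\ 0 <= a + b + (c + f), a <= a + b + (c + f), b + c <= a + b + (c + f) &
      b + f <= a + b + (c + f)].
Proof. by move=> *; split; lra. Qed.

Section nonneg_integrals.
Context d (T : measurableType d) (R : realType).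
Variable nu : {measure set T -> \bar R}.

Lemma integral_comb (a b : R) (f t1 t2 : T -> R) : 0 <= a -> 0 <= b ->
  (forall x, (0 <= (f x)%:E)%E) -> (forall x, (0 <= (t1 x)%:E)%E) ->
  (forall x, (0 <= (t2 x)%:E)%E) ->
  measurable_fun setT (fun x => (f x)%:E) -> measurable_fun setT (fun x => (t1 x)%:E) ->
  measurable_fun setT (fun x => (t2 x)%:E) ->
  (\int[nu]_x (a%:E * (f x)%:E + b%:E * ((t1 x)%:E + (t2 x)%:E)) =
   a%:E * \int[nu]_x (f x)%:E + b%:E * (\int[nu]_x (t1 x)%:E + \int[nu]_x (t2 x)%:E))%E.
Proof.
rewrite -2!lee_fin => a0 b0 f0 t10 t20 mf m1 m2.
have t0 x : (0 <= (t1 x)%:E + (t2 x)%:E)%E by exact: adde_ge0.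
have mt : measurable_fun setT (fun x => ((t1 x)%:E + (t2 x)%:E)%E) by exact: emeasurable_funD.
rewrite ge0_integralD//; last 4 first.
- by move=> x _; exact: mule_ge0.
- exact: measurable_funeM.
- by move=> x _; exact: mule_ge0.
- exact: measurable_funeM.
rewrite ge0_integralZl// [X in (_ + X)%E = _]ge0_integralZl//.
by rewrite [X in (_ + _ * X)%E = _]ge0_integralD.
Qed.

(** Integrability of [f] lets its negative part be moved to the other side
    although the integrals of [l] and [g] may be infinite. *)
Lemma le_integral_absorb (l f g : T -> R) : nu.-integrable setT (fun x => (f x)%:E) ->
  (0 <= \int[nu]_x (f x)%:E)%E ->
  (forall x, (0 <= (l x)%:E)%E) -> (forall x, (0 <= (g x)%:E)%E) ->
  measurable_fun setT (fun x => (l x)%:E) -> measurable_fun setT (fun x => (g x)%:E) ->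
  {ae nu, forall x, l x + f x <= g x} ->
  (\int[nu]_x (l x)%:E <= \int[nu]_x (g x)%:E)%E.
Proof.
move=> intf If l0 g0 ml mg lfg.
have /integrableP[mf foo] := intf.
pose fp z : R := Num.max (f z) 0; pose fm z : R := Num.max (- f z) 0.
have fpm z : f z = fp z - fm z.
  by rewrite /fp /fm /Num.max oppr_lt0; case: ltrgt0P => [h1|h1|->]; rewrite ?subr0 ?sub0r ?opprK.
have fp0 z : (0 <= (fp z)%:E)%E by rewrite lee_fin le_max lexx orbT.
have fm0 z : (0 <= (fm z)%:E)%E by rewrite lee_fin le_max lexx orbT.
have mfR : measurable_fun setT f by apply/measurable_EFinP.
have mfp : measurable_fun setT (fun z => (fp z)%:E).
  by apply/measurable_EFinP; apply: measurable_maxr => //; exact: measurable_cst.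
have mfm : measurable_fun setT (fun z => (fm z)%:E).
  apply/measurable_EFinP; apply: measurable_maxr; last exact: measurable_cst.
  exact: measurable_funN.
have fpoo : (\int[nu]_z (fp z)%:E < +oo)%E.
  apply: le_lt_trans foo; apply: ge0_le_lower_integral => z _ //.
  by rewrite lee_fin ge_max ler_norm normr_ge0.
have fmoo : (\int[nu]_z (fm z)%:E < +oo)%E.
  apply: le_lt_trans foo; apply: ge0_le_lower_integral => z _ //.
  by rewrite lee_fin ge_max normr_ge0 andbT -normrN ler_norm.
have Ifp0 : (0 <= \int[nu]_z (fp z)%:E)%E by exact: integral_ge0.
have Ifm0 : (0 <= \int[nu]_z (fm z)%:E)%E by exact: integral_ge0.
have fpfin : (\int[nu]_z (fp z)%:E)%E \is a fin_num by rewrite ge0_fin_numE.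
have fmfin : (\int[nu]_z (fm z)%:E)%E \is a fin_num by rewrite ge0_fin_numE.
have fmp : (\int[nu]_z (fm z)%:E <= \int[nu]_z (fp z)%:E)%E.
  move: If; rewrite integralE.
  rewrite (eq_integral (fun z => (fp z)%:E)); last by move=> z _; rewrite funeposE -EFin_max.
  rewrite [X in (_ - X)%E](eq_integral (fun z => (fm z)%:E)); last first.
    by move=> z _; rewrite funenegE -EFinN -EFin_max.
  by rewrite sube_ge0// fmfin.
rewrite -(leeD2rE _ _ fpfin) -ge0_integralD//.
apply: (@le_trans _ _ (\int[nu]_z ((g z)%:E + (fm z)%:E))%E); last first.
  by rewrite ge0_integralD// leeD2l.
apply: ae_ge0_le_integral => //.
- by move=> z _; exact: adde_ge0.
- exact: emeasurable_funD.
- by move=> z _; exact: adde_ge0.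
- exact: emeasurable_funD.
have /ae_elim[N [mN N0 HN]] := lfg.
apply: (ae_intro mN N0) => z Nz _; have := HN z Nz.
by rewrite -!EFinD lee_fin fpm addrA lerBlDr.
Qed.

End nonneg_integrals.

Section logarithmic_estimate.
Context {R : realType} {n : nat}.
Variables (h m : nat) (p s : R).
Hypotheses (h_gt0 : (0 < h)%N) (h_le_n : (h <= n)%N).
Hypotheses (p_gt1 : 1 < p) (s_gt0 : 0 < s).
Local Notation M := (m * (n - h))%N.
Hypothesis gap : M%:R + s * p < p.
Local Notation d := (@cc_dist R n h m).
Local Notation mu := (@lebesgue_tuple R n).
Local Notation q := ((hom_dim n h m)%:R + s * p : R).
Local Notation k := (@cc_kernel R n h m p s).
Variables (u : eucl R n -> R) (x0 : eucl R n) (r R0 e : R).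
Hypotheses (r_gt0 : 0 < r) (e_gt0 : 0 < e) (rR0 : r <= R0 / 2).
Implicit Types (x y : eucl R n) (z : eucl R n * eucl R n).
Local Notation phi := (cutoff h m x0 r).
Local Notation eta := (test h m p u x0 r e).
Local Notation B := (cc_ball h m x0).
Local Notation B' := (cc_ball h m x0 (3 / 2 * r)).
Local Notation pi := (mu \x mu)%E.
Local Notation P := (normh h x0 + 2 * r).

Let p_gt0 : 0 < p. Proof. exact: lt_trans ltr01 p_gt1. Qed.

Let q_gt0 : 0 < q.
Proof. by rewrite ltr_wpDl// mulr_gt0. Qed.

Let B_sub_B' x : B r x -> B' x.
Proof.
rewrite /cc_ball/= => xr; apply: (lt_le_trans xr).
by rewrite -[leLHS]mul1r ler_wpM2r ?(ltW r_gt0)//; lra.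
Qed.

Let B'_sub_BR x : B' x -> B R0 x.
Proof.
rewrite /cc_ball/= => xr; apply: (lt_le_trans xr).
by have r0 := r_gt0; have rR := rR0; lra.
Qed.

Definition form x y : R := k x y * jmap p (u x - u y) * (eta x - eta y).
Definition log_density x y : R :=
  \1_(B r) x * (\1_(B r) y * (k x y * `|ln ((u x + e) / (u y + e))| `^ p)).
Definition tail_density x : R := \1_(~` B R0) x * ((u^\- x)%R `^ (p - 1) * k x x0).

Lemma formC x y : form x y = form y x.
Proof.
rewrite /form (cc_kernel_sym m p s h_gt0 h_le_n) -[u x - u y]opprB jmapN.
by rewrite -[eta x - eta y]opprB !mulrN mulNr opprK.
Qed.

Lemma tail_density_ge0 x : 0 <= tail_density x.
Proof. by rewrite !mulr_ge0 ?powR_ge0. Qed.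

Lemma log_density_ge0 x y : 0 <= log_density x y.
Proof. by rewrite !mulr_ge0 ?powR_ge0. Qed.

(** As [d x x0 < 3 / 4 * R0 <= 3 / 4 * d y x0], the triangle inequality gives
    [d y x0 <= 4 * d x y]. *)
Let kernel_far x y : B' x -> ~ B R0 y -> k x y <= 4 `^ q * k y x0.
Proof.
rewrite /cc_ball/= => xB' /negP; rewrite -leNgt => yB.
have r0 := r_gt0; have rR := rR0.
have dy : 0 < d y x0 by lra.
have tri := cc_dist_triangle m h_gt0 h_le_n y x x0.
have dxy : 4^-1 * d y x0 <= d x y by rewrite (cc_dist_sym m h_gt0 h_le_n x y); lra.
have d4 : 0 < 4^-1 * d y x0 by rewrite mulr_gt0.
have -> : 4 `^ q * k y x0 = (4^-1 * d y x0) `^ (- q).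
  rewrite powRM ?cc_dist_ge0// cc_kernelE; congr (_ * _).
  by rewrite -powR_inv1// -powRrM mulN1r opprK.
rewrite cc_kernelE !powRN lef_pV2 ?posrE ?powR_gt0//; last exact: lt_le_trans dxy.
by apply: ge0_ler_powR; rewrite ?nnegrE ?(ltW q_gt0) ?(ltW d4) ?cc_dist_ge0.
Qed.

Definition near_const : R := caccioppoli_const p + 2 `^ (p - 1).
Definition far_const : R := 2 `^ (p - 1) * e `^ (1 - p) * 4 `^ q.

Lemma near_const_ge0 : 0 <= near_const.
Proof. by rewrite addr_ge0 ?powR_ge0// caccioppoli_const_ge0. Qed.

Lemma far_const_ge0 : 0 <= far_const.
Proof. by rewrite !mulr_ge0 ?powR_ge0. Qed.

Let energy x y : R := `|phi x - phi y| `^ p * k x y.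

Let energy_ge0 x y : 0 <= energy x y.
Proof. by rewrite mulr_ge0 ?powR_ge0. Qed.

Let etaE x : 0 <= u x -> eta x = phi x `^ p * (u x + e) `^ (1 - p).
Proof. by move=> ux; rewrite /test max_l. Qed.

Let form_near x y : 0 <= u x -> 0 <= u y ->
  form x y <= caccioppoli_const p * energy x y.
Proof.
move=> ux uy; rewrite /form !etaE// /energy -mulrA [leRHS]mulrA [leRHS]mulrC.
rewrite ler_wpM2l ?cc_kernel_ge0//.
have -> : u x - u y = (u x + e) - (u y + e) by ring.
by apply: jmap_caccioppoli => //; rewrite ?ltr_wpDl//;
  have /andP[] := cutoff_itv h m x0 r x; have /andP[] := cutoff_itv h m x0 r y.
Qed.

Let form_log x y : 0 <= u x -> 0 <= u y -> B r x -> B r y ->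
  log_const p * (k x y * `|ln ((u x + e) / (u y + e))| `^ p) + form x y <= 0.
Proof.
move=> ux uy xB yB; rewrite /form !etaE// !cutoff_eq1// powR1 !mul1r.
have G (a b c f g : R) : a * (b * c) + b * f * g = b * (a * c + f * g) by ring.
rewrite G mulr_ge0_le0 ?cc_kernel_ge0//.
have -> : u x - u y = (u x + e) - (u y + e) by ring.
by apply: jmap_log => //; rewrite ltr_wpDl.
Qed.

Let form_far x y : 0 <= u x -> ~ B R0 y ->
  form x y <= 2 `^ (p - 1) * energy x y + far_const * (\1_B' x * tail_density y).
Proof.
move=> ux yB.
have phiy : phi y = 0 by apply: cutoff_eq0 => // yB'; apply: yB; exact: B'_sub_BR.
have etay : eta y = 0 by apply: test_eq0 => // yB'; apply: yB; exact: B'_sub_BR.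
have rhs0 : 0 <= 2 `^ (p - 1) * energy x y + far_const * (\1_B' x * tail_density y).
  by rewrite addr_ge0// !mulr_ge0 ?far_const_ge0 ?tail_density_ge0 ?powR_ge0.
have [xB'|xB'] := pselect (B' x); last first.
  by apply: le_trans rhs0; rewrite /form etay test_eq0// subr0 mulr0.
have /andP[phi0 phi1] := cutoff_itv h m x0 r x.
rewrite /form etay subr0 etaE// /energy phiy subr0 ger0_norm//.
have := @jmap_far R p p_gt1 (u x) (u y) e (phi x) ux e_gt0 phi0.
set J := jmap _ _ * _ => HJ.
apply: (@le_trans _ _ (k x y * (2 `^ (p - 1) * (phi x `^ p *
    (1 + e `^ (1 - p) * Num.max (- u y) 0 `^ (p - 1)))))).
  by rewrite -mulrA ler_wpM2l ?cc_kernel_ge0.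
rewrite indicE mem_set// mul1r /tail_density indicE mem_set// mul1r.
have -> : (u^\- y)%R = Num.max (- u y) 0 by [].
set T := Num.max (- u y) 0 `^ (p - 1).
have T0 : 0 <= T by exact: powR_ge0.
have phip : phi x `^ p <= 1.
  apply: (@le_trans _ _ (1 `^ p)); last by rewrite powR1.
  by apply: ge0_ler_powR; rewrite ?nnegrE// ltW.
have kf := kernel_far xB' yB.
have G (K K' A E F C : R) : 0 <= A -> 0 <= E -> 0 <= K -> F <= 1 -> K <= C * K' ->
    K * (A * (F * (1 + E * T))) <= A * (F * K) + A * E * C * (T * K').
  move=> A0 E0 K0 F1 KK'; have FK : F * K <= C * K' by rewrite (le_trans _ KK')// ler_piMl.
  rewrite (_ : _ * (A * _) = A * (F * K) + A * E * T * (F * K)); last by ring.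
  rewrite lerD2l (_ : A * E * C * _ = A * E * T * (C * K')); last by ring.
  by rewrite ler_wpM2l// !mulr_ge0.
by apply: G; rewrite ?powR_ge0// cc_kernel_ge0.
Qed.

(** If both points lie in the large ball, the form is at most a multiple of the
    energy of the cut-off, and if both lie in the small one, its negative compensates the
    logarithm. If one of them lies outside the large ball, the tail appears; if
    both do, the test function vanishes at both. *)
Lemma pointwise_estimate x y : (B R0 x -> 0 <= u x) -> (B R0 y -> 0 <= u y) ->
  log_const p * log_density x y + form x y <=
  near_const * energy x y +
    far_const * (\1_B' x * tail_density y + \1_B' y * tail_density x).
Proof.
move=> Hx Hy.
have T1 : 0 <= \1_B' x * tail_density y by rewrite mulr_ge0// tail_density_ge0.
have T2 : 0 <= \1_B' y * tail_density x by rewrite mulr_ge0// tail_density_ge0.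
have c0 := far_const_ge0; have cc0 := caccioppoli_const_ge0 p_gt1.
have E0 := energy_ge0 x y; have pow0 := powR_ge0 (2 : R) (p - 1).
have fT1 := mulr_ge0 c0 T1; have fT2 := mulr_ge0 c0 T2.
have cE := mulr_ge0 cc0 E0; have pE := mulr_ge0 pow0 E0.
have B_sub x' : B r x' -> B R0 x' by move=> /B_sub_B'/B'_sub_BR.
have log0 : ~ (B r x /\ B r y) -> log_density x y = 0.
  move=> H; rewrite /log_density !indicE.
  case: (boolP (x \in B r)) => [xB|_]; last by rewrite mul0r.
  case: (boolP (y \in B r)) => [yB|_]; last by rewrite mul0r mulr0.
  by exfalso; apply: H; split; [rewrite inE in xB|rewrite inE in yB].
have log1 : B r x -> B r y -> log_density x y = k x y * `|ln ((u x + e) / (u y + e))| `^ p.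
  move=> xB yB; rewrite /log_density !indicE (mem_set xB) (mem_set yB).
  by rewrite [LHS]mul1r mul1r.
rewrite /near_const mulrDl mulrDr.
have [s0 s1 s2 s3] := add4_ge cE pE fT1 fT2.
have [xR|xR] := pselect (B R0 x); have [yR|yR] := pselect (B R0 y).
- have [[xB yB]|H] := pselect (B r x /\ B r y).
    by rewrite log1//; exact: le_trans (form_log (Hx xR) (Hy yR) xB yB) s0.
  rewrite (log0 H) mulr0 add0r; exact: le_trans (form_near (Hx xR) (Hy yR)) s1.
- rewrite log0; last by move=> [_ /B_sub].
  rewrite mulr0 add0r; exact: le_trans (form_far (Hx xR) yR) s2.
- rewrite log0; last by move=> [/B_sub].
  rewrite mulr0 add0r formC; apply: le_trans (form_far (Hy yR) xR) _.
  have -> : energy y x = energy x y.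
    by rewrite /energy distrC (cc_kernel_sym m p s h_gt0 h_le_n).
  exact: s3.
- rewrite log0; last by move=> [/B_sub].
  have etax : eta x = 0 by apply: test_eq0 => // /B'_sub_BR.
  have etay : eta y = 0 by apply: test_eq0 => // /B'_sub_BR.
  by rewrite /form etax etay subr0 !mulr0 addr0; exact: s0.
Qed.

Hypothesis mu_u : measurable_fun setT u.
Hypothesis u_energy : (\int[pi]_z (gagliardo h m p s u z)%:E < +oo)%E.
Hypothesis u_ge0 : {ae mu, forall x, B R0 x -> 0 <= u x}.
Hypothesis supersolution :
  (0 <= \int[mu]_y \int[mu]_x (k x y * (`|u x - u y| `^ (p - 2) * (u x - u y)) *
     (eta x - eta y))%:E)%E.

Let formz z : R := form z.2 z.1.

Let measurable_formz : measurable_fun setT (fun z => (formz z)%:E).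
Proof.
have meta : measurable_fun setT eta by exact: measurable_test.
have md (v : eucl R n -> R) : measurable_fun setT v ->
    measurable_fun setT (fun z : eucl R n * eucl R n => v z.2 - v z.1).
  by move=> mv; apply: measurable_funB; [exact: measurable_comp_snd|exact: measurable_comp_fst].
apply/measurable_EFinP; apply: measurable_funM; last exact: md.
apply: measurable_funM; first exact: measurable_kernel_swap.
apply: measurable_funM; last exact: md.
exact: measurable_diff_powR.
Qed.

Let young (a b : R) : 0 <= a -> 0 <= b -> a `^ (p - 1) * b <= a `^ p + b `^ p.
Proof.
move=> a0 b0; have p10 : 0 <= p - 1 by rewrite subr_ge0 ltW.
have [ab|/ltW ba] := leP a b.
  apply: (@le_trans _ _ (b `^ p)); last by rewrite lerDr powR_ge0.
  rewrite -(@mulr_powRB1 _ b p)// mulrC ler_wpM2l//.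
  by apply: ge0_ler_powR; rewrite ?nnegrE.
apply: (@le_trans _ _ (a `^ p)); last by rewrite lerDl powR_ge0.
by rewrite -(@mulr_powRB1 _ a p)// mulrC ler_wpM2r ?powR_ge0.
Qed.

Let formz_le z : `|formz z| <= gagliardo h m p s u z + gagliardo h m p s eta z.
Proof.
rewrite /formz /form normrM normrM norm_jmap// (ger0_norm (cc_kernel_ge0 _ _ _ _ _ _)).
rewrite /gagliardo -mulrDl -mulrA mulrC ler_wpM2r ?cc_kernel_ge0//.
exact: young.
Qed.

(** By Young's inequality the energies of [u] and [eta] dominate the form. *)
Let integrable_formz : pi.-integrable setT (fun z => (formz z)%:E).
Proof.
apply/integrableP; split => //.
have meta : measurable_fun setT eta by exact: measurable_test.
apply: (@le_lt_trans _ _ (\int[pi]_z ((gagliardo h m p s u z)%:E +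
    (gagliardo h m p s eta z)%:E))%E).
  apply: ge0_le_lower_integral => z _ //; rewrite -EFinD lee_fin; exact: formz_le.
rewrite ge0_integralD//; last 4 first.
- by move=> z _; rewrite lee_fin gagliardo_ge0.
- exact: measurable_gagliardo.
- by move=> z _; rewrite lee_fin gagliardo_ge0.
- exact: measurable_gagliardo.
by apply: lte_add_pinfty; [exact: u_energy|exact: gagliardo_test_lty].
Qed.

Let formz_ge0 : (0 <= \int[pi]_z (formz z)%:E)%E.
Proof. by rewrite -(integral12_prod_meas1 integrable_formz); exact: supersolution. Qed.

Let logz z : R := log_density z.2 z.1.
Let rhs z : R := near_const * energy z.2 z.1 +
    far_const * (\1_B' z.2 * tail_density z.1 + \1_B' z.1 * tail_density z.2).

(** The exceptional set of [u] gives two null strips in the product. *)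
Let ae_pointwise : {ae pi, forall z, log_const p * logz z + formz z <= rhs z}.
Proof.
have /ae_elim[N [mN N0 HN]] := u_ge0.
have mNT : measurable (N `*` setT : set (eucl R n * eucl R n)) by exact: measurableX.
have mTN : measurable (setT `*` N : set (eucl R n * eucl R n)) by exact: measurableX.
have e1 : pi (N `*` setT) = 0%E by rewrite product_measure1E// N0 mul0e.
have e2 : pi (setT `*` N) = 0%E by rewrite product_measure1E// N0 mule0.
have [C [mC C0 NC]] : pi.-negligible ((N `*` setT) `|` (setT `*` N)).
  by apply: negligibleU; [exists (N `*` setT); split|exists (setT `*` N); split].
apply: (ae_intro mC C0) => -[y x] zC; apply: pointwise_estimate.
  by apply: HN => Nx; apply: zC; apply: NC; right.
by apply: HN => Ny; apply: zC; apply: NC; left.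
Qed.

Let measurable_ball_indic (A : set (eucl R n)) : measurable A ->
  measurable_fun setT (fun x => \1_A x : R).
Proof. by move=> mA; exact: measurable_indic. Qed.

Let measurable_inv (v : eucl R n * eucl R n -> R) : measurable_fun setT v ->
  measurable_fun setT (fun z => (v z)^-1).
Proof.
move=> mv; rewrite (_ : (fun z => (v z)^-1) = (fun z => v z * (`|v z|^-1) ^+ 2)).
  apply: measurable_funM => //; apply: measurable_funX.
  apply: (@measurableT_comp _ _ _ _ _ _ (fun t : R => `|t|^-1) setT) => //.
  exact: measurable_invr.
apply/funext => z; have [->|v0] := eqVneq (v z) 0; first by rewrite invr0 mul0r.
by rewrite exprVn real_normK ?num_real// expr2 invfM mulrA divff// mul1r.
Qed.

Let measurable_logz : measurable_fun setT (fun z => (logz z)%:E).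
Proof.
have mB : measurable (B r) by exact: measurable_cc_ball.
apply/measurable_EFinP; apply: measurable_funM.
  by apply: measurable_comp_snd; exact: measurable_ball_indic.
apply: measurable_funM.
  by apply: measurable_comp_fst; exact: measurable_ball_indic.
apply: measurable_funM; first exact: measurable_kernel_swap.
apply: (@measurableT_comp _ _ _ _ _ _ (fun t : R => t `^ p) setT).
  exact: measurable_powR.
apply: (@measurableT_comp _ _ _ _ _ _ (Num.norm : R -> R) setT) => //.
apply: (@measurableT_comp _ _ _ _ _ _ (@ln R) setT); first exact: measurable_ln.
apply: measurable_funM; last apply: measurable_inv;
  apply: measurable_funD => //.
- exact: measurable_comp_snd.
- exact: measurable_comp_fst.
Qed.

Let measurable_tail : measurable_fun setT (fun x => (tail_density x)%:E).
Proof.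
apply/measurable_EFinP; apply: measurable_funM.
  by apply: measurable_ball_indic; apply: measurableC; exact: measurable_cc_ball.
apply: measurable_funM.
  apply: (@measurableT_comp _ _ _ _ _ _ (fun t : R => t `^ (p - 1)) setT).
    exact: measurable_powR.
  exact: measurable_funrneg.
apply: (@measurableT_comp _ _ _ _ _ _ (fun t : R => t `^ (- q)) setT).
  exact: measurable_powR.
exact: measurable_cc_distl.
Qed.

Let tail_part z : R := \1_B' z.2 * tail_density z.1.
Let tail_part' z : R := \1_B' z.1 * tail_density z.2.

Let tail_part_ge0 z : (0 <= (tail_part z)%:E)%E.
Proof. by rewrite lee_fin mulr_ge0// tail_density_ge0. Qed.

Let tail_part'_ge0 z : (0 <= (tail_part' z)%:E)%E.
Proof. by rewrite lee_fin mulr_ge0// tail_density_ge0. Qed.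

Let measurable_support_indic : measurable_fun setT (fun x => \1_B' x : R).
Proof. by apply: measurable_ball_indic; exact: measurable_cc_ball. Qed.

Let measurable_tail_part : measurable_fun setT (fun z => (tail_part z)%:E).
Proof.
apply/measurable_EFinP; apply: measurable_funM; first exact: measurable_comp_snd.
by apply: measurable_comp_fst; apply/measurable_EFinP; exact: measurable_tail.
Qed.

Let measurable_tail_part' : measurable_fun setT (fun z => (tail_part' z)%:E).
Proof.
apply/measurable_EFinP; apply: measurable_funM; first exact: measurable_comp_fst.
by apply: measurable_comp_snd; apply/measurable_EFinP; exact: measurable_tail.
Qed.

Let measurable_tails :
  measurable_fun setT (fun z => ((tail_part z)%:E + (tail_part' z)%:E)%E).
Proof. exact (emeasurable_funD measurable_tail_part measurable_tail_part'). Qed.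

Definition tail_integral : \bar R := (\int[mu]_x (tail_density x)%:E)%E.

Lemma tail_integral_ge0 : (0 <= tail_integral)%E.
Proof. by apply: integral_ge0 => x _; rewrite lee_fin tail_density_ge0. Qed.

Let tail_slice (a : R) : 0 <= a ->
  (\int[mu]_x (\1_B' x * a)%:E = a%:E * mu B')%E.
Proof.
move=> a0; have mB : measurable B' by exact: measurable_cc_ball.
under eq_integral do rewrite mulrC EFinM.
rewrite ge0_integralZl ?lee_fin//; last first.
  by apply/measurable_EFinP; exact: measurable_support_indic.
by rewrite integral_indic// setIT.
Qed.

Let tail_slices : (\int[mu]_y ((tail_density y)%:E * mu B') = mu B' * tail_integral)%E.
Proof.
under eq_integral do rewrite muleC.
rewrite ge0_integralZl// => x _; by rewrite lee_fin tail_density_ge0.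
Qed.

Let tail_partE : (\int[pi]_z (tail_part z)%:E = mu B' * tail_integral)%E.
Proof.
rewrite (fubini_tonelli1 _ measurable_tail_part tail_part_ge0) -tail_slices.
apply: eq_integral => y _; exact: tail_slice (tail_density_ge0 y).
Qed.

Let tail_part'E : (\int[pi]_z (tail_part' z)%:E = mu B' * tail_integral)%E.
Proof.
rewrite (fubini_tonelli2 _ measurable_tail_part' tail_part'_ge0) -tail_slices.
apply: eq_integral => y _; exact: tail_slice (tail_density_ge0 y).
Qed.

Let rhsE z : (rhs z)%:E = ((near_const)%:E * (gagliardo h m p s phi z)%:E +
   far_const%:E * ((tail_part z)%:E + (tail_part' z)%:E))%E.
Proof. by []. Qed.

Let measurable_gphi : measurable_fun setT (fun z => (gagliardo h m p s phi z)%:E).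
Proof. by apply: measurable_gagliardo => //; exact: measurable_cutoff. Qed.

Let measurable_rhs : measurable_fun setT (fun z => (rhs z)%:E).
Proof.
rewrite (_ : (fun z => (rhs z)%:E) = fun z => (near_const%:E * (gagliardo h m p s phi z)%:E +
   far_const%:E * ((tail_part z)%:E + (tail_part' z)%:E))%E); last exact: funext rhsE.
apply: emeasurable_funD; first by apply: measurable_funeM; exact: measurable_gphi.
by apply: measurable_funeM; exact: measurable_tails.
Qed.

Let gphi_ge0 z : (0 <= (gagliardo h m p s phi z)%:E)%E.
Proof. by rewrite lee_fin gagliardo_ge0. Qed.

Let rhs_ge0 z : (0 <= (rhs z)%:E)%E.
Proof.
rewrite lee_fin /rhs addr_ge0// mulr_ge0 ?near_const_ge0 ?far_const_ge0//.
by rewrite addr_ge0// mulr_ge0// tail_density_ge0.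
Qed.

Let rhs_le : (\int[pi]_z (rhs z)%:E <=
  (near_const * (@energy_const R n h m p s * (r `^ (2 * n%:R - q) * (P ^+ M * P ^+ M))))%:E +
  (far_const * (2 * (@support_const R n h m * (r ^+ n * P ^+ M))))%:E * tail_integral)%E.
Proof.
rewrite (eq_integral _ _ (fun z _ => rhsE z)).
rewrite (integral_comb pi near_const_ge0 far_const_ge0 gphi_ge0 tail_part_ge0
  tail_part'_ge0 measurable_gphi measurable_tail_part measurable_tail_part').
rewrite tail_partE tail_part'E.
have T0 := tail_integral_ge0.
have vB := volume_support m h_gt0 h_le_n x0 r_gt0.
set V := @support_const R n h m * _ in vB *.
have V0 : (0 <= V%:E)%E by exact: le_trans (measure_ge0 _ _) vB.
have N0 : (0 <= near_const%:E)%E by rewrite lee_fin near_const_ge0.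
have F0 : (0 <= far_const%:E)%E by rewrite lee_fin far_const_ge0.
apply: leeD.
  rewrite (EFinM near_const); apply: (lee_wpmul2l N0); exact: gagliardo_cutoff_le.
rewrite (EFinM far_const) -muleA; apply: (lee_wpmul2l F0).
have -> : ((2 * V)%:E = V%:E + V%:E)%E by rewrite mulr_natl mulr2n EFinD.
rewrite (ge0_muleDl _ V0 V0).
by apply: leeD; exact: (lee_wpmul2r T0 vB).
Qed.

Let log_integral_le : ((log_const p)%:E * \int[pi]_z (logz z)%:E <=
  \int[pi]_z (rhs z)%:E)%E.
Proof.
have lc0 : (0 <= (log_const p)%:E)%E by rewrite lee_fin (ltW (log_const_gt0 p_gt1)).
have l0 z : (0 <= (logz z)%:E)%E by rewrite lee_fin log_density_ge0.
have ml : measurable_fun setT (fun z => (log_const p * logz z)%:E).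
  apply/measurable_EFinP; apply: measurable_funM; first exact: measurable_cst.
  by apply/measurable_EFinP; exact: measurable_logz.
rewrite -(ge0_integralZl pi measurableT measurable_logz (fun z _ => l0 z) lc0).
apply: (le_integral_absorb integrable_formz formz_ge0 _ rhs_ge0 ml measurable_rhs ae_pointwise).
move=> z; exact: (mule_ge0 lc0 (l0 z)).
Qed.

Let log_doubleE : (\int[mu]_(y in B r) \int[mu]_(x in B r)
    (k x y * `|ln ((u x + e) / (u y + e))| `^ p)%:E = \int[pi]_z (logz z)%:E)%E.
Proof.
have l0 z : (0 <= (logz z)%:E)%E by rewrite lee_fin log_density_ge0.
rewrite (fubini_tonelli1 _ measurable_logz l0) [LHS]integral_mkcond.
apply: eq_integral => y _; rewrite /fubini_F /patch.
case: (boolP (y \in B r)) => yB.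
  rewrite [LHS]integral_mkcond; apply: eq_integral => x _.
  rewrite /logz /log_density /= /patch !indicE yB.
  by case: (x \in B r); rewrite ?mul1r ?mul0r// [LHS]mul1r.
apply/esym/integral0_eq => x _.
by rewrite /logz /log_density /= !indicE (negbTE yB) mul0r mulr0.
Qed.

Lemma logarithmic_estimate :
  ((log_const p)%:E * \int[mu]_(y in B r) \int[mu]_(x in B r)
    (k x y * `|ln ((u x + e) / (u y + e))| `^ p)%:E <=
  (near_const * (@energy_const R n h m p s * (r `^ (2 * n%:R - q) * (P ^+ M * P ^+ M))))%:E +
  (far_const * (2 * (@support_const R n h m * (r ^+ n * P ^+ M))))%:E * tail_integral)%E.
Proof.
by rewrite log_doubleE; exact: le_trans log_integral_le rhs_le.
Qed.

Lemma tail_integralE : 1 < p -> 0 < R0 ->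
  (nonlocal_tail h m p s (u^\-)%R x0 R0 `^ (p - 1) = (R0 `^ (s * p))%:E * tail_integral)%E.
Proof.
move=> p1 R00; rewrite /nonlocal_tail -poweRrM mulVf ?subr_eq0 ?gt_eqF//.
rewrite poweRe1.
  congr (_ * _)%E; rewrite integral_mkcond; apply: eq_integral => x _.
  rewrite /patch /tail_density indicE; case: (x \in _); last by rewrite mul0r.
  by rewrite mul1r ger0_norm// /funrneg le_max lexx orbT.
apply: mule_ge0; first by rewrite lee_fin powR_ge0.
by apply: integral_ge0 => x _; rewrite lee_fin mulr_ge0 ?powR_ge0.
Qed.

End logarithmic_estimate.

(** * Choice of the constant *)

Lemma le_affine_divl (R : realType) (L a b A B : R) (I T : \bar R) :
  0 < L -> (0 <= T)%E -> (L%:E * I <= a%:E + b%:E * T)%E ->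
  a <= L * A -> b <= L * B -> 0 <= A -> 0 <= B -> (I <= A%:E + B%:E * T)%E.
Proof.
move=> L0 T0 LI aA bB A0 B0.
rewrite -(@lee_pmul2l _ L%:E) ?lte_fin//; apply: (le_trans LI).
rewrite ge0_muleDr ?lee_fin//; last by rewrite mule_ge0 ?lee_fin.
rewrite muleA -!EFinM; apply: leeD; first by rewrite lee_fin.
by apply: lee_wpmul2r => //; rewrite lee_fin.
Qed.

Lemma powR_scaling (R : realType) (n : nat) (r R0 t Q : R) : 0 < r -> 0 < R0 ->
  r `^ (2 * n%:R - Q - t) * ((r / R0) `^ t * r `^ (Q - n%:R) * R0 `^ t) = r ^+ n.
Proof.
move=> r0 R00.
have -> : (r / R0) `^ t = r `^ t * (R0 `^ t)^-1.
  rewrite powRM ?invr_ge0 ?(ltW r0) ?(ltW R00)//; congr (_ * _).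
  by rewrite -powR_inv1 ?(ltW R00)// -powRrM mulN1r powRN.
have R1 : R0 `^ t != 0 by rewrite gt_eqF// powR_gt0.
rewrite (_ : r `^ t * (R0 `^ t)^-1 * r `^ (Q - n%:R) * R0 `^ t = r `^ t * r `^ (Q - n%:R)); last first.
  by field.
have rne : r != 0 by rewrite gt_eqF.
rewrite -!powRD; try by apply/implyP => _.
rewrite -powR_mulrn ?(ltW r0)//; congr (_ `^ _); by ring.
Qed.

Theorem theorem1p4 (R : realType) (n h m : nat) (p s : R)
    (h_gt0 : (0 < h)%N) (h_le_n : (h <= n)%N)
    (Q_lt_2n : (hom_dim n h m < 2 * n)%N)
    (p_gt : Num.max (m * (n - h))%:R 1 < p)
    (s_gt0 : 0 < s) (s_lt : s < 1 - (m * (n - h))%:R / p) :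
  let Q : R := (hom_dim n h m)%:R in
  exists2 c : R, 0 < c &
    forall (Omega : set (eucl R n)) (g u : eucl R n -> R) (x0 : eucl R n)
        (R0 r d : R),
      cc_open h m Omega -> cc_bounded h m Omega ->
      weak_supersolution h m p s Omega g u ->
      0 < R0 -> cc_ball h m x0 R0 `<=` Omega ->
      {ae lebesgue_tuple n, forall x, cc_ball h m x0 R0 x -> 0 <= u x} ->
      0 < r -> cc_ball h m x0 r `<=` cc_ball h m x0 (R0 / 2) ->
      0 < d ->
      (\int[lebesgue_tuple n]_(y in cc_ball h m x0 r)
         \int[lebesgue_tuple n]_(x in cc_ball h m x0 r)
           (cc_kernel h m p s x y * `|ln ((u x + d) / (u y + d))| `^ p)%:E
       <= (c * r `^ (2 * n%:R - Q - s * p)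
             * (normh h x0 + 2 * r) ^+ (m * (n - h)))%:E
          * ((d `^ (1 - p) * (r / R0) `^ (s * p) * r `^ (Q - n%:R))%:E
               * nonlocal_tail h m p s (u^\-)%R x0 R0 `^ (p - 1)
             + ((normh h x0 + 2 * r) ^+ (m * (n - h)))%:E))%E.
Proof.
move=> Q.
have /andP[Mp p_gt1] : ((m * (n - h))%:R < p) && (1 < p).
  by move: p_gt; rewrite gt_max.
have p_gt0 : 0 < p by exact: lt_trans ltr01 p_gt1.
have gap : (m * (n - h))%:R + s * p < p.
  move: s_lt; rewrite -(ltr_pM2r p_gt0) mulrBl mul1r divfK ?gt_eqF//.
  by rewrite ltrBrDr addrC.
have L0 := log_const_gt0 p_gt1.
pose K1 : R := near_const p * @energy_const R n h m p s.
pose F : R := 2 `^ (p - 1) * 4 `^ (Q + s * p).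
pose K2 : R := F * 2 * @support_const R n h m.
(* absolute values make [c] positive and at least both quotients *)
pose c : R := (`|K1| + `|K2|) / log_const p + 1.
have c0 : 0 < c by rewrite ltr_wpDl// divr_ge0 ?addr_ge0// ltW.
have K1c : K1 <= log_const p * c.
  rewrite /c mulrDr mulrC divfK ?gt_eqF// mulr1 -addrA.
  by apply: (le_trans (ler_norm _)); rewrite lerDl addr_ge0// ltW.
have K2c : K2 <= log_const p * c.
  rewrite /c mulrDr mulrC divfK ?gt_eqF// mulr1 -addrA addrCA.
  by apply: (le_trans (ler_norm _)); rewrite lerDl addr_ge0// ltW.
exists c => // Omega g u x0 R0 r d _ _ [_ [Lu eu] _ weak] R00 subO u0 r0 subR d0.
have mu_u : measurable_fun setT u by have := sub_Lfun_mfun Lu; rewrite inE.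
have R02 : 0 < R0 / 2 by rewrite divr_gt0.
have rR := cc_ball_radius_le h_gt0 h_le_n R02 subR.
rewrite -gagliardoE// in eu.
have supersol : (0 <= \int[lebesgue_tuple n]_y \int[lebesgue_tuple n]_x
    (cc_kernel h m p s x y * (`|u x - u y| `^ (p - 2) * (u x - u y)) *
     (test h m p u x0 r d x - test h m p u x0 r d y))%:E)%E.
  apply: weak.
    split; first exact: test_frac_sobolev.
    apply: (ae_intro measurable0 (measure0 _)) => x _ xO.
    apply: (test_eq0 p_gt1) => // xB; apply: xO; apply: subO.
    by apply: (lt_le_trans xB); clear - rR R00 r0; lra.
  by apply: (ae_intro measurable0 (measure0 _)) => x _; exact: test_ge0.
have := logarithmic_estimate h_gt0 h_le_n p_gt1 s_gt0 gap r0 d0 rR mu_u eu u0 supersol.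
rewrite (tail_integralE h m s u x0 p_gt1 R00).
set I := (\int[_]_(y in _) _)%E; set T := tail_integral _ _ _ _ _ _ _.
have T0 : (0 <= T)%E by exact: tail_integral_ge0.
set P := normh h x0 + 2 * r; set M := (m * (n - h))%N.
have P0 : 0 <= P ^+ M by rewrite exprn_ge0// addr_ge0 ?normh_ge0// mulr_ge0 ?(ltW r0).
have -> : 2 * n%:R - ((hom_dim n h m)%:R + s * p) = 2 * n%:R - Q - s * p by rewrite opprD addrA.
have scal := powR_scaling n (s * p) Q r0 R00.
set rho := r `^ (2 * n%:R - Q - s * p) in scal *.
have rho0 : 0 <= rho by exact: powR_ge0.
move=> LI.
have D0 : 0 <= d `^ (1 - p) by exact: powR_ge0.
have rn0 : 0 <= r ^+ n by rewrite exprn_ge0// ltW.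
have key : (I <= (c * rho * (P ^+ M * P ^+ M))%:E + (c * d `^ (1 - p) * (r ^+ n * P ^+ M))%:E * T)%E.
  apply: (le_affine_divl L0 T0 LI).
  - rewrite (_ : near_const p * _ = K1 * (rho * (P ^+ M * P ^+ M))); last by rewrite mulrA.
    rewrite (_ : _ * (c * _ * _) = log_const p * c * (rho * (P ^+ M * P ^+ M))); last first.
      by rewrite !mulrA.
    by rewrite ler_wpM2r// !mulr_ge0.
  - rewrite (_ : far_const h m p s d * _ = K2 * (d `^ (1 - p) * (r ^+ n * P ^+ M))); last first.
      by rewrite /far_const /K2 /F; have G (a b f t v : R) : a * b * f * (2 * (t * v)) = a * f * 2 * t * (b * v)
        by [ring]; exact: G.
    rewrite (_ : _ * (c * _ * _) = log_const p * c * (d `^ (1 - p) * (r ^+ n * P ^+ M))); last first.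
      by rewrite !mulrA.
    by rewrite ler_wpM2r// !mulr_ge0.
  - by rewrite !mulr_ge0// ltW.
  - by rewrite !mulr_ge0// ltW.
move: (I) (T) T0 key => {LI supersol T} {}I T T0 key.
apply: (le_trans key); rewrite muleA -EFinM ge0_muleDr ?lee_fin//; last first.
  by rewrite mule_ge0// lee_fin !mulr_ge0 ?powR_ge0.
rewrite addeC muleA -!EFinM -scal.
rewrite le_eqVlt; apply/orP; left; apply/eqP; congr (_%:E * _ + _%:E)%E.
  have G (a1 a2 a3 b1 b2 b3 b4 : R) : a1 * a3 * (b1 * (b2 * b3 * b4) * a2) =
    a1 * b1 * a2 * (a3 * b2 * b3 * b4) by ring.
  exact: G.
by rewrite mulrA.
Qed.
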